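(* For any integer $d\geq 3$, there exist a sequence $(\varepsilon_t)_{t=1}^\infty$ of non-negative real numbers and a sequence $(\gamma_t)_{t=1}^\infty$ of curves such that, for each $t$, $\gamma_t$ is an $\varepsilon_t$-approximate $t$-design curve on $S^d$, and such that, as $t\to\infty$, $\ell(\gamma_t)\asymp t^{d-1}$ if $d$ is odd, $\ell(\gamma_t)\asymp t^{2d-3}$ if $d$ is even, and $\varepsilon_t\asymp 1/t$.
   Context: $S^d\subset\mathbb R^{d+1}$ is the unit sphere. $P_t(S^d)$ is the space of restrictions to $S^d$ of real-valued polynomials on $\mathbb R^{d+1}$ of degree at most $t$. $\sigma$ is the uniform measure on $S^d$, normalized so that $\sigma(S^d)=1$. For a curve $\gamma:[0,1]\to S^d$, write $\int_\gamma f:=\int_0^1 f(\gamma(s))|\gamma'(s)|\,ds$ and let $\ell(\gamma):=\int_\gamma 1$ be its length. For $t\in\mathbb N=\{0,1,\dots\}$, $\varepsilon\ge 0$ and $c>0$, a continuous, piecewise smooth, closed curve $\gamma:[0,1]\to S^d$ with finitely many self-intersections is an $(\varepsilon,c)$-approximate $t$-design curve if $$\left|c\int_\gamma f-\int_{S^d}f\,d\sigma\right|\le\varepsilon\sup_{S^d}|f|\quad\text{for all } f\in P_t(S^d).$$ If $c=1/\ell(\gamma)$, then $\gamma$ is called an $\varepsilon$-approximate $t$-design curve. For sequences of positive reals, $a_t\asymp b_t$ as $t\to\infty$ means that $a_t/b_t$ is bounded above and bounded away from $0$ for all sufficiently large $t$. *)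

(* Defs.v *)
From HB Require Import structures.
From mathcomp Require Import all_boot all_order all_algebra.
From mathcomp Require mpoly.
From mathcomp Require Import all_classical all_reals all_analysis.
From mathcomp Require Import measurable_realfun ring lra.

Set Implicit Arguments.
Unset Strict Implicit.
Unset Printing Implicit Defensive.

Import Order.TTheory GRing.Theory Num.Theory.
Import numFieldNormedType.Exports.

Local Open Scope classical_set_scope.
Local Open Scope ring_scope.

(* 'rV[R]_n carries the product sigma-algebra, which is the Borel one. *)
Definition measure_rV_display : measure_display. Proof. exact: default_measure_display. Qed.

Section measurable_rV.
Context {R : realType} (n : nat).

Definition rV_coord (i : 'I_n) (x : 'rV[R]_n) : measurableTypeR R := x ord0 i.

Let rV_set0 : g_sigma_preimage rV_coord set0.
Proof. exact: sigma_algebra0. Qed.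

Let rV_setC A : g_sigma_preimage rV_coord A -> g_sigma_preimage rV_coord (~` A).
Proof. exact: sigma_algebraC. Qed.

Let rV_bigcup (F : (set 'rV[R]_n)^nat) :
  (forall i, g_sigma_preimage rV_coord (F i)) ->
  g_sigma_preimage rV_coord (\bigcup_i (F i)).
Proof. exact: sigma_algebra_bigcup. Qed.

HB.instance Definition _ := @isMeasurable.Build measure_rV_display
  'rV[R]_n (g_sigma_preimage rV_coord) rV_set0 rV_setC rV_bigcup.

Lemma measurable_rV_coord (i : 'I_n) : measurable_fun [set: 'rV[R]_n] (rV_coord i).
Proof.
move=> _ Y mY; rewrite setTI; apply: sub_sigma_algebra => /=.
rewrite -bigcup_seq/=; exists i => /=; first by rewrite mem_index_enum.
by exists Y => //; rewrite setTI.
Qed.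

End measurable_rV.

Lemma measurable_fun_rV (R : realType) d (T : measurableType d) n (f : T -> 'rV[R]_n) :
  (forall i, measurable_fun [set: T] (rV_coord i \o f)) ->
  measurable_fun [set: T] f.
Proof.
move=> mf.
have prefS : g_sigma_preimage (fun i => @rV_coord R n i \o f) `<=` measurable.
  apply: smallest_sub; first exact: sigma_algebra_measurable.
  case: n => [|n] in f mf *; first by rewrite big_ord0.
  rewrite -bigcup_mkord_ord; apply: bigcup_sub => i Ii.
  by move=> A [B mB <-]; exact: mf.
move: prefS; rewrite g_sigma_preimage_comp => prefS.
by move=> _ A mA; apply: prefS; exists A.
Qed.

Section lebesgue_rV.
Context {R : realType}.

Definition rV_cons n (xy : measurableTypeR R * 'rV[R]_n) : 'rV[R]_n.+1 :=
  row_mx (xy.1 : R)%:M xy.2 : 'rV[R]_(1 + n).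

Lemma rV_cons_ord0 n xy : @rV_cons n xy ord0 ord0 = xy.1.
Proof.
by rewrite /rV_cons mxE; case: splitP => [j _|//]; rewrite (ord1 j) mxE.
Qed.

Lemma rV_cons_lift n xy (i : 'I_n) : @rV_cons n xy ord0 (lift ord0 i) = xy.2 ord0 i.
Proof.
rewrite /rV_cons mxE; case: splitP => [j /=|k /= ik].
  by move=> ij; have := ltn_ord j; rewrite -ij.
by congr (xy.2 ord0 _); apply/val_inj; case: ik.
Qed.

Lemma measurable_rV_cons n : measurable_fun [set: measurableTypeR R * 'rV[R]_n]
  (@rV_cons n).
Proof.
apply: measurable_fun_rV => i; case: (unliftP ord0 i) => [j|] ->.
  rewrite (_ : _ \o _ = rV_coord j \o snd); last first.
    by apply/funext => xy; exact: rV_cons_lift.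
  by apply: measurableT_comp => //; exact: measurable_rV_coord.
by rewrite (_ : _ \o _ = fst)//; apply/funext => xy; exact: rV_cons_ord0.
Qed.

HB.instance Definition _ n := isMeasurableFun.Build _ _ _ _
  (@rV_cons n) (@measurable_rV_cons n).

Section lebesgue_cons.
Variables (n : nat) (mu : {sigma_finite_measure set 'rV[R]_n -> \bar R}).

Definition lebesgue_cons : set 'rV[R]_n.+1 -> \bar R :=
  pushforward (lebesgue_measure \x mu)%E (@rV_cons n).

Let lebesgue_cons0 : lebesgue_cons set0 = 0%E.
Proof. exact: measure0. Qed.

Let lebesgue_cons_ge0 A : (0 <= lebesgue_cons A)%E.
Proof. exact: measure_ge0. Qed.

Let lebesgue_cons_sigma_additive : semi_sigma_additive lebesgue_cons.
Proof. exact: measure_semi_sigma_additive. Qed.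

HB.instance Definition _ := isMeasure.Build _ _ _ lebesgue_cons
  lebesgue_cons0 lebesgue_cons_ge0 lebesgue_cons_sigma_additive.

Let lebesgue_cons_sigma_finite : sigma_finite setT lebesgue_cons.
Proof.
have /sigma_finiteP[F [TF ndF Foo]] := sigma_finiteT (@lebesgue_measure R).
have /sigma_finiteP[G [TG ndG Goo]] := sigma_finiteT mu.
pose h (v : 'rV[R]_n.+1) : measurableTypeR R * 'rV[R]_n :=
  (v ord0 ord0, \row_i v ord0 (lift ord0 i)).
have mh : measurable_fun setT h.
  apply: measurable_fun_pair; first exact: (@measurable_rV_coord R n.+1 ord0).
  apply: measurable_fun_rV => i.
  rewrite (_ : _ \o _ = rV_coord (lift ord0 i)).
    exact: measurable_rV_coord.
  by apply/funext => v; rewrite /rV_coord /= mxE.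
have hK xy : h (rV_cons xy) = xy.
  case: xy => x y; rewrite /h rV_cons_ord0; congr pair.
  by apply/rowP => i; rewrite mxE rV_cons_lift.
exists (fun k => h @^-1` (F k `*` G k)).
  apply/seteqP; split => // v _.
  have [i _ Fi] : (\bigcup_i F i) (h v).1 by rewrite -TF.
  have [j _ Gj] : (\bigcup_i G i) (h v).2 by rewrite -TG.
  exists (maxn i j) => //; split.
    by move: Fi; exact/subsetPset/ndF/leq_maxl.
  by move: Gj; exact/subsetPset/ndG/leq_maxr.
move=> k; have [mF Foo'] := Foo k; have [mG Goo'] := Goo k; split.
  by rewrite -[X in measurable X]setTI; apply: mh => //; exact: measurableX.
rewrite /lebesgue_cons /pushforward (_ : _ @^-1` _ = F k `*` G k); last first.
  by apply/funext => xy; exact: (congr1 (F k `*` G k) (hK xy)).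
by rewrite product_measure1E// lte_mul_pinfty// ge0_fin_numE.
Qed.

HB.instance Definition _ := Measure_isSigmaFinite.Build _ _ _ lebesgue_cons
  lebesgue_cons_sigma_finite.

End lebesgue_cons.

Fixpoint lebesgue_rV (n : nat) : {sigma_finite_measure set 'rV[R]_n -> \bar R} :=
  match n with
  | 0 => \d_(0 : 'rV[R]_0)
  | m.+1 => lebesgue_cons (lebesgue_rV m)
  end.

Definition enorm n (x : 'rV[R]_n) : R := Num.sqrt (\sum_(i < n) x ord0 i ^+ 2).

Definition radial n (x : 'rV[R]_n) : 'rV[R]_n := (enorm x)^-1 *: x.

Lemma measurable_enorm n : measurable_fun [set: 'rV[R]_n]
  (@enorm n : 'rV[R]_n -> measurableTypeR R).
Proof.
apply: (@measurableT_comp _ _ _ _ _ _ (@Num.sqrt R)).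
  by apply: continuous_measurable_fun; exact: sqrt_continuous.
apply: measurable_sum => i; apply: measurable_funX.
exact: measurable_rV_coord.
Qed.

Lemma measurable_radial n : measurable_fun [set: 'rV[R]_n] (@radial n).
Proof.
apply: measurable_fun_rV => i.
rewrite (_ : _ \o _ = fun x => (enorm x) `^ (-1) * rV_coord i x); last first.
  apply/funext => x; rewrite /rV_coord /= /radial mxE powR_inv1//.
  exact: sqrtr_ge0.
apply: measurable_funM; last exact: measurable_rV_coord.
apply: (@measurableT_comp _ _ _ _ _ _ (fun r : R => r `^ (-1))).
  exact: measurable_powR.
exact: measurable_enorm.
Qed.

HB.instance Definition _ n := isMeasurableFun.Build _ _ _ _
  (@radial n) (@measurable_radial n).

Definition unit_ball n : set 'rV[R]_n := [set x | enorm x <= 1].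
Arguments unit_ball n _ : clear implicits.

Definition sphere d : set 'rV[R]_d.+1 := [set x | enorm x = 1].
Arguments sphere d _ : clear implicits.

Lemma measurable_unit_ball n : measurable (unit_ball n).
Proof.
rewrite (_ : unit_ball n = @enorm n @^-1` `]-oo, 1]); last first.
  by apply/seteqP; split => x /=; rewrite in_itv.
by rewrite -[X in measurable X]setTI; apply: measurable_enorm.
Qed.

Lemma measurable_sphere d : measurable (sphere d).
Proof.
rewrite (_ : sphere d = @enorm d.+1 @^-1` [set 1])//.
by rewrite -[X in measurable X]setTI; apply: measurable_enorm.
Qed.

Definition cube n (r : R) : set 'rV[R]_n := [set x | forall i, `|x ord0 i| <= r].
Arguments cube n r _ : clear implicits.

Lemma measurable_cube n (r : R) : measurable (cube n r).
Proof.
rewrite (_ : cube n r = \bigcap_(i in [set: 'I_n]) (rV_coord i @^-1` `[- r, r])).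
  apply: fin_bigcap_measurable => // i _.
  by rewrite -[X in measurable X]setTI; apply: measurable_rV_coord.
apply/seteqP; split => x /=.
  by move=> xr i _; rewrite /= in_itv /= -ler_norml; exact: xr.
by move=> xr i; have := xr i I; rewrite /= in_itv /= -ler_norml.
Qed.

Lemma lebesgue_rV_cube n (r : R) : 0 <= r ->
  lebesgue_rV n (cube n r) = ((2 * r) ^+ n)%:E.
Proof.
move=> r0; elim: n => [|n IH].
  rewrite /= diracE expr0 mem_set//; first by rewrite /cube /= => -[].
have mI : measurable (`[- r, r] : set (measurableTypeR R)).
  exact: measurable_itv.
have mC : measurable (cube n r) by exact: measurable_cube.
rewrite /= /lebesgue_cons /pushforward.
rewrite (_ : _ @^-1` _ = `[- r, r] `*` cube n r); last first.
  apply/seteqP; split => [[x y] xyr|[x y] [/= xr yr] i].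
    split => /=; first by have := xyr ord0; rewrite rV_cons_ord0 in_itv /= ler_norml.
    by move=> i; have := xyr (lift ord0 i); rewrite rV_cons_lift.
  case: (unliftP ord0 i) => [j|] ->; first by rewrite rV_cons_lift; exact: yr.
  by rewrite rV_cons_ord0 /= ler_norml; move: xr; rewrite in_itv.
rewrite product_measure1E// [X in (_ * X)%E]IH exprS EFinM; congr (_ * _)%E.
apply: (etrans (@lebesgue_measure_itv R `[- r, r])); rewrite /= lte_fin.
have [r0'|rr] := ltP (- r) r; first by rewrite -EFinB; congr EFin; ring.
have -> : r = 0 by apply/eqP; rewrite eq_le r0 andbT; lra.
by rewrite mulr0.
Qed.

Lemma unit_ball_sub_cube n : unit_ball n `<=` cube n 1.
Proof.
move=> x x1 i; apply: le_trans x1; rewrite -sqrtr_sqr ler_wsqrtr//.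
by rewrite (bigD1 i)//= lerDl sumr_ge0// => j _; exact: sqr_ge0.
Qed.

Lemma cube_sub_unit_ball n : cube n n.+1%:R^-1 `<=` unit_ball n.
Proof.
move=> x xn; rewrite /unit_ball /= /enorm -[leRHS]sqrtr1 ler_wsqrtr//.
have n1 : (n.+1%:R : R)^-1 <= 1 by rewrite invf_le1// ler1n.
apply: (@le_trans _ _ (\sum_(i < n) n.+1%:R^-1)).
  apply: ler_sum => i _; rewrite -real_normK ?num_real//.
  apply: le_trans (xn i); rewrite expr2 ler_piMl//.
  exact: le_trans (xn i) n1.
rewrite sumr_const card_ord -[leLHS]mulr_natl ler_pdivrMr// mul1r ler_nat.
exact: leqnSn.
Qed.

Lemma lebesgue_unit_ball_gt0 n : (0 < lebesgue_rV n (unit_ball n))%E.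
Proof.
apply: (@lt_le_trans _ _ (lebesgue_rV n (cube n n.+1%:R^-1))).
  by rewrite lebesgue_rV_cube// lte_fin exprn_gt0// mulr_gt0.
apply: le_measure; rewrite ?inE; [exact: measurable_cube|
  exact: measurable_unit_ball|exact: cube_sub_unit_ball].
Qed.

Lemma lebesgue_unit_ball_lty n : (lebesgue_rV n (unit_ball n) < +oo)%E.
Proof.
apply: (@le_lt_trans _ _ (lebesgue_rV n (cube n 1))).
  apply: le_measure; rewrite ?inE; [exact: measurable_unit_ball|
    exact: measurable_cube|exact: unit_ball_sub_cube].
by rewrite lebesgue_rV_cube// ltry.
Qed.

Lemma lebesgue_unit_ball_inv_ge0 n : 0 <= (fine (lebesgue_rV n (unit_ball n)))^-1.
Proof. by rewrite invr_ge0 fine_ge0. Qed.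

(* The normalized surface measure of A is the relative volume, in the unit ball,
   of the cone over A. *)
Definition sphere_measure d (A : set 'rV[R]_d.+1) : \bar R :=
  ((fine (lebesgue_rV d.+1 (unit_ball d.+1)))^-1%:E *
   lebesgue_rV d.+1 (@radial d.+1 @^-1` A `&` unit_ball d.+1))%E.

Section sphere_measure_probability.
Variable d : nat.

Let nu : set 'rV[R]_d.+1 -> \bar R :=
  pushforward (mrestr (lebesgue_rV d.+1) (@measurable_unit_ball d.+1))
    (@radial d.+1).

Let nu0 : nu set0 = 0%E.
Proof. exact: measure0. Qed.

Let nu_ge0 A : (0 <= nu A)%E.
Proof. exact: measure_ge0. Qed.

Let nu_sigma_additive : semi_sigma_additive nu.
Proof. exact: measure_semi_sigma_additive. Qed.

HB.instance Definition _ := isMeasure.Build _ _ _ nu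
  nu0 nu_ge0 nu_sigma_additive.

Let mu := mscale (NngNum (lebesgue_unit_ball_inv_ge0 d.+1)) nu.

Let sphere_measure0 : @sphere_measure d set0 = 0%E.
Proof. exact: (@measure0 _ _ _ mu). Qed.

Let sphere_measure_ge0 (A : set 'rV[R]_d.+1) : (0 <= sphere_measure A)%E.
Proof. exact: (@measure_ge0 _ _ _ mu). Qed.

Let sphere_measure_sigma_additive : semi_sigma_additive (@sphere_measure d).
Proof. exact: (@measure_semi_sigma_additive _ _ _ mu). Qed.

HB.instance Definition _ := isMeasure.Build _ _ _ (@sphere_measure d)
  sphere_measure0 sphere_measure_ge0 sphere_measure_sigma_additive.

Let sphere_measure_setT : @sphere_measure d setT = 1%E.
Proof.
rewrite /sphere_measure preimage_setT setTI.
have := lebesgue_unit_ball_gt0 d.+1; have := lebesgue_unit_ball_lty d.+1.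
case: (lebesgue_rV _ _) => [r _ r0| |]//=.
by rewrite -EFinM mulVf// gt_eqF.
Qed.

HB.instance Definition _ := Measure_isProbability.Build _ _ _
  (@sphere_measure d) sphere_measure_setT.

End sphere_measure_probability.

Lemma sphere_measure_sphere d : sphere_measure (sphere d) = 1%E.
Proof.
have mZ : measurable (cube d.+1 0) by exact: measurable_cube.
have mB : measurable (unit_ball d.+1) by exact: measurable_unit_ball.
have mS : measurable (@radial d.+1 @^-1` sphere d `&` unit_ball d.+1).
  apply: measurableI => //; rewrite -[X in measurable X]setTI.
  by apply: measurable_radial => //; exact: measurable_sphere.
transitivity (sphere_measure [set: 'rV[R]_d.+1]); last exact: probability_setT.
rewrite /sphere_measure preimage_setT setTI.
congr (_ * _)%E; apply/eqP; rewrite eq_le; apply/andP; split.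
  by apply: le_measure; rewrite ?inE//; exact: subIsetr.
apply: (@le_trans _ _ (lebesgue_rV d.+1
  ((@radial d.+1 @^-1` sphere d `&` unit_ball d.+1) `|` cube d.+1 0))).
  apply: le_measure; rewrite ?inE//; first exact: measurableU.
  move=> x x1; have [x0|x0] := eqVneq (enorm x) 0; last first.
    left; split => //; rewrite /preimage /sphere /= /radial /enorm.
    under eq_bigr do rewrite mxE exprMn.
    rewrite -mulr_sumr sqrtrM ?sqr_ge0// sqrtr_sqr -/(enorm x).
    by rewrite ger0_norm ?invr_ge0 ?sqrtr_ge0// mulVf.
  right => i; rewrite -x0 -sqrtr_sqr ler_wsqrtr//.
  by rewrite (bigD1 i)//= lerDl sumr_ge0// => j _; exact: sqr_ge0.
apply: le_trans (measureU2 _ mS mZ) _.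
by rewrite [X in (_ + X)%E]lebesgue_rV_cube// mulr0 expr0n /= adde0.
Qed.

End lebesgue_rV.
Arguments unit_ball R n _ : clear implicits.
Arguments sphere R d _ : clear implicits.
Arguments sphere_measure R d _ : clear implicits.

Section sphere_poly.
(* Imported locally: mpoly shadows names and notations of mathcomp-analysis. *)
Import -(notations) mpoly.

(* P_t(S^d); only the values on S^d of such an f are relevant. *)
Definition sphere_poly (R : realType) d (t : nat) : set ('rV[R]_d.+1 -> R) :=
  [set f | exists2 p : mpoly d.+1 R, (mpoly.msize p <= t.+1)%N &
     forall x, sphere R d x -> f x = meval (x ord0) p].

End sphere_poly.

Section curves.
Context {R : realType} (d : nat).
Implicit Types (gamma : R -> 'rV[R]_d.+1) (f : 'rV[R]_d.+1 -> R).

Definition sphere_int f : R := \int[sphere_measure R d]_(x in sphere R d) f x.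

Definition sphere_sup f : R := sup [set `|f x| | x in sphere R d].

(* Junk values of the derivative at the finitely many break points of a
   piecewise smooth curve do not affect the integral. *)
Definition curve_int gamma f : R :=
  \int[lebesgue_measure]_(s in `[0, 1]) (f (gamma s) * enorm (derive1 gamma s)).

Definition curve_length gamma : R := curve_int gamma (cst 1).

Definition smooth (g : R -> 'rV[R]_d.+1) : Prop :=
  forall n x, derivable (derive1n n g) x 1.

(* Smoothness on a closed piece means being the restriction of a smooth map. *)
Definition piecewise_smooth gamma : Prop :=
  exists (k : nat) (s : nat -> R),
    [/\ s 0%N = 0, s k = 1 & forall i, (i < k)%N -> s i < s i.+1 /\
      exists2 g, smooth g &
        forall x, s i <= x <= s i.+1 -> gamma x = g x].

(* gamma 0 = gamma 1 is not a self-intersection of a closed curve. *)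
Definition self_intersections gamma : set (R * R) :=
  [set st | [/\ 0 <= st.1, st.1 < st.2, st.2 < 1 & gamma st.1 = gamma st.2]].

Definition sphere_curve gamma : Prop :=
  [/\ forall s, 0 <= s <= 1 -> sphere R d (gamma s),
      {within `[0, 1], continuous gamma},
      piecewise_smooth gamma,
      gamma 0 = gamma 1 &
      finite_set (self_intersections gamma)].

Definition approx_design_curve_with (eps c : R) (t : nat) gamma : Prop :=
  [/\ 0 <= eps, 0 < c, sphere_curve gamma &
    forall f, sphere_poly t f ->
      `|c * curve_int gamma f - sphere_int f| <= eps * sphere_sup f].

Definition approx_design_curve (eps : R) (t : nat) gamma : Prop :=
  approx_design_curve_with eps (curve_length gamma)^-1 t gamma.

End curves.

Definition asymp (R : realType) (a b : nat -> R) : Prop :=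
  exists m M : R, [/\ 0 < m & \forall t \near \oo, m <= a t / b t <= M].

(* Main.v *)
Require Import Defs.
From HB Require Import structures.
From mathcomp Require Import all_boot all_order all_algebra.
From mathcomp Require mpoly.
From mathcomp Require Import all_classical all_reals all_analysis.
From mathcomp Require Import measurable_realfun ring lra zify.

Set Implicit Arguments.
Unset Strict Implicit.
Unset Printing Implicit Defensive.

Import Order.TTheory GRing.Theory Num.Theory.
Import numFieldNormedType.Exports.

Local Open Scope classical_set_scope.
Local Open Scope ring_scope.

(* A circle of radius r in S^d contributes 2 pi r times the mean of f over it to
   a curve integral, so a family of parallel circles is a quadrature rule.  Good
   families are built by induction on the dimension.  The latitude formula
   turns the integral over the sphere into the integral over phi in [0, pi] of
   sin(phi)^n times the mean over a layer of radius sin(phi), and this is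
   approximated by the midpoint rule in phi, with an error of the order of one
   layer.  A polynomial of degree t is, on a layer of radius s, exponentially
   close to a polynomial of degree 64 t s, so a layer only needs the
   lower-dimensional family for that degree.  For degree T in S^(n+2) the circles
   then have total length of order T^(n+1), with error O(T^n); joining
   consecutive circles by great arcs costs another O(T^n), whence a relative
   error O(1/T).  For d even the family is taken for the larger degree
   T = t^((2d-3)/(d-1)), which only improves the error. *)

(** * Integrals over segments *)

(** The obstacle is that a curve offers no free weights: a circle counts with its length and nothing
    else. On S^(n+3) the latitude density is sin^(n+2), whereas placing a family on a layer of
    radius s multiplies its length by s only. The missing factor s^(n+1) must come from the number
    of circles, so the layer has to carry the family for a degree proportional to T s. Degree
    reduction is thus what makes the weights come out right, not merely a saving of length. It also
    explains why the degree parameter T is real and why a single constant [kap] must serve all T.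

    Odd powers of sin(phi) are not polynomials in cos(phi), so the midpoint rule is not exact. Its
    error is estimated mode by mode in the Chebyshev basis, uniformly in the degree, from a sup
    bound alone.

    The measure on the sphere is defined through cones in the ball. Integrals of homogeneous
    functions are therefore expressed by moments of the ball, these are computed by slicing, and the
    latitude formula results from comparing two consecutive dimensions. *)

Section integrals.
Context {R : realType}.
Implicit Types (F G : R -> R) (a b c : R).
Local Notation mu := (@lebesgue_measure R).
Local Notation intg a b F := (\int[mu]_(x in `[a, b]) F x).

Lemma continuous_integrable_itv F a b : continuous F ->
  mu.-integrable `[a, b] (EFin \o F).
Proof.
move=> cF; apply: continuous_compact_integrable; first exact: segment_compact.
exact: continuous_subspaceT.
Qed.

Lemma intg_point F a : intg a a F = 0.
Proof. by rewrite set_itv1 Rintegral_set1. Qed.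

Lemma intg_FTC G F a b : a <= b -> continuous F ->
  (forall x, a <= x <= b -> is_derive x 1 G (F x)) -> intg a b F = G b - G a.
Proof.
rewrite le_eqVlt => /predU1P[<- _ _|ab cF dG]; first by rewrite intg_point subrr.
have ld x : a <= x <= b -> derivable G x 1 by move=> /dG [].
have cG x : a <= x <= b -> {for x, continuous G}.
  by move=> /ld /derivable1_diffP /differentiable_continuous.
rewrite /Rintegral (@continuous_FTC2 _ F G)//.
- exact: continuous_subspaceT.
- split.
  + by move=> x /[!in_itv]/= /andP[ax xb]; apply: ld; rewrite !ltW.
  + by apply: cvg_at_right_filter; apply: cG; rewrite lexx ltW.
  + by apply: cvg_at_left_filter; apply: cG; rewrite lexx ltW.
- move=> x /[!in_itv]/= /andP[ax xb].
  by rewrite derive1E; apply: (@derive_val _ _ _ _ _ _ _ (dG x _)); rewrite !ltW.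
Qed.

(** The derivative is two-sided because x is interior. Users choose an interval slightly larger than
    the one of interest, so that its endpoints become interior as well. *)
Lemma antiderivative_ex F a b : continuous F ->
  exists G, forall x, a < x < b -> is_derive x 1 G (F x).
Proof.
move=> cF; exists (fun x => intg a x F) => x /andP[ax xb].
have [d e] := @continuous_FTC1_closed R F a x b xb
  (continuous_integrable_itv _ _ cF) ax (cF x).
by apply: DeriveDef; [exact: d|rewrite -derive1E; exact: e].
Qed.

Lemma intg_cat F a b c : continuous F -> a <= b -> b <= c ->
  intg a b F + intg b c F = intg a c F.
Proof.
move=> cF ab bc.
have [G dG] := antiderivative_ex (a - 1) (c + 1) cF.
have E u v : a <= u -> u <= v -> v <= c -> intg u v F = G v - G u.
  by move=> au uv vc; apply: intg_FTC => // x ?; apply: dG; lra.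
by rewrite !E// ?lexx//; lra.
Qed.

Lemma intg_affine F a b (u v : R) : continuous F -> a <= b -> 0 < u ->
  intg a b (fun x => F (u * x + v)) * u = intg (u * a + v) (u * b + v) F.
Proof.
move=> cF ab u0.
have uab : u * a + v <= u * b + v by rewrite lerD2r ler_pM2l.
have [G dG] := antiderivative_ex (u * a + v - 1) (u * b + v + 1) cF.
have -> : intg (u * a + v) (u * b + v) F = G (u * b + v) - G (u * a + v).
  by apply: intg_FTC => // x ?; apply: dG; lra.
have -> : intg a b (fun x => F (u * x + v)) =
    u^-1 * G (u * b + v) - u^-1 * G (u * a + v); last by field; lra.
apply: (@intg_FTC (fun x => u^-1 * G (u * x + v))) => //.
- move=> x; apply: continuous_comp; last exact: cF.
  by apply: cvgD; [apply: cvgM; [exact: cvg_cst|exact: cvg_id]|exact: cvg_cst].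
- move=> x /andP[ax xb].
  have dGx : is_derive (u * x + v) 1 G (F (u * x + v)).
    by apply: dG; have := ler_pM2l u0 a x; have := ler_pM2l u0 x b; lra.
  have dl : is_derive x 1 (fun x => u * x + v) u.
    by apply: is_derive_eq; rewrite /GRing.scale/=; lra.
  have dc := @is_derive1_comp _ G (fun x => u * x + v) x _ _ dGx dl.
  have := is_deriveZ u^-1 dc.
  by rewrite /GRing.scale/= mulrA mulrAC mulVf ?mul1r//; lra.
Qed.

Lemma intg_opp F a b : continuous F -> a <= b ->
  intg a b (fun x => F (- x)) = intg (- b) (- a) F.
Proof.
move=> cF ab.
rewrite /Rintegral integration_by_substitution_oppr//.
exact: continuous_subspaceT.
Qed.

Lemma intg_cst a b c : a <= b -> intg a b (fun=> c) = c * (b - a).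
Proof.
move=> ab; rewrite Rintegral_cst; last exact: measurable_itv.
congr (_ * _); have -> : b - a = fine (b - a)%:E by [].
congr fine; apply: (etrans (@lebesgue_measure_itv R `[a, b])).
rewrite /= lte_fin; have [_|ba] := ltP a b; first by rewrite EFinB.
by rewrite (_ : b = a) ?subrr//; apply/le_anti/andP.
Qed.

Lemma intg_le F a b (B : R) : continuous F -> a <= b ->
  (forall x, a <= x <= b -> `|F x| <= B) -> `|intg a b F| <= B * (b - a).
Proof.
move=> cF ab FB; apply: (le_trans (le_normr_Rintegral _ _)) => //.
  exact: continuous_integrable_itv.
have -> : B * (b - a) = intg a b (fun=> B).
  by rewrite intg_cst.
apply: le_Rintegral => //.
- apply: (@continuous_integrable_itv (fun x => `|F x|)) => x.
  by apply: continuous_comp; [exact: cF|exact: norm_continuous].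
- apply: (@continuous_integrable_itv (fun=> B)); exact: cst_continuous.
Qed.

Lemma intgD F G a b : continuous F -> continuous G ->
  intg a b (fun x => F x + G x) = intg a b F + intg a b G.
Proof. by move=> cF cG; rewrite RintegralD//; exact: continuous_integrable_itv. Qed.

Lemma intgB F G a b : continuous F -> continuous G ->
  intg a b (fun x => F x - G x) = intg a b F - intg a b G.
Proof. by move=> cF cG; rewrite RintegralB//; exact: continuous_integrable_itv. Qed.

Lemma intgZ F a b c : continuous F ->
  intg a b (fun x => c * F x) = c * intg a b F.
Proof. by move=> cF; rewrite RintegralZl//; exact: continuous_integrable_itv. Qed.

Lemma continuous_sumr (I : Type) (r : seq I) (F : I -> R -> R) :
  (forall i, continuous (F i)) -> continuous (fun x => \sum_(i <- r) F i x).
Proof.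
move=> cF; elim: r => [|i r IH] x.
  by under eq_fun do rewrite big_nil; exact: cvg_cst.
by under eq_fun do rewrite big_cons; apply: cvgD; [exact: cF|exact: IH].
Qed.

Lemma intg_sum (I : Type) (r : seq I) (F : I -> R -> R) a b :
  (forall i, continuous (F i)) ->
  intg a b (fun x => \sum_(i <- r) F i x) = \sum_(i <- r) intg a b (F i).
Proof.
move=> cF; elim: r => [|i r IH].
  rewrite big_nil; under eq_Rintegral do rewrite big_nil.
  by rewrite Rintegral_cst ?mul0r.
rewrite big_cons -IH -intgD//; first by apply: eq_Rintegral => x _; rewrite big_cons.
exact: continuous_sumr.
Qed.

End integrals.

Lemma ler_sum_cst (R : realType) n (F : 'I_n -> R) b :
  (forall i, F i <= b) -> \sum_(i < n) F i <= b * n%:R.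
Proof.
move=> Fb; apply: (@le_trans _ _ (\sum_(i < n) b)); first exact: ler_sum.
by rewrite sumr_const card_ord mulr_natr.
Qed.

(** * The midpoint rule for trigonometric polynomials *)

Section trig_bounds.
Context {R : realType}.
Implicit Types x y : R.
Local Notation intg a b F := (\int[@lebesgue_measure R]_(x in `[a, b]) F x).

Lemma norm_sin_le x : 0 <= x -> `|sin x| <= x.
Proof.
move=> x0; have -> : sin x = intg 0 x cos.
  rewrite (intg_FTC (G := sin))// ?sin0 ?subr0//.
  exact: continuous_cos.
have -> : x = 1 * (x - 0) by rewrite subr0 mul1r.
rewrite {1}subr0 mul1r; apply: intg_le => //; first exact: continuous_cos.
by move=> y _; exact: cos_max.
Qed.

Lemma sin_le_id x : 0 <= x -> sin x <= x.
Proof. by move=> x0; rewrite (le_trans (ler_norm _))// norm_sin_le. Qed.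

Lemma one_sub_cos_le x : 1 - cos x <= x ^+ 2 / 2.
Proof.
wlog x0 : x / 0 <= x.
  move=> H; have [/H//|x0] := leP 0 x.
  by rewrite -cosN -sqrrN; apply: H; rewrite oppr_ge0 ltW.
have -> : cos x = 1 - 2 * sin (x / 2) ^+ 2.
  rewrite -[in LHS](_ : (x / 2) *+ 2 = x); last by rewrite -mulr_natr; field.
  by rewrite cos_mulr2n cos2sin2 -mulr_natl; ring.
have x20 : 0 <= x / 2 by lra.
have := norm_sin_le x20; rewrite ler_norml => /andP[h1 h2].
by nra.
Qed.

(** [sin x - x * cos x] is the integral of [t * sin t] over [0, x]. *)
Lemma id_cos_le_sin x : 0 <= x <= pi -> x * cos x <= sin x.
Proof.
move=> /andP[x0 xpi].
have E : intg 0 x (fun t => t * sin t) = (sin x - x * cos x) - (sin 0 - 0 * cos 0).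
  apply: (@intg_FTC R (fun t => sin t - t * cos t)) => //.
  - by move=> y; apply: cvgM; [exact: cvg_id|exact: continuous_sin].
  - by move=> y _; apply: is_derive_eq; rewrite /GRing.scale/=; ring.
suff : 0 <= intg 0 x (fun t => t * sin t) by rewrite E sin0 mul0r; lra.
apply: Rintegral_ge0 => t /=; rewrite in_itv/= => /andP[t0 tx].
by rewrite mulr_ge0// sin_ge0_pi// t0/= (le_trans tx).
Qed.

(** By the previous bound at x / 2, [sin x] is at least [x * cos (x / 2) ^+ 2], and this square is
    at least 1 / 2 because [cos x] is nonnegative. *)
Lemma half_le_sin x : 0 <= x <= pi / 2 -> x / 2 <= sin x.
Proof.
move=> /andP[x0 xpi]; have pi0 := pi_gt0 R.
have e : x = (x / 2) *+ 2 by rewrite -mulr_natr; field.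
have : 0 <= cos x by apply: cos_ge0_pihalf; lra.
have : x / 2 * cos (x / 2) <= sin (x / 2) by apply: id_cos_le_sin; lra.
rewrite [in cos x]e [in sin x]e sin_mulr2n cos_mulr2n.
have : 0 <= cos (x / 2) by apply: cos_ge0_pihalf; lra.
set c := cos _; set s := sin _ => c0; rewrite !mulr2n => h c2.
have : x / 2 * c * c <= s * c by rewrite ler_wpM2r.
have : x / 2 * (1 / 2) <= x / 2 * (c ^+ 2) by rewrite ler_wpM2l//; lra.
by nra.
Qed.

(* The nonsingular part of [1 / sin x] at 0. *)
Definition cosec_defect x := (sin x)^-1 - x^-1.

Lemma cosec_defect_le x : 0 < x <= pi / 2 -> `|cosec_defect x| <= 2 * x.
Proof.
move=> /andP[x0 xpi]; have pi0 := pi_gt0 R.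
have s1 : x / 2 <= sin x by apply: half_le_sin; lra.
have s2 : sin x <= x by apply: sin_le_id; lra.
have s3 : x * cos x <= sin x by apply: id_cos_le_sin; lra.
have c1 := one_sub_cos_le x.
have s0 : 0 < sin x by lra.
rewrite /cosec_defect (_ : _ - _ = (x - sin x) / (x * sin x)); last first.
  by field; lra.
rewrite ger0_norm; last by rewrite divr_ge0 ?mulr_ge0//; lra.
rewrite ler_pdivrMr ?mulr_gt0//.
have : x - sin x <= x * (1 - cos x) by lra.
have : x * (1 - cos x) <= x * (x ^+ 2 / 2) by rewrite ler_pM2l.
have : x ^+ 2 * (x / 2) <= x ^+ 2 * sin x by rewrite ler_pM2l ?exprn_gt0.
rewrite !expr2; lra.
Qed.

(** Mean value theorem. In the derivative, the numerator [sin t ^+ 2 - t ^+ 2 * cos t] is at most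
    t^4 / 2 in absolute value, since [sin t] lies between [t * cos t] and t, while the denominator
    [t ^+ 2 * sin t ^+ 2] is at least t^4 / 4. *)
Lemma cosec_defect_lipschitz x y : 0 < x -> x <= y -> y <= pi / 2 ->
  `|cosec_defect y - cosec_defect x| <= 2 * (y - x).
Proof.
move=> x0; rewrite le_eqVlt => /predU1P[->|xy ypi].
  by rewrite !subrr normr0 mulr0.
have pi0 := pi_gt0 R.
have sin_neq0 t : 0 < t -> t <= y -> sin t != 0.
  by move=> t0 ty; rewrite gt_eqF// sin_gt0_pi//; lra.
have dh t : 0 < t -> t <= y -> is_derive t 1 cosec_defect
    (t ^- 2 - cos t / sin t ^+ 2).
  move=> t0 ty; have s0 := sin_neq0 _ t0 ty.
  have t0' : t != 0 by rewrite gt_eqF.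
  have d1 : is_derive t 1 (fun t => (sin t)^-1) (- (sin t) ^- 2 *: cos t).
    exact: is_deriveV.
  have d2 : is_derive t 1 (fun t : R => t^-1) (- t ^- 2 *: 1).
    exact: is_deriveV.
  have := is_deriveB d1 d2; rewrite /GRing.scale/= => d3.
  by apply: is_derive_eq d3 _; field; rewrite s0.
have [||t /[!in_itv]/= /andP[xt ty] ->] := @MVT _ cosec_defect
    (fun t => t ^- 2 - cos t / sin t ^+ 2) x y xy.
- by move=> t /[!in_itv]/= /andP[xt ty]; apply: dh; lra.
- apply: derivable_within_continuous => t /[!in_itv]/= /andP[xt ty].
  by have [] := dh t _ _ => //; lra.
rewrite normrM (ger0_norm (_ : 0 <= y - x)); last by lra.
rewrite ler_pM2r; last by lra.
have t0 : 0 < t by lra.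
have s1 : t / 2 <= sin t by apply: half_le_sin; lra.
have s2 : sin t <= t by apply: sin_le_id; lra.
have s3 : t * cos t <= sin t by apply: id_cos_le_sin; lra.
have c1 := one_sub_cos_le t; have c2 := cos_le1 t.
have c3 : 0 <= cos t by apply: cos_ge0_pihalf; lra.
have s0 : 0 < sin t by lra.
have -> : t ^- 2 - cos t / sin t ^+ 2 =
    (sin t ^+ 2 - t ^+ 2 * cos t) / (t ^+ 2 * sin t ^+ 2) by field; lra.
rewrite normrM [X in _ * X]gtr0_norm; last by rewrite invr_gt0 mulr_gt0 ?exprn_gt0.
rewrite ler_pdivrMr ?mulr_gt0 ?exprn_gt0//.
have st : (t / 2) ^+ 2 <= sin t ^+ 2 by rewrite ler_pXn2r// nnegrE; lra.
have st2 : t ^+ 2 * (t / 2) ^+ 2 <= t ^+ 2 * sin t ^+ 2 by rewrite ler_pM2l// exprn_gt0.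
have st3 : t ^+ 2 * (1 - cos t) <= t ^+ 2 * (t ^+ 2 / 2) by rewrite ler_pM2l// exprn_gt0.
have st4 : sin t ^+ 2 <= t ^+ 2 by rewrite ler_pXn2r// nnegrE; lra.
have st5 : (t * cos t) ^+ 2 <= sin t ^+ 2.
  by rewrite ler_pXn2r// nnegrE ?mulr_ge0//; lra.
have st6 : t ^+ 2 * (cos t * (1 - cos t)) <= t ^+ 2 * (1 - cos t).
  by rewrite ler_pM2l ?exprn_gt0// ler_piMl//; lra.
rewrite ler_norml; rewrite !expr2 in st st2 st3 st4 st5 st6 *; apply/andP; split; lra.
Qed.

End trig_bounds.

(** * Chebyshev expansions and quadrature at the midpoint nodes *)

Section chebyshev.
Context {R : realType}.
Implicit Types (x y r B : R) (P : {poly R}) (k n M : nat).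

(** Two consecutive Chebyshev polynomials of the first kind are carried along, which makes the
    three-term recurrence structural. *)
Fixpoint cheb_pair n : {poly R} * {poly R} :=
  if n is n.+1 then let: (p, q) := cheb_pair n in (q, 'X * q *+ 2 - p)
  else (1, 'X).

Definition cheb n : {poly R} := (cheb_pair n).1.

Lemma cheb0 : cheb 0 = 1. Proof. by []. Qed.
Lemma cheb1 : cheb 1 = 'X. Proof. by []. Qed.
Lemma chebSS n : cheb n.+2 = 'X * cheb n.+1 *+ 2 - cheb n.
Proof. by rewrite /cheb /=; case: (cheb_pair n). Qed.

Lemma cheb_ind (Q : nat -> Prop) :
  Q 0%N -> Q 1%N -> (forall n, Q n -> Q n.+1 -> Q n.+2) -> forall n, Q n.
Proof.
move=> Q0 Q1 QS n; suff : Q n /\ Q n.+1 by case.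
by elim: n => [//|n [? ?]]; split => //; exact: QS.
Qed.

Lemma cheb_cos n x : (cheb n).[cos x] = cos (n%:R * x).
Proof.
elim/cheb_ind: n => [||n IH0 IH1].
- by rewrite cheb0 hornerC mul0r cos0.
- by rewrite cheb1 hornerX mul1r.
rewrite chebSS hornerD hornerN hornerMn hornerM hornerX IH0 IH1.
have -> : n.+2%:R * x = n.+1%:R * x + x by rewrite -[n.+2]addn1 natrD mulrDl mul1r.
have -> : n%:R * x = n.+1%:R * x - x by rewrite -[n.+1]addn1 natrD mulrDl mul1r addrK.
by rewrite (cosB _ x) cosD mulr2n; ring.
Qed.

(** The recurrence gives [a n.+2 <= 2 * r * a n.+1 + a n] for the weighted coefficients, and q = 1 +
    2 r satisfies [2 * r * q + 1 <= q ^+ 2]. *)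
Lemma coef_cheb_le n r i : 0 <= r -> `|(cheb n)`_i| * r ^+ i <= (1 + 2 * r) ^+ n.
Proof.
move=> r0; have r1 : 1 <= 1 + 2 * r by lra.
elim/cheb_ind: n i => [i|i|n IH0 IH1 i].
- by rewrite cheb0 coefC; case: i => [|i]; rewrite ?normr1 ?mul1r ?normr0 ?mul0r.
- rewrite cheb1 coefX expr1; case: (i =P 1%N) => [->|_].
    by rewrite normr1 mul1r expr1; lra.
  by rewrite normr0 mul0r; lra.
rewrite chebSS coefB coefMn coefXM.
apply: (@le_trans _ _ (2 * r * (1 + 2 * r) ^+ n.+1 + (1 + 2 * r) ^+ n)).
  apply: (@le_trans _ _ (`|(if i == 0 then 0 else (cheb n.+1)`_i.-1) *+ 2| * r ^+ i
     + `|(cheb n)`_i| * r ^+ i)).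
    by rewrite -mulrDl ler_wpM2r ?exprn_ge0// ler_normB.
  rewrite lerD//; case: i => [|i] /=.
    by rewrite mul0rn normr0 mul0r !mulr_ge0 ?exprn_ge0//; lra.
  rewrite normrMn mulr2n exprS.
  have -> : (`|(cheb n.+1)`_i| + `|(cheb n.+1)`_i|) * (r * r ^+ i) =
    2 * r * (`|(cheb n.+1)`_i| * r ^+ i) by ring.
  by rewrite ler_wpM2l ?mulr_ge0.
have : (1 + 2 * r) ^+ n <= (1 + 2 * r) ^+ n.+1 by rewrite ler_weXn2l.
set v := (1 + 2 * r) ^+ n.+1 => h.
by rewrite [leRHS]exprS -/v (mulrDl 1 (2 * r)) mul1r [leRHS]addrC lerD2l.
Qed.

Definition cheb_span n P := exists c : nat -> R, P = \sum_(k < n) c k *: cheb k.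

Lemma cheb_spanD n P Q : cheb_span n P -> cheb_span n Q -> cheb_span n (P + Q).
Proof.
move=> [c ->] [d ->]; exists (fun k => c k + d k).
by rewrite -big_split; apply: eq_bigr => k _; rewrite scalerDl.
Qed.

Lemma cheb_spanZ n a P : cheb_span n P -> cheb_span n (a *: P).
Proof.
move=> [c ->]; exists (fun k => a * c k).
by rewrite scaler_sumr; apply: eq_bigr => k _; rewrite scalerA.
Qed.

Lemma cheb_span_sum n m (F : nat -> {poly R}) :
  (forall k, (k < m)%N -> cheb_span n (F k)) -> cheb_span n (\sum_(k < m) F k).
Proof.
elim: m => [_|m IH H]; rewrite ?big_ord0 ?big_ord_recr/=.
  by exists (fun=> 0); rewrite big1// => k _; rewrite scale0r.
by apply: cheb_spanD; [apply: IH => k km; apply: H; lia|exact: H].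
Qed.

Lemma cheb_span_cheb n k : (k < n)%N -> cheb_span n (cheb k).
Proof.
move=> kn; exists (fun j => (j == k)%:R).
rewrite (bigD1 (Ordinal kn))//= eqxx scale1r big1 ?addr0// => j.
by rewrite -val_eqE/= => /negbTE ->; rewrite scale0r.
Qed.

Lemma cheb_spanX n P : cheb_span n P -> cheb_span n.+1 ('X * P).
Proof.
move=> [c ->]; rewrite mulr_sumr.
apply: (@cheb_span_sum n.+1 n (fun k => 'X * (c k *: cheb k))) => k kn.
rewrite -scalerAr; apply: cheb_spanZ; case: k kn => [|k] kn.
  by rewrite cheb0 mulr1 -cheb1; apply: cheb_span_cheb; lia.
have -> : 'X * cheb k.+1 = (2 : R)^-1 *: (cheb k.+2 + cheb k).
  by rewrite chebSS subrK -(scaler_nat 2 ('X * cheb k.+1)) scalerA mulVf ?scale1r.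
by apply/cheb_spanZ/cheb_spanD; apply: cheb_span_cheb; lia.
Qed.

Lemma cheb_span_widen n m P : (n <= m)%N -> cheb_span n P -> cheb_span m P.
Proof.
move=> nm [c ->]; apply: (@cheb_span_sum m n (fun k => c k *: cheb k)) => k kn.
by apply/cheb_spanZ/cheb_span_cheb/(leq_trans kn).
Qed.

Lemma cheb_spanT n P : (size P <= n)%N -> cheb_span n P.
Proof.
move=> sP; rewrite -[P]coefK poly_def.
apply: (@cheb_span_sum n (size P) (fun k => P`_k *: 'X^k)) => k kP.
apply: cheb_spanZ; apply: (@cheb_span_widen k.+1); first exact: leq_trans sP.
elim: k {kP} => [|k IH]; first by rewrite expr0 -cheb0; exact: cheb_span_cheb.
by rewrite exprS; exact: cheb_spanX.
Qed.

(** The midpoint of part j when [0, pi] is cut into M equal parts; the cosines of these points are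
    the zeros of [cheb M]. *)
Definition node M j : R := pi * (2 * j%:R + 1) / (2 * M%:R).

Lemma node_gt0 M j : (0 < M)%N -> 0 < node M j.
Proof.
move=> M0; rewrite divr_gt0 ?mulr_gt0 ?pi_gt0 ?ltr0n// ltr_wpDl ?mulr_ge0.
Qed.

Lemma node_ltpi M j : (j < M)%N -> node M j < pi.
Proof.
move=> jM; have M0 : (0 : R) < M%:R by rewrite ltr0n; lia.
rewrite ltr_pdivrMr ?mulr_gt0// ltr_pM2l ?pi_gt0//.
by rewrite -!natrM natr1 ltr_nat; lia.
Qed.

(** Multiplying by [2 * sin h], where [2 * h] is the step of the angles, makes the sum telescope
    from sin 0 to sin of k times pi. *)
Lemma sum_cos_node M k : (0 < k < 2 * M)%N -> \sum_(j < M) cos (k%:R * node M j) = 0.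
Proof.
move=> /andP[k0 kM].
have M0 : (0 : R) < M%:R by rewrite ltr0n; lia.
pose h : R := k%:R * pi / (2 * M%:R).
have h0 : 0 < sin h.
  apply: sin_gt0_pi; rewrite divr_gt0 ?mulr_gt0 ?pi_gt0 ?ltr0n//= ?(leq_ltn_trans _ kM)//; last by lia.
  by rewrite ltr_pdivrMr ?mulr_gt0// mulrC ltr_pM2l ?pi_gt0// -natrM ltr_nat.
suff : (\sum_(j < M) cos (k%:R * node M j)) * (2 * sin h) = 0.
  by move/eqP; rewrite mulf_eq0 mulf_eq0 !pnatr_eq0/= (gt_eqF h0) !orbF => /eqP.
pose F j : R := sin (h * (2 * j%:R)).
transitivity (\sum_(0 <= j < M) (F j.+1 - F j)).
  rewrite big_mkord mulr_suml; apply: eq_bigr => j _.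
  have -> : k%:R * node M j = h * (2 * j%:R) + h by rewrite /node /h; field; lra.
  have -> : F j.+1 = sin (h * (2 * j%:R) + h + h).
    by rewrite /F -[j.+1]addn1 natrD; congr sin; ring.
  have -> : F j = sin (h * (2 * j%:R) + h - h) by rewrite addrK.
  by rewrite sinD sinB; ring.
rewrite telescope_sumr// /F mulr0 mulr0 sin0 subr0.
have -> : h * (2 * M%:R) = pi *+ k by rewrite /h -mulr_natr; field; lra.
elim: k {k0 kM h h0 F} => [|k IH]; first by rewrite mulr0n sin0.
by rewrite mulrSr sinDpi IH oppr0.
Qed.

Lemma sin_natpi k : sin (pi *+ k) = 0 :> R.
Proof.
elim: k => [|k IH]; first by rewrite mulr0n sin0.
by rewrite mulrSr sinDpi IH oppr0.
Qed.

Lemma cos_natpi k : cos (pi *+ k) = (-1) ^+ k :> R.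
Proof.
elim: k => [|k IH]; first by rewrite mulr0n cos0.
by rewrite mulrSr cosDpi IH exprS mulN1r.
Qed.

(** The same telescoping. The integral of the mode is [(1 - (-1) ^+ k) / k%:R], so the midpoint rule
    merely replaces 1 / h by 1 / sin h at [h = k * pi / (2 * M)]; this is where [cosec_defect] comes
    from. *)
Lemma sum_sin_node M k : (0 < k < 2 * M)%N ->
  \sum_(j < M) sin (k%:R * node M j) =
  (1 - (-1) ^+ k) / (2 * sin (k%:R * pi / (2 * M%:R))).
Proof.
move=> /andP[k0 kM].
have M0 : (0 : R) < M%:R by rewrite ltr0n; lia.
pose h : R := k%:R * pi / (2 * M%:R).
have h0 : 0 < sin h.
  apply: sin_gt0_pi; rewrite divr_gt0 ?mulr_gt0 ?pi_gt0 ?ltr0n//= ?(leq_ltn_trans _ kM)//; last by lia.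
  by rewrite ltr_pdivrMr ?mulr_gt0// mulrC ltr_pM2l ?pi_gt0// -natrM ltr_nat.
apply: (canRL (mulfK _)); first by rewrite mulf_neq0 ?pnatr_eq0// gt_eqF.
pose F j : R := - cos (h * (2 * j%:R)).
transitivity (\sum_(0 <= j < M) (F j.+1 - F j)).
  rewrite big_mkord mulr_suml; apply: eq_bigr => j _.
  have -> : k%:R * node M j = h * (2 * j%:R) + h by rewrite /node /h; field; lra.
  have -> : F j.+1 = - cos (h * (2 * j%:R) + h + h).
    by rewrite /F -[j.+1]addn1 natrD; congr (- cos _); ring.
  have -> : F j = - cos (h * (2 * j%:R) + h - h) by rewrite addrK.
  by rewrite -/h cosD cosB; ring.
rewrite telescope_sumr// /F mulr0 mulr0 cos0.
have -> : h * (2 * M%:R) = pi *+ k by rewrite /h -mulr_natr; field; lra.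
by rewrite cos_natpi; ring.
Qed.

Lemma sum_cos_cos_node M k l : (k < M)%N -> (l < M)%N ->
  \sum_(j < M) cos (k%:R * node M j) * cos (l%:R * node M j) =
  if k == l then (if k == 0 then M%:R else M%:R / 2) else 0.
Proof.
wlog : k l / (l <= k)%N.
  move=> H kM lM; have [/H|/ltnW/H] := leqP l k; first exact.
  move=> /(_ lM kM); rewrite eq_sym; case: eqP => [->//|_] e.
  by rewrite -[RHS]e; apply: eq_bigr => j _; rewrite mulrC.
move=> lk kM lM.
have -> : \sum_(j < M) cos (k%:R * node M j) * cos (l%:R * node M j) =
   (\sum_(j < M) cos ((k + l)%:R * node M j) +
    \sum_(j < M) cos ((k - l)%:R * node M j)) / 2.
  rewrite -big_split mulr_suml; apply: eq_bigr => j _ /=.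
  have -> : (k + l)%:R * node M j = k%:R * node M j + l%:R * node M j.
    by rewrite natrD mulrDl.
  have -> : (k - l)%:R * node M j = k%:R * node M j - l%:R * node M j.
    by rewrite natrB// mulrBl.
  by rewrite cosD (cosB (k%:R * _)); field.
have one : \sum_(j < M) cos (0%:R * node M j) = M%:R.
  under eq_bigr do rewrite mul0r cos0.
  by rewrite sumr_const card_ord.
case: (k =P l) => [->|/eqP kl].
  rewrite subnn one; case: (l =P 0) => [->|/eqP l0]; first by rewrite addn0 one; field.
  by rewrite sum_cos_node ?add0r//; lia.
by rewrite !sum_cos_node ?addr0 ?mul0r//; lia.
Qed.

(** Discrete orthogonality at the nodes recovers [c k] from the values of the polynomial there; the
    factor 2 is the normalization M / 2 of the nonconstant modes. *)
Lemma cheb_coef_le M n (c : nat -> R) B : (n <= M)%N ->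
  (forall x, `|(\sum_(k < n) c k *: cheb k).[cos x]| <= B) ->
  forall k, (k < n)%N -> `|c k| <= 2 * B.
Proof.
move=> nM PB k kn; set P := \sum_(_ < _) _ in PB.
have M0 : (0 : R) < M%:R by rewrite ltr0n; lia.
have B0 : 0 <= B by apply: le_trans (PB 0); exact: normr_ge0.
have E : \sum_(j < M) P.[cos (node M j)] * cos (k%:R * node M j) =
    c k * (if k == 0 then M%:R else M%:R / 2).
  transitivity (\sum_(l < n) c l * \sum_(j < M) cos (l%:R * node M j) * cos (k%:R * node M j)).
    under eq_bigr do rewrite horner_sum mulr_suml.
    rewrite exchange_big /=; apply: eq_bigr => l _.
    rewrite mulr_sumr; apply: eq_bigr => j _.
    by rewrite hornerZ cheb_cos mulrA.
  have kM : (k < M)%N by lia.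
  rewrite (bigD1 (Ordinal kn))//= sum_cos_cos_node// eqxx big1 ?addr0// => l.
  rewrite -val_eqE/= => lk; rewrite sum_cos_cos_node ?(negbTE lk) ?mulr0//.
  by have := ltn_ord l; lia.
have : `|c k * (if k == 0 then M%:R else M%:R / 2)| <= B * M%:R.
  rewrite -E (le_trans (ler_norm_sum _ _ _))//.
  apply: ler_sum_cst => j; rewrite normrM -[leRHS]mulr1.
  by apply: ler_pM => //; exact: cos_max.
rewrite normrM; case: ifP => _.
  rewrite (gtr0_norm M0) ler_pM2r//; lra.
rewrite [X in _ * X]gtr0_norm ?divr_gt0//.
have -> : `|c k| * (M%:R / 2) = (`|c k| / 2) * M%:R by ring.
by rewrite ler_pM2r//; lra.
Qed.

(** Expansion in Chebyshev polynomials: each of the n coefficients is at most 2 B, and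
    [coef_cheb_le] bounds each basis polynomial. The free parameter r is later taken larger than the
    radius of a layer, which turns the bound into geometric decay. *)
Lemma coef_poly_le n P B r i : (size P <= n)%N -> 0 <= r ->
  (forall x, `|P.[cos x]| <= B) ->
  `|P`_i| * r ^+ i <= 2 * B * n%:R * (1 + 2 * r) ^+ n.
Proof.
move=> sP r0 PB; have [c Pc] := cheb_spanT sP.
have cB k : (k < n)%N -> `|c k| <= 2 * B.
  by apply: (@cheb_coef_le n n) => // x; rewrite -Pc.
have B0 : 0 <= B by apply: le_trans (PB 0); exact: normr_ge0.
rewrite Pc coef_sum (le_trans (ler_wpM2r _ (ler_norm_sum _ _ _))) ?exprn_ge0//.
rewrite mulr_suml mulrAC.
apply: ler_sum_cst => k; rewrite coefZ normrM -mulrA.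
apply: ler_pM => //; [by rewrite mulr_ge0 ?exprn_ge0|exact: cB|].
apply: le_trans (coef_cheb_le _ _ r0) _.
by rewrite ler_weXn2l ?(ltnW (ltn_ord k))//; lra.
Qed.


Local Notation intg a b F := (\int[@lebesgue_measure R]_(x in `[a, b]) F x).

Lemma continuous_cosM (a : R) : continuous (fun x => cos (a * x)).
Proof.
move=> x; apply: continuous_comp; last exact: continuous_cos.
by apply: cvgM; [exact: cvg_cst|exact: cvg_id].
Qed.

Lemma continuous_sinM (a : R) : continuous (fun x => sin (a * x)).
Proof.
move=> x; apply: continuous_comp; last exact: continuous_sin.
by apply: cvgM; [exact: cvg_cst|exact: cvg_id].
Qed.

Lemma is_derive_mull (a x : R) : is_derive x 1 (fun x : R => a * x) a.
Proof. by apply: is_derive_eq; rewrite /GRing.scale/=; lra. Qed.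

Lemma intg_cosM k : (0 < k)%N -> intg 0 pi (fun x : R => cos (k%:R * x)) = 0.
Proof.
move=> k0; have kn0 : k%:R != 0 :> R by rewrite pnatr_eq0; lia.
rewrite [RHS](_ : _ = k%:R^-1 * sin (k%:R * pi) - k%:R^-1 * sin (k%:R * 0)); last first.
  by rewrite mulr_natl sin_natpi !mulr0 sin0 mulr0 subr0.
apply: (@intg_FTC R (fun x => k%:R^-1 * sin (k%:R * x))).
- exact: pi_ge0.
- exact: continuous_cosM.
move=> x _.
have ds : is_derive (k%:R * x) 1 sin (cos (k%:R * x)) by exact: is_derive_sin.
have := is_deriveZ k%:R^-1 (is_derive1_comp ds (is_derive_mull k%:R x)).
by rewrite /GRing.scale/= mulrA mulrAC mulVf ?mul1r.
Qed.

Lemma intg_sinM k : (0 < k)%N ->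
  intg 0 pi (fun x : R => sin (k%:R * x)) = (1 - (-1) ^+ k) / k%:R.
Proof.
move=> k0; have kn0 : k%:R != 0 :> R by rewrite pnatr_eq0; lia.
have -> : (1 - (-1) ^+ k) / k%:R =
    - k%:R^-1 * cos (k%:R * pi) - - k%:R^-1 * cos (k%:R * 0) :> R.
  by rewrite mulr_natl cos_natpi mulr0 cos0 mulr1; field.
apply: (@intg_FTC R (fun x => - k%:R^-1 * cos (k%:R * x))).
- exact: pi_ge0.
- exact: continuous_sinM.
move=> x _.
have ds : is_derive (k%:R * x) 1 cos (- sin (k%:R * x)) by exact: is_derive_cos.
have := is_deriveZ (- k%:R^-1) (is_derive1_comp ds (is_derive_mull k%:R x)).
by rewrite /GRing.scale/= (_ : _ * (_ * _) = sin (k%:R * x)); last by field.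
Qed.

Lemma continuous_horner_cos P : continuous (fun x => P.[cos x]).
Proof.
move=> x; apply: (@continuous_comp _ _ _ cos (fun y => P.[y])).
  exact: continuous_cos.
exact: continuous_horner.
Qed.

(** Sum and integral both annihilate every nonconstant cosine mode of frequency below 2 M, so the
    rule is exact. *)
Lemma midpoint_cos M P : (size P <= 2 * M)%N -> (0 < M)%N ->
  pi / M%:R * \sum_(j < M) P.[cos (node M j)] = intg 0 pi (fun x => P.[cos x]).
Proof.
move=> sP M0; have M0' : M%:R != 0 :> R by rewrite pnatr_eq0; lia.
have [c ->] := cheb_spanT sP.
under eq_bigr do rewrite horner_sum.
rewrite exchange_big/= mulr_sumr.
under eq_Rintegral do rewrite horner_sum.
rewrite intg_sum; last first.
  by move=> k; exact: continuous_horner_cos.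
apply: eq_bigr => k _.
under eq_bigr do rewrite hornerZ cheb_cos.
under eq_Rintegral do rewrite hornerZ cheb_cos.
rewrite -mulr_sumr mulrCA intgZ; last exact: continuous_cosM.
congr (_ * _); have [k0|k0] := posnP k.
  under eq_bigr do rewrite k0 mul0r cos0.
  under eq_Rintegral do rewrite k0 mul0r cos0.
  by rewrite intg_cst ?pi_ge0// sumr_const card_ord; field.
by rewrite intg_cosM// sum_cos_node ?mulr0// k0/=.
Qed.

(** The frequency is the real number [k%:R - 1] and not [k.-1]: for k = 0 it is -1, and the odd sine
    then contributes with the opposite sign. *)
Lemma intg_cos_sin k : intg 0 pi (fun x : R => cos (k%:R * x) * sin x) =
  (intg 0 pi (fun x : R => sin (k.+1%:R * x))
   - intg 0 pi (fun x : R => sin ((k%:R - 1) * x))) / 2.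
Proof.
rewrite -intgB; [|exact: continuous_sinM|exact: continuous_sinM].
rewrite mulrC -intgZ; last first.
  by move=> x; apply: cvgB; exact: continuous_sinM.
apply: eq_Rintegral => x _; rewrite (_ : k.+1%:R * x = k%:R * x + x); last first.
  by rewrite -[k.+1]addn1 natrD mulrDl mul1r.
by rewrite mulrBl mul1r (sinB _ x) sinD; field.
Qed.

Lemma sum_cos_sin M k : \sum_(j < M) cos (k%:R * node M j) * sin (node M j) =
  (\sum_(j < M) sin (k.+1%:R * node M j) - \sum_(j < M) sin ((k%:R - 1) * node M j)) / 2.
Proof.
rewrite -sumrB mulr_suml; apply: eq_bigr => j _.
move: (node M j) => x; rewrite (_ : k.+1%:R * x = k%:R * x + x); last first.
  by rewrite -[k.+1]addn1 natrD mulrDl mul1r.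
by rewrite (mulrBl x) mul1r (sinB _ x) sinD; field.
Qed.

(** The product is half the difference of the sine modes k + 1 and k - 1. Modes of even frequency
    have no error; for odd frequencies the errors are [pi / M] times values of [cosec_defect] at
    points [pi / M] apart. The Lipschitz bound makes their difference of order M^-2 uniformly in k,
    which is what survives the summation over M modes. *)
Lemma midpoint_cos_sin_mode M k : (k < M)%N ->
  `|pi / M%:R * (\sum_(j < M) cos (k%:R * node M j) * sin (node M j)) -
    intg 0 pi (fun x : R => cos (k%:R * x) * sin x)| <= (pi / M%:R) ^+ 2.
Proof.
move=> kM; have M0 : (0 : R) < M%:R by rewrite ltr0n; lia.
have pi0 := pi_gt0 R.
pose h l : R := l%:R * pi / (2 * M%:R).
have h0 l : (0 < l <= M)%N -> 0 < h l <= pi / 2.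
  move=> /andP[l0 lM]; rewrite divr_gt0 ?mulr_gt0 ?ltr0n//=; last by lia.
  rewrite ler_pdivrMr ?mulr_gt0//.
  have -> : pi / 2 * (2 * M%:R) = M%:R * pi :> R by field.
  by rewrite ler_pM2r// ler_nat.
have mode l : (0 < l <= M)%N -> odd l -> pi / M%:R * (\sum_(j < M) sin (l%:R * node M j)) -
    intg 0 pi (fun x : R => sin (l%:R * x)) = pi / M%:R * cosec_defect (h l).
  move=> lM ol; rewrite sum_sin_node ?intg_sinM//; [|by lia|by lia].
  rewrite -/(h l) -signr_odd ol expr1 /cosec_defect.
  have sh : sin (h l) != 0 by rewrite gt_eqF// sin_gt0_pi//; have := h0 l lM; lra.
  have l0 : l%:R != 0 :> R by rewrite pnatr_eq0; lia.
  rewrite mulrBr; congr (_ - _); first by field; rewrite sh; lra.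
  rewrite /h; have {}pi0 : pi != 0 :> R by rewrite gt_eqF.
  have {}M0 : M%:R != 0 :> R by rewrite gt_eqF.
  have a : (1 - -1) / l%:R * (l%:R * pi / (2 * M%:R)) = pi / M%:R :> R.
    by rewrite opprK; field; rewrite M0 l0.
  by rewrite -a mulfK// mulf_neq0 ?invr_neq0 ?mulf_neq0.
have mode_even l : (l < 2 * M)%N -> ~~ odd l ->
   pi / M%:R * (\sum_(j < M) sin (l%:R * node M j)) -
    intg 0 pi (fun x : R => sin (l%:R * x)) = 0.
  move=> lM ol; have [->|l0] := posnP l.
    under eq_bigr do rewrite mul0r sin0.
    under eq_Rintegral do rewrite mul0r sin0.
    by rewrite big1// intg_cst ?pi_ge0// mulr0 mul0r subrr.
  rewrite sum_sin_node ?intg_sinM//; last by rewrite l0.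
  by rewrite -signr_odd (negbTE ol) expr0 subrr !mul0r mulr0 subrr.
rewrite intg_cos_sin sum_cos_sin.
have [k0|k0] := posnP k.
  have e : \sum_(j < M) sin (1 * node M j) = \sum_(j < M) sin (1%:R * node M j) by [].
  have -> : \sum_(j < M) sin ((k%:R - 1) * node M j) = - \sum_(j < M) sin (1%:R * node M j).
    by rewrite -sumrN; apply: eq_bigr => j _; rewrite k0 sub0r mulN1r sinN mul1r.
  have -> : intg 0 pi (fun x : R => sin ((k%:R - 1) * x)) =
      - intg 0 pi (fun x : R => sin (1%:R * x)).
    rewrite -[RHS]mulN1r -intgZ; last exact: continuous_sinM.
    by apply: eq_Rintegral => x _; rewrite k0 sub0r mulN1r sinN mul1r mulN1r.
  have halves (S I : R) : pi / M%:R * ((S - - S) / 2) - (I - - I) / 2 = pi / M%:R * S - I.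
    by field; lra.
  rewrite !k0 halves mode//; last by lia.
  rewrite normrM gtr0_norm ?divr_gt0// expr2 ler_pM2l ?divr_gt0//.
  have h1 : 0 < h 1%N <= pi / 2 by apply: h0; lia.
  apply: le_trans (cosec_defect_le h1) _.
  by rewrite /h le_eqVlt; apply/orP; left; apply/eqP; field; lra.
have k1E : k%:R - 1 = k.-1%:R :> R by rewrite -[in LHS](prednK k0) -[k.-1.+1]addn1 natrD addrK.
rewrite k1E.
have halves (S1 S2 I1 I2 : R) : pi / M%:R * ((S1 - S2) / 2) - (I1 - I2) / 2 =
   ((pi / M%:R * S1 - I1) - (pi / M%:R * S2 - I2)) / 2 by field; lra.
rewrite halves; have [ok|ek] := boolP (odd k).
  by rewrite !mode_even ?subr0 ?mul0r ?normr0 ?sqr_ge0//; lia.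
rewrite !mode; try lia.
rewrite -mulrBr -mulrA normrM gtr0_norm ?divr_gt0// expr2 ler_pM2l ?divr_gt0//.
rewrite normrM [X in _ * X]gtr0_norm ?invr_gt0// ler_pdivrMr//.
apply: le_trans (cosec_defect_lipschitz _ _ _) _.
- by have /andP[] : 0 < h k.-1 <= pi / 2 by apply: h0; lia.
- by rewrite /h ler_pM2r ?invr_gt0 ?mulr_gt0// ler_pM2r// ler_nat; lia.
- by have /andP[] : 0 < h k.+1 <= pi / 2 by apply: h0; lia.
rewrite /h -k1E -[k.+1]addn1 natrD le_eqVlt; apply/orP; left; apply/eqP; field; lra.
Qed.

(** There are M modes, with coefficients at most 2 B and errors at most [(pi / M) ^+ 2] each. *)
Lemma midpoint_cos_sin M P B : (size P <= M)%N -> (0 < M)%N ->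
  (forall x, `|P.[cos x]| <= B) ->
  `|pi / M%:R * (\sum_(j < M) P.[cos (node M j)] * sin (node M j)) -
    intg 0 pi (fun x => P.[cos x] * sin x)| <= 2 * pi ^+ 2 * B / M%:R.
Proof.
move=> sP M0 PB; have M0' : (0 : R) < M%:R by rewrite ltr0n; lia.
have B0 : 0 <= B by apply: le_trans (PB 0); exact: normr_ge0.
have [c Pc] := cheb_spanT sP.
have cB k : (k < M)%N -> `|c k| <= 2 * B.
  by apply: (@cheb_coef_le M M) => // x; rewrite -Pc.
rewrite Pc.
have -> : \sum_(j < M) (\sum_(k < M) c k *: cheb k).[cos (node M j)] * sin (node M j) =
   \sum_(k < M) c k * \sum_(j < M) cos (k%:R * node M j) * sin (node M j).
  under eq_bigr do rewrite horner_sum mulr_suml.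
  rewrite exchange_big/=; apply: eq_bigr => k _; rewrite mulr_sumr.
  by apply: eq_bigr => j _; rewrite hornerZ cheb_cos mulrA.
have cc k : continuous (fun x : R => cos (k%:R * x) * sin x).
  by move=> x; apply: cvgM; [exact: continuous_cosM|exact: continuous_sin].
have -> : intg 0 pi (fun x => (\sum_(k < M) c k *: cheb k).[cos x] * sin x) =
   \sum_(k < M) c k * intg 0 pi (fun x : R => cos (k%:R * x) * sin x).
  under eq_Rintegral do rewrite horner_sum mulr_suml.
  rewrite intg_sum; last first.
    move=> k x; apply: cvgM; [exact: continuous_horner_cos|exact: continuous_sin].
  apply: eq_bigr => k _; rewrite -intgZ//.
  by apply: eq_Rintegral => x _; rewrite hornerZ cheb_cos mulrA.
rewrite mulr_sumr -sumrB (le_trans (ler_norm_sum _ _ _))//.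
have -> : 2 * pi ^+ 2 * B / M%:R = (2 * B * (pi / M%:R) ^+ 2) * M%:R.
  by rewrite !expr2; field; lra.
apply: ler_sum_cst => k; rewrite mulrCA -mulrBr normrM.
by apply: ler_pM => //; [exact: cB|exact: midpoint_cos_sin_mode].
Qed.

(** Even powers of the sine are polynomials in the cosine and are absorbed into P. At most one
    factor [sin] remains; without it the rule is exact. *)
Lemma midpoint_cos_sinX a M P B : (size P + a <= M)%N -> (0 < M)%N ->
  (forall x, `|P.[cos x]| <= B) ->
  `|pi / M%:R * (\sum_(j < M) P.[cos (node M j)] * sin (node M j) ^+ a) -
    intg 0 pi (fun x => P.[cos x] * sin x ^+ a)| <= 2 * pi ^+ 2 * B / M%:R.
Proof.
move=> sP M0 PB.
have B0 : 0 <= B by apply: le_trans (PB 0); exact: normr_ge0.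
pose Q := P * (1 - 'X ^+ 2) ^+ a./2.
have QE x : Q.[cos x] = P.[cos x] * sin x ^+ (a./2).*2.
  by rewrite hornerM horner_exp !hornerE -sin2cos2 -exprM mul2n.
have QB x : `|Q.[cos x]| <= B.
  rewrite QE normrM -[leRHS]mulr1; apply: ler_pM => //.
  by rewrite normrX exprn_ile1// sin_max.
have sQ : (size Q <= size P + (a./2).*2)%N.
  apply: leq_trans (size_polyMleq _ _) _.
  have : (size ((1 - 'X ^+ 2) ^+ a./2 : {poly R})%R <= (a./2).*2.+1)%N.
    apply: leq_trans (size_poly_exp_leq _ _) _.
    have : (size (1 - 'X ^+ 2 : {poly R})%R <= 3)%N.
      by rewrite (leq_trans (size_polyD _ _))// geq_max size_polyN size_poly1 size_polyXn.
    by move: (size _) => z; nia.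
  by lia.
have := odd_double_half a; case: (odd a) => /= ea.
  have e x : P.[cos x] * sin x ^+ a = Q.[cos x] * sin x.
    by rewrite QE -mulrA -exprSr -add1n ea.
  under eq_bigr do rewrite e.
  under eq_Rintegral do rewrite e.
  by apply: midpoint_cos_sin => //; lia.
have e x : P.[cos x] * sin x ^+ a = Q.[cos x] by rewrite QE -[in LHS]ea.
under eq_bigr do rewrite e.
under eq_Rintegral do rewrite e.
rewrite midpoint_cos//; last by lia.
by rewrite subrr normr0 divr_ge0// mulr_ge0// mulr_ge0// sqr_ge0.
Qed.

End chebyshev.

(** * Polynomial functions on the sphere *)

Section polynomial_functions.
Context {R : realType}.

(** Homogeneous polynomial functions, given by generation rather than by coefficients, so that
    properties follow by induction on the construction. The zero function has every degree. *)
Inductive hom n : nat -> ('rV[R]_n -> R) -> Prop :=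
| hom_zero k : hom k (fun=> 0)
| hom_one : hom 0 (fun=> 1)
| homX k i f : hom k f -> hom k.+1 (fun x => x ord0 i * f x)
| homD k f g : hom k f -> hom k g -> hom k (fun x => f x + g x)
| homZ k c f : hom k f -> hom k (fun x => c * f x).

Definition nsq n (x : 'rV[R]_n) : R := \sum_(i < n) x ord0 i ^+ 2.

Definition rcons0 n (u : R) (y : 'rV[R]_n) : 'rV[R]_n.+1 := rV_cons (u, y).

Lemma nsq_ge0 n (x : 'rV[R]_n) : 0 <= nsq x.
Proof. by apply: sumr_ge0 => i _; exact: sqr_ge0. Qed.

Lemma nsq_rcons0 n u (y : 'rV[R]_n) : nsq (rcons0 u y) = u ^+ 2 + nsq y.
Proof.
rewrite /nsq big_ord_recl /rcons0 rV_cons_ord0; congr (_ + _).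
by apply: eq_bigr => i _; rewrite rV_cons_lift.
Qed.

Lemma nsqZ n s (y : 'rV[R]_n) : nsq (s *: y) = s ^+ 2 * nsq y.
Proof. by rewrite /nsq mulr_sumr; apply: eq_bigr => i _; rewrite mxE exprMn. Qed.

Lemma nsq0 n : nsq (0 : 'rV[R]_n) = 0.
Proof. by rewrite -(scale0r 0) nsqZ expr0n mul0r. Qed.

Lemma nsq_le0 n (x : 'rV[R]_n) : (nsq x <= 0) = (x == 0).
Proof.
apply/idP/eqP => [x0|->]; last by rewrite nsq0.
apply/rowP => i; rewrite mxE; apply/eqP; rewrite -sqrf_eq0 eq_le sqr_ge0 andbT.
by apply: le_trans x0; rewrite /nsq (bigD1 i)//= lerDl sumr_ge0// => j _; exact: sqr_ge0.
Qed.

Lemma enorm_sqr n (x : 'rV[R]_n) : enorm x ^+ 2 = nsq x.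
Proof. by rewrite sqr_sqrtr// nsq_ge0. Qed.

Lemma enorm_ge0 n (x : 'rV[R]_n) : 0 <= enorm x. Proof. exact: sqrtr_ge0. Qed.

Lemma enorm1E n (x : 'rV[R]_n) : (enorm x = 1) <-> (nsq x = 1).
Proof.
split=> [e|e]; first by rewrite -enorm_sqr e expr1n.
by rewrite /enorm -/(nsq x) e sqrtr1.
Qed.

Lemma homS n k (f g : 'rV[R]_n -> R) : f =1 g -> hom k f -> hom k g.
Proof. by move=> /funext ->. Qed.

Lemma hom_sum n k (I : Type) (r : seq I) (F : I -> 'rV[R]_n -> R) :
  (forall i, hom k (F i)) -> hom k (fun x => \sum_(i <- r) F i x).
Proof.
move=> HF; elim: r => [|i r IH].
  by apply: homS (hom_zero _ _) => x; rewrite big_nil.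
by apply: homS (homD (HF i) IH) => x; rewrite big_cons.
Qed.

Lemma hom_nsq n k (f : 'rV[R]_n -> R) : hom k f -> hom k.+2 (fun x => nsq x * f x).
Proof.
move=> Hf.
apply: (@homS n k.+2 (fun x => \sum_(i <- enum 'I_n) x ord0 i * (x ord0 i * f x))).
  by move=> x; rewrite /nsq mulr_suml big_enum/=; apply: eq_bigr => i _; rewrite mulrA.
by apply: hom_sum => i; do 2 apply: homX.
Qed.

Lemma hom_scale n k (f : 'rV[R]_n -> R) s x : hom k f -> f (s *: x) = s ^+ k * f x.
Proof.
elim=> {k f} [k||k i f _ ->|k f g _ -> _ ->|k c f _ ->]; rewrite ?mulr0 ?mulr1//.
- by rewrite mxE exprS; ring.
- by rewrite mulrDr.
- by rewrite mulrCA.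
Qed.

Lemma coord_le n (x : 'rV[R]_n) i : nsq x <= 1 -> `|x ord0 i| <= 1.
Proof.
move=> x1; rewrite -(@expr_le1 _ 2)// real_normK ?num_real//.
by apply: le_trans x1; rewrite /nsq (bigD1 i)//= lerDl sumr_ge0// => j _; exact: sqr_ge0.
Qed.

Lemma hom_bounded n k (f : 'rV[R]_n -> R) : hom k f ->
  exists2 C, 0 <= C & forall x, nsq x <= 1 -> `|f x| <= C.
Proof.
elim=> {k f} [k||k i f _ [C C0 fC]|k f g _ [C C0 fC] _ [D D0 gD]|k c f _ [C C0 fC]].
- by exists 0 => // x _; rewrite normr0.
- by exists 1 => // x _; rewrite normr1.
- exists C => // x x1; rewrite normrM -[leRHS]mul1r.
  by apply: ler_pM => //; [exact: coord_le|exact: fC].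
- exists (C + D); first exact: addr_ge0.
  by move=> x x1; rewrite (le_trans (ler_normD _ _))// lerD ?fC ?gD.
- exists (`|c| * C); first by rewrite mulr_ge0.
  by move=> x x1; rewrite normrM ler_wpM2l// fC.
Qed.

Lemma hom_measurable n k (f : 'rV[R]_n -> R) : hom k f ->
  measurable_fun [set: 'rV[R]_n] (f : 'rV[R]_n -> measurableTypeR R).
Proof.
elim=> {k f} [k||k i f _ IH|k f g _ IHf _ IHg|k c f _ IH].
- exact: measurable_cst.
- exact: measurable_cst.
- by apply: measurable_funM => //; exact: (measurable_rV_coord i).
- exact: measurable_funD.
- by apply: measurable_funM => //; exact: measurable_cst.
Qed.

Lemma hom_continuous_path n k (f : 'rV[R]_n -> R) (c : R -> 'rV[R]_n) : hom k f ->
  (forall i, continuous (fun s => c s ord0 i)) -> continuous (fun s => f (c s)).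
Proof.
move=> Hf cc; elim: Hf => {k f} [k||k i f _ IH|k f g _ IHf _ IHg|k a f _ IH].
- exact: cst_continuous.
- exact: cst_continuous.
- by move=> s; apply: cvgM; [exact: cc|exact: IH].
- by move=> s; apply: cvgD; [exact: IHf|exact: IHg].
- by move=> s; apply: cvgM; [exact: cvg_cst|exact: IH].
Qed.

Lemma hom_rcons0 n k (f : 'rV[R]_n.+1 -> R) : hom k f ->
  exists2 g : nat -> 'rV[R]_n -> R, (forall a, (a <= k)%N -> hom (k - a) (g a)) &
    forall u y, f (rcons0 u y) = \sum_(a < k.+1) u ^+ a * g a y.
Proof.
elim=> {k f} [k||k i f _ [g Hg fE]|k f h _ [g Hg fE] _ [g' Hg' hE]|k c f _ [g Hg fE]].
- exists (fun _ _ => 0) => [a _|u y]; first exact: hom_zero.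
  by rewrite big1// => a _; rewrite mulr0.
- exists (fun _ _ => 1) => [[|a]//= _|u y]; first exact: hom_one.
  by rewrite big_ord_recl big_ord0 expr0 mulr1 addr0.
- case: (unliftP ord0 i) => [j|] ->.
    exists (fun a (y : 'rV_n) => if (a <= k)%N then y ord0 j * g a y else 0) => [a ak|u y].
      case: leqP => ka; last exact: hom_zero.
      by rewrite subSn//; apply/homX/Hg.
    rewrite big_ord_recr/= ltnn mulr0 addr0 fE /rcons0 rV_cons_lift mulr_sumr.
    by apply: eq_bigr => a _; rewrite -ltnS ltn_ord mulrCA.
  exists (fun a y => if a is a'.+1 then g a' y else 0) => [[|a] ak|u y].
  - exact: hom_zero.
  - by rewrite subSS; exact: Hg.
  - rewrite big_ord_recl/= mulr0 add0r fE /rcons0 rV_cons_ord0 mulr_sumr.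
    by apply: eq_bigr => a _; rewrite exprS mulrA.
- exists (fun a y => g a y + g' a y) => [a ak|u y]; first by apply: homD; [exact: Hg|exact: Hg'].
  by rewrite fE hE -big_split/=; apply: eq_bigr => a _; rewrite mulrDr.
- exists (fun a y => c * g a y) => [a ak|u y]; first by apply/homZ/Hg.
  by rewrite fE mulr_sumr; apply: eq_bigr => a _; rewrite mulrCA.
Qed.

(* Polynomial functions of degree strictly less than [t]. *)
Definition plt n t (f : 'rV[R]_n -> R) :=
  exists2 g : nat -> 'rV[R]_n -> R, (forall k, hom k (g k)) &
    f = fun x => \sum_(k < t) g k x.

Lemma plt0 n t : @plt n t (fun=> 0).
Proof.
exists (fun _ _ => 0); first by move=> k; exact: hom_zero.
by apply/funext => x; rewrite big1.
Qed.

Lemma plt_hom n k t (f : 'rV[R]_n -> R) : (k < t)%N -> hom k f -> plt t f.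
Proof.
move=> kt Hf; exists (fun j x => if j == k then f x else 0).
  by move=> j; case: eqP => [->//|_]; exact: hom_zero.
apply/funext => x; rewrite (bigD1 (Ordinal kt))//= eqxx big1 ?addr0// => j.
by rewrite -val_eqE/= => /negbTE ->.
Qed.

Lemma pltD n t (f g : 'rV[R]_n -> R) : plt t f -> plt t g ->
  plt t (fun x => f x + g x).
Proof.
move=> [F HF ->] [G HG ->]; exists (fun k x => F k x + G k x).
  by move=> k; exact: homD.
by apply/funext => x; rewrite -big_split.
Qed.

Lemma pltZ n t c (f : 'rV[R]_n -> R) : plt t f -> plt t (fun x => c * f x).
Proof.
move=> [F HF ->]; exists (fun k x => c * F k x).
  by move=> k; exact: homZ.
by apply/funext => x; rewrite mulr_sumr.
Qed.

Lemma pltN n t (f : 'rV[R]_n -> R) : plt t f -> plt t (fun x => - f x).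
Proof.
by move=> /(pltZ (-1)); rewrite (_ : (fun x => _) = (fun x => - f x))//; apply/funext => x; rewrite mulN1r.
Qed.

Lemma plt_sum n t (I : Type) (r : seq I) (F : I -> 'rV[R]_n -> R) :
  (forall i, plt t (F i)) -> plt t (fun x => \sum_(i <- r) F i x).
Proof.
move=> HF; elim: r => [|i r IH].
  by rewrite (_ : (fun x => _) = (fun=> 0)); [exact: plt0|apply/funext => x; rewrite big_nil].
rewrite (_ : (fun x => _) = (fun x => F i x + \sum_(i <- r) F i x)); first exact: pltD.
by apply/funext => x; rewrite big_cons.
Qed.

Lemma plt_widen n t u (f : 'rV[R]_n -> R) : (t <= u)%N -> plt t f -> plt u f.
Proof.
move=> tu [F HF ->].
apply: (@plt_sum n u 'I_t (index_enum _) (fun (k : 'I_t) => F k)) => k.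
by apply: (@plt_hom n k) => //; exact: leq_trans tu.
Qed.

Lemma pltX n t i (f : 'rV[R]_n -> R) : plt t f -> plt t.+1 (fun x => x ord0 i * f x).
Proof.
move=> [F HF ->]; rewrite (_ : (fun x => _) = (fun x : 'rV_n => \sum_(k < t) x ord0 i * F k x)).
  apply: (@plt_sum n t.+1 'I_t (index_enum _) (fun (k : 'I_t) (x : 'rV_n) => x ord0 i * F k x)) => k.
  by apply: (@plt_hom n k.+1); [rewrite ltnS|exact: (homX i (HF k))].
by apply/funext => x; rewrite mulr_sumr.
Qed.

Lemma plt_nsq n t (f : 'rV[R]_n -> R) : plt t f -> plt t.+2 (fun x => nsq x * f x).
Proof.
move=> [F HF ->]; rewrite (_ : (fun x => _) = (fun x => \sum_(k < t) nsq x * F k x)).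
  apply: (@plt_sum n t.+2 'I_t (index_enum _) (fun (k : 'I_t) x => nsq x * F k x)) => k.
  by apply: (@plt_hom n k.+2); [rewrite !ltnS|apply: hom_nsq; exact: HF].
by apply/funext => x; rewrite mulr_sumr.
Qed.

Lemma plt_cst n t c : @plt n t.+1 (fun=> c).
Proof.
apply: (@plt_hom n 0) => //.
by apply: homS (homZ c (hom_one n)) => x; rewrite mulr1.
Qed.

Lemma plt_bounded n t (f : 'rV[R]_n -> R) : plt t f ->
  exists2 C, 0 <= C & forall x, nsq x <= 1 -> `|f x| <= C.
Proof.
move=> [F HF ->]; elim: t => [|t [C C0 IH]].
  by exists 0 => // x _; rewrite big_ord0 normr0.
have [D D0 FD] := hom_bounded (HF t).
exists (C + D); first exact: addr_ge0.
move=> x x1; rewrite big_ord_recr/= (le_trans (ler_normD _ _))// lerD ?IH ?FD//.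
Qed.

Lemma plt_measurable n t (f : 'rV[R]_n -> R) : plt t f ->
  measurable_fun [set: 'rV[R]_n] (f : 'rV[R]_n -> measurableTypeR R).
Proof.
move=> [F HF ->]; apply: measurable_sum => k; exact: hom_measurable (HF k).
Qed.

Lemma plt_continuous_path n t (f : 'rV[R]_n -> R) (c : R -> 'rV[R]_n) : plt t f ->
  (forall i, continuous (fun s => c s ord0 i)) -> continuous (fun s => f (c s)).
Proof.
move=> [F HF ->] cc; apply: continuous_sumr => k; exact: hom_continuous_path (HF k) cc.
Qed.

Lemma plt_subst n t (f : 'rV[R]_n.+1 -> R) u s : plt t f ->
  plt t (fun y => f (rcons0 u (s *: y))).
Proof.
have HP k g : @hom n.+1 k g -> plt k.+1 (fun y => g (rcons0 u (s *: y))).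
  elim=> {k g} [k||k i g _ IH|k g h _ IHg _ IHh|k c g _ IH].
  - exact: plt0.
  - exact: plt_cst.
  - case: (unliftP ord0 i) => [j|] ->.
      rewrite (_ : (fun y => _) =
        (fun y : 'rV_n => s * (y ord0 j * g (rcons0 u (s *: y))))).
        by apply: pltZ; apply: (pltX j IH).
      by apply/funext => y; rewrite [in LHS]/rcons0 rV_cons_lift mxE mulrA.
    rewrite (_ : (fun y => _) = (fun y : 'rV_n => u * g (rcons0 u (s *: y)))).
      by apply: pltZ; apply: (plt_widen _ IH).
    by apply/funext => y; rewrite [in LHS]/rcons0 rV_cons_ord0.
  - exact: (pltD IHg IHh).
  - exact: (pltZ c IH).
move=> [F HF ->].
apply: (@plt_sum n t 'I_t (index_enum _) (fun (k : 'I_t) (y : 'rV_n) => F k (rcons0 u (s *: y)))) => k.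
by apply: plt_widen (HP _ _ (HF k)).
Qed.

(* On the sphere [u ^+ 2 = 1 - nsq y], so only the powers 0 and 1 of the first
   coordinate are needed. *)
Lemma plt_split n t (f : 'rV[R]_n.+1 -> R) : plt t.+1 f ->
  exists G H : 'rV[R]_n -> R, [/\ plt t.+1 G, plt t H &
    forall u y, u ^+ 2 + nsq y = 1 -> f (rcons0 u y) = G y + u * H y].
Proof.
have HP k g : @hom n.+1 k g -> exists G H : 'rV[R]_n -> R, [/\ plt k.+1 G, plt k H &
    forall u y, u ^+ 2 + nsq y = 1 -> g (rcons0 u y) = G y + u * H y].
  elim=> {k g} [k||k i g _ [G [H [HG HH E]]]|k g h _ [G [H [HG HH E]]] _ [G' [H' [HG' HH' E']]]|k c g _ [G [H [HG HH E]]]].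
  - by exists (fun=> 0), (fun=> 0); split; [exact: plt0|exact: plt0|move=> *; rewrite mulr0 addr0].
  - by exists (fun=> 1), (fun=> 0); split; [exact: plt_cst|exact: plt0|move=> *; rewrite mulr0 addr0].
  - case: (unliftP ord0 i) => [j|] ->.
      exists (fun y : 'rV_n => y ord0 j * G y), (fun y : 'rV_n => y ord0 j * H y); split; [exact: pltX|exact: pltX|].
      by move=> u y /E e; rewrite e /rcons0 rV_cons_lift; ring.
    exists (fun y => H y - nsq y * H y), G; split => //.
      apply: pltD; first by apply: plt_widen HH; lia.
      exact/pltN/plt_nsq.
    move=> u y e; rewrite E// /rcons0 rV_cons_ord0 /=.
    by rewrite (_ : nsq y = 1 - u ^+ 2); [ring|rewrite -e; ring].
  - exists (fun y => G y + G' y), (fun y => H y + H' y); split; [exact: pltD|exact: pltD|].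
    by move=> u y e; rewrite E// E'//; ring.
  - exists (fun y => c * G y), (fun y => c * H y); split; [exact: pltZ|exact: pltZ|].
    by move=> u y e; rewrite E//; ring.
move=> [F HF ->].
have {}HP k : exists GH : ('rV[R]_n -> R) * ('rV[R]_n -> R), [/\ plt k.+1 GH.1, plt k GH.2 &
    forall u y, u ^+ 2 + nsq y = 1 -> F k (rcons0 u y) = GH.1 y + u * GH.2 y].
  by have [G [H ?]] := HP _ _ (HF k); exists (G, H).
have [GH HGH] := choice HP.
exists (fun y => \sum_(k < t.+1) (GH k).1 y), (fun y => \sum_(k < t.+1) (GH k).2 y); split.
- apply: (@plt_sum n t.+1 'I_t.+1 (index_enum _) (fun (k : 'I_t.+1) => (GH k).1)) => k.
  by have [+ _ _] := HGH k; exact: plt_widen.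
- apply: (@plt_sum n t 'I_t.+1 (index_enum _) (fun (k : 'I_t.+1) => (GH k).2)) => k.
  by have [_ + _] := HGH k; apply: plt_widen; rewrite -ltnS.
- move=> u y e; rewrite mulr_sumr -big_split/=; apply: eq_bigr => k _.
  by have [_ _ ->] := HGH k.
Qed.

Lemma hom_prod n (r : seq 'I_n) (e : 'I_n -> nat) :
  hom (\sum_(i <- r) e i) (fun x : 'rV[R]_n => \prod_(i <- r) x ord0 i ^+ e i).
Proof.
elim: r => [|i r IH].
  by rewrite big_nil; apply: homS (hom_one _) => x; rewrite big_nil.
rewrite big_cons; apply: (@homS _ _ (fun x : 'rV[R]_n =>
    x ord0 i ^+ e i * \prod_(i <- r) x ord0 i ^+ e i)).
  by move=> x; rewrite big_cons.
elim: (e i) => [|k IHk].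
  by apply: homS IH => x; rewrite expr0 mul1r.
by apply: homS (homX i IHk) => x; rewrite exprS mulrA.
Qed.

Lemma sum_pow_half_le m n : \sum_(m <= k < n) (2^-1 : R) ^+ k <= 2 * 2^-1 ^+ m.
Proof.
have [mn|nm] := leqP m n; last by rewrite big_geq ?mulr_ge0 ?exprn_ge0//; lia.
suff : \sum_(m <= k < n) (2^-1 : R) ^+ k = 2 * 2^-1 ^+ m - 2 * 2^-1 ^+ n.
  by move=> ->; rewrite gerBl mulr_ge0 ?exprn_ge0.
elim: n mn => [|n IH]; first by rewrite leqn0 => /eqP ->; rewrite big_nil subrr.
rewrite leq_eqVlt => /predU1P[->|mn]; first by rewrite big_geq// subrr.
by rewrite big_nat_recr//= IH// exprS; field.
Qed.

(* Writing [f = G + u H] on the sphere, the Taylor coefficients of [G] and [H]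
   at the pole are those of univariate polynomials bounded on [-1, 1]. *)
Lemma degree_reduction n t tau (f : 'rV[R]_n.+1 -> R) (B c s : R) :
  plt t.+1 f ->
  (forall x, nsq x = 1 -> `|f x| <= B) -> 0 < s -> c ^+ 2 + s ^+ 2 = 1 ->
  exists2 F, plt tau F & forall y, nsq y = 1 ->
    `|f (rcons0 c (s *: y)) - F y| <=
      12 * B * t.+1%:R * (1 + 8 * s) ^+ t.+1 * 2^-1 ^+ tau.
Proof.
move=> pf fB s0 cs1.
have c1 : `|c| <= 1 by rewrite -(@expr_le1 _ 2)// real_normK ?num_real//; have := sqr_ge0 s; lra.
have [G [H [[g Hg GE] [h Hh HE] fE]]] := plt_split pf.
(* The part of degree k in y of f on the layer, where the first coordinate is the constant c. The
   guard is there because H has only the parts of degree below t. *)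
pose F k (y : 'rV[R]_n) : R := s ^+ k * g k y + c * (if (k < t)%N then s ^+ k * h k y else 0).
have HF k : hom k (F k).
  apply: homD; first exact/homZ.
  by apply: homZ; case: (k < t)%N; [exact/homZ|exact: hom_zero].
have FE y : nsq y = 1 -> f (rcons0 c (s *: y)) = \sum_(k < t.+1) F k y.
  move=> y1; rewrite fE; last by rewrite nsqZ y1 mulr1.
  rewrite GE HE big_split/=; congr (_ + _).
    by apply: eq_bigr => k _; rewrite (hom_scale _ _ (Hg k)).
  rewrite -mulr_sumr big_ord_recr/= ltnn addr0; congr (_ * _).
  by apply: eq_bigr => k _; rewrite ltn_ord (hom_scale _ _ (Hh k)).
(* Truncation of the expansion; for tau > t + 1 nothing is cut off and the error is zero. *)
exists (fun y => \sum_(k < minn tau t.+1) F k y).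
  by apply: (@plt_widen _ (minn tau t.+1)); [exact: geq_minl|exists F].
move=> y y1; rewrite FE//.
have e1 x u : u ^+ 2 = sin x ^+ 2 -> u ^+ 2 + nsq (cos x *: y) = 1.
  by move=> ->; rewrite nsqZ y1 mulr1 addrC cos2Dsin2.
have e2 x : (- sin x) ^+ 2 = sin x ^+ 2 :> R by rewrite sqrrN.
have b1 x : `|f (rcons0 (sin x) (cos x *: y))| <= B by apply: fB; rewrite nsq_rcons0 e1.
have b2 x : `|f (rcons0 (- sin x) (cos x *: y))| <= B by apply: fB; rewrite nsq_rcons0 e1.
have B0 : 0 <= B by apply: le_trans (b1 0).
have r0 : 0 <= 4 * s by lra.
pose K := B * t.+1%:R * (1 + 8 * s) ^+ t.+1.
have K0 : 0 <= K by rewrite !mulr_ge0// exprn_ge0//; lra.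
have K4 : 1 + 2 * (4 * s) = 1 + 8 * s by ring.
(* Averaging f over the heights [sin x] and [- sin x] cancels the H part, so G is bounded by B at
   the points [cos x *: y]. Weighting the coefficients with [4 * s] instead of s gains the factor
   4^-k. *)
have gB k : (k < t.+1)%N -> `|s ^+ k * g k y| <= 2 * K * 2^-1 ^+ k.
  move=> kt; pose P : {poly R} := \poly_(i < t.+1) g i y.
  have PB x : `|P.[cos x]| <= B.
    have PE : P.[cos x] = G (cos x *: y).
      rewrite horner_poly GE; apply: eq_bigr => i _.
      by rewrite (hom_scale _ _ (Hg i)) mulrC.
    have -> : P.[cos x] = (f (rcons0 (sin x) (cos x *: y)) + f (rcons0 (- sin x) (cos x *: y))) / 2.
      by rewrite PE !fE ?e1//; field.
    rewrite normrM [X in _ * X]gtr0_norm// ler_pdivrMr// (le_trans (ler_normD _ _))//.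
    by have := b1 x; have := b2 x; lra.
  have := coef_poly_le k (size_poly _ _) r0 PB.
  rewrite coef_poly kt K4 => b.
  rewrite normrM normrX (gtr0_norm s0) mulrC.
  have -> : `|g k y| * s ^+ k = `|g k y| * (4 * s) ^+ k * 4^-1 ^+ k.
    by rewrite -mulrA -exprMn; congr (_ * _ ^+ _); field.
  apply: ler_pM => //.
  - by rewrite mulr_ge0 ?exprn_ge0.
  - by rewrite /K !mulrA; rewrite ?mulrA in b.
  - by apply: lerXn2r; rewrite ?nnegrE ?invr_ge0//; lra.
(* The difference over two opposite heights is [2 * u * H], and u vanishes where the remaining
   coordinates have norm 1. Hence H is evaluated at half the radius, where [u >= 1 / 2]; the halving
   costs 2^k and leaves 2^-k of the gain. *)
have hB k : (k < t)%N -> `|s ^+ k * h k y| <= 4 * K * 2^-1 ^+ k.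
  move=> kt; pose P : {poly R} := \poly_(i < t) (h i y * 2^-1 ^+ i).
  have PB x : `|P.[cos x]| <= 2 * B.
    have PE : P.[cos x] = H (2^-1 *: (cos x *: y)).
      rewrite horner_poly HE; apply: eq_bigr => i _.
      by rewrite !(hom_scale _ _ (Hh i)); ring.
    pose u := Num.sqrt (1 - cos x ^+ 2 / 4).
    have cx1 : cos x ^+ 2 <= 1 by have := cos2Dsin2 x; have := sqr_ge0 (sin x); lra.
    have u2 : u ^+ 2 = 1 - cos x ^+ 2 / 4 by rewrite sqr_sqrtr//; lra.
    have u1 : 1 / 2 <= u.
      by rewrite -(@ler_pXn2r _ 2)// ?nnegrE ?sqrtr_ge0// u2 expr2; lra.
    have e3 v : v ^+ 2 = u ^+ 2 -> v ^+ 2 + nsq (2^-1 *: (cos x *: y)) = 1.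
      by move=> ->; rewrite !nsqZ y1 u2; field.
    have b3 : `|f (rcons0 u (2^-1 *: (cos x *: y)))| <= B by apply: fB; rewrite nsq_rcons0 e3.
    have b4 : `|f (rcons0 (- u) (2^-1 *: (cos x *: y)))| <= B by apply: fB; rewrite nsq_rcons0 e3 ?sqrrN.
    have : `|2 * u * P.[cos x]| <= 2 * B.
      have -> : 2 * u * P.[cos x] = f (rcons0 u (2^-1 *: (cos x *: y))) -
          f (rcons0 (- u) (2^-1 *: (cos x *: y))).
        by rewrite PE !fE ?e3 ?sqrrN//; ring.
      by rewrite (le_trans (ler_normB _ _))//; lra.
    rewrite normrM gtr0_norm; last by lra.
    apply: le_trans; rewrite -[leLHS]mul1r ler_wpM2r//; lra.
  have := coef_poly_le k (size_poly _ _) r0 PB.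
  rewrite coef_poly kt K4 => b.
  rewrite normrM normrX (gtr0_norm s0) mulrC.
  have -> : `|h k y| * s ^+ k = `|h k y * 2^-1 ^+ k| * (4 * s) ^+ k * 2^-1 ^+ k.
    rewrite normrM normrX (@gtr0_norm R 2^-1) ?invr_gt0//.
    have -> : `|h k y| * 2^-1 ^+ k * (4 * s) ^+ k * 2^-1 ^+ k =
       `|h k y| * (2^-1 ^+ k * (4 * s) ^+ k * 2^-1 ^+ k) by ring.
    by rewrite -!exprMn; congr (_ * _ ^+ _); field.
  rewrite ler_wpM2r ?exprn_ge0 ?invr_ge0//; apply: le_trans b _.
  have -> : 2 * (2 * B) * t%:R * (1 + 8 * s) ^+ t = 4 * (B * t%:R * (1 + 8 * s) ^+ t) by ring.
  rewrite ler_pM2l// /K; apply: ler_pM.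
  - by rewrite mulr_ge0.
  - by rewrite exprn_ge0//; lra.
  - by rewrite ler_wpM2l// ler_nat.
  - by apply: ler_weXn2l => //; lra.
have hk k : 0 <= (2^-1 : R) ^+ k by rewrite exprn_ge0// invr_ge0.
have FB k : (k < t.+1)%N -> `|F k y| <= 6 * K * 2^-1 ^+ k.
  move=> kt; rewrite /F (le_trans (ler_normD _ _))//.
  have -> : 6 * K * 2^-1 ^+ k = 2 * K * 2^-1 ^+ k + 4 * K * 2^-1 ^+ k by ring.
  apply: lerD; first exact: gB.
  case: ifP => [kt'|_]; last first.
    by rewrite mulr0 normr0; apply: mulr_ge0 => //; apply: mulr_ge0.
  by rewrite normrM -[leRHS]mul1r; apply: ler_pM => //; exact: hB.
have -> : 12 * B * t.+1%:R * (1 + 8 * s) ^+ t.+1 * 2^-1 ^+ tau =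
  6 * K * (2 * 2^-1 ^+ tau) by rewrite /K; ring.
have [tt|tt] := leqP tau t.+1; last first.
  by rewrite subrr normr0; apply: mulr_ge0; apply: mulr_ge0.
rewrite -!(big_mkord xpredT (F^~ y)) (@big_cat_nat _ _ _ tau 0 t.+1)//= addrAC subrr add0r.
rewrite (le_trans (ler_norm_sum _ _ _))//.
apply: (@le_trans _ _ (\sum_(tau <= k < t.+1) 6 * K * 2^-1 ^+ k)).
  by apply: ler_sum_nat => k /andP[_ kt]; exact: FB.
rewrite -mulr_sumr ler_wpM2l ?sum_pow_half_le//; lra.
Qed.

End polynomial_functions.

Section sphere_polynomials.
Import -(notations) mpoly.

(** [f] is constrained on the sphere only; its replacement F is a polynomial function, hence
    measurable and continuous everywhere. As [msize] exceeds the degree by one, degree at most t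
    becomes [plt t.+1]. *)
Lemma sphere_poly_plt (R : realType) d t (f : 'rV[R]_d.+1 -> R) : sphere_poly t f ->
  exists2 F, plt t.+1 F & forall x, sphere R d x -> f x = F x.
Proof.
move=> [p sp fE]; exists (fun x => meval (x ord0) p) => //.
(* [plt_sum] asks for a bound on every index, so the coefficient is set to zero explicitly outside
   the support, where the degree is not controlled. *)
pose c (m : multinom d.+1) : R := if m \in msupp p then mcoeff m p else 0.
rewrite (_ : (fun x => _) = (fun x : 'rV[R]_d.+1 => \sum_(m <- msupp p)
   (c m * \prod_(i <- enum 'I_d.+1) x ord0 i ^+ fun_of_multinom m i))); last first.
  apply/funext => x; rewrite mevalE; apply: eq_big_seq => m mp.
  by rewrite /c mp big_enum.
apply: (@plt_sum R d.+1 t.+1 _ (msupp p) (fun m (x : 'rV[R]_d.+1) =>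
   c m * \prod_(i <- enum 'I_d.+1) x ord0 i ^+ fun_of_multinom m i)) => m.
rewrite /c; case: ifP => mp; last first.
  by rewrite (_ : (fun x => _) = fun=> 0); [exact: plt0|apply/funext => x; rewrite mul0r].
apply: pltZ; apply: plt_hom (hom_prod _ _).
rewrite big_enum -mdegE; apply: leq_trans sp.
exact: msize_mdeg_lt.
Qed.

End sphere_polynomials.

(** * Lebesgue measure and moments of the ball *)

Section measures.
Context {R : realType}.
Local Notation vol N := (@lebesgue_rV R N).
Local Notation leb := (@lebesgue_measure R).

(** Names the canonical structure, so that the pushforward can be used as a bundled measure, for
    instance under [mscale]. *)
Definition pushforward_measure d1 d2 (T1 : measurableType d1) (T2 : measurableType d2)
    (m : {measure set T1 -> \bar R}) (f : T1 -> T2) (mf : measurable_fun setT f) :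
    {measure set T2 -> \bar R} :=
  measure_function_pushforward__canonical__measure_function_Measure m mf.

Section bounded_support.
Context d (T : measurableType d) (m : {measure set T -> \bar R}).

Definition bounded_support (f : T -> R) := exists D C,
  [/\ measurable D, (m D < +oo)%E, measurable_fun setT f,
      forall x, `|f x| <= C & forall x, ~ D x -> f x = 0].

Lemma bounded_support_integrable f : bounded_support f ->
  m.-integrable setT (EFin \o f).
Proof.
move=> [D [C [mD mDoo mf fC fD]]].
have -> : EFin \o f = (EFin \o f) \_ D.
  apply/funext => x; rewrite /patch; case: ifPn => // /negP xD.
  by rewrite /= fD// => xD'; apply: xD; rewrite inE.
apply/(integrable_mkcond _ mD).1.
apply: measurable_bounded_integrable => //; first exact: measurable_funTS.
by exists C; split; rewrite ?num_real// => x Cx y _; apply: le_trans (fC y) (ltW Cx).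
Qed.

Lemma integral_mscale (k : {nonneg R}) (f : T -> \bar R) :
  measurable_fun setT f -> m.-integrable setT f ->
  (\int[mscale k m]_x f x = k%:num%:E * \int[m]_x f x)%E.
Proof.
move=> mf intf; rewrite (integralE (mscale k m) setT f) (integralE m setT f).
rewrite !ge0_integral_mscale//; [|exact: measurable_funeneg|exact: measurable_funepos].
rewrite [RHS]muleBr// fin_num_adde_defl// fin_numN.
exact: integrable_neg_fin_num.
Qed.

Lemma integral_comp_mscale (k : {nonneg R}) (f : T -> T) (F : T -> \bar R) :
  measurable_fun setT f ->
  (forall A, measurable A -> m (f @^-1` A) = (k%:num%:E * m A)%E) ->
  measurable_fun setT F -> m.-integrable setT F -> m.-integrable setT (F \o f) ->
  (\int[m]_x F (f x) = k%:num%:E * \int[m]_x F x)%E.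
Proof.
move=> mf fm mF iF iFf; rewrite -integral_mscale//.
transitivity (\int[pushforward_measure m mf]_x F x)%E.
  by rewrite [RHS]integral_pushforward.
by apply: eq_measure_integral => A mA _; exact: fm.
Qed.

End bounded_support.

Lemma Rfubini d1 d2 (T1 : measurableType d1) (T2 : measurableType d2)
    (m1 : {sigma_finite_measure set T1 -> \bar R})
    (m2 : {sigma_finite_measure set T2 -> \bar R}) (f : T1 * T2 -> R) :
  (m1 \x m2)%E.-integrable setT (EFin \o f) ->
  (forall x, m2.-integrable setT (fun y => (f (x, y))%:E)) ->
  \int[m1]_x (\int[m2]_y f (x, y)) = \int[(m1 \x m2)%E]_z f z.
Proof.
move=> intf intf1; rewrite /Rintegral -integral12_prod_meas1//.
congr fine; apply: eq_integral => x _.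
by rewrite /fubini_F /= fineK// integrable_fin_num.
Qed.

Lemma Rfubini_swap d1 d2 (T1 : measurableType d1) (T2 : measurableType d2)
    (m1 : {sigma_finite_measure set T1 -> \bar R})
    (m2 : {sigma_finite_measure set T2 -> \bar R}) (f : T1 * T2 -> R) :
  (m1 \x m2)%E.-integrable setT (EFin \o f) ->
  (forall x, m2.-integrable setT (fun y => (f (x, y))%:E)) ->
  (forall y, m1.-integrable setT (fun x => (f (x, y))%:E)) ->
  \int[m1]_x (\int[m2]_y f (x, y)) = \int[m2]_y (\int[m1]_x f (x, y)).
Proof.
move=> intf intf1 intf2; rewrite Rfubini// /Rintegral -integral21_prod_meas1//.
congr fine; apply: eq_integral => x _.
by rewrite /fubini_G /= fineK// integrable_fin_num.
Qed.

Lemma measurable_nsq N : measurable_fun setT (@nsq R N : 'rV[R]_N -> measurableTypeR R).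
Proof.
by apply: measurable_sum => i; apply: measurable_funX; exact: (measurable_rV_coord i).
Qed.

Lemma unit_ballE N (x : 'rV[R]_N) : unit_ball R N x <-> nsq x <= 1.
Proof.
rewrite /unit_ball /= -enorm_sqr; split=> h; first by rewrite expr_le1 ?enorm_ge0.
by rewrite -(@expr_le1 _ 2) ?enorm_ge0.
Qed.

Definition scale_rV N (r : R) (x : 'rV[R]_N) : 'rV[R]_N := r *: x.

Lemma measurable_scale_rV N (r : R) : measurable_fun setT (@scale_rV N r).
Proof.
apply: measurable_fun_rV => i.
rewrite (_ : _ \o _ = fun x => r * rV_coord i x); last first.
  by apply/funext => x; rewrite /rV_coord /= mxE.
by apply: measurable_funM; [exact: measurable_cst|exact: (measurable_rV_coord i)].
Qed.

Definition scale_R (r : R) (x : measurableTypeR R) : measurableTypeR R := r * x.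

Lemma measurable_scale_R (r : R) : measurable_fun setT (scale_R r).
Proof. by apply: measurable_funM => //; exact: measurable_cst. Qed.

Definition scale_pair N (r : R) (z : measurableTypeR R * 'rV[R]_N) :
  measurableTypeR R * 'rV[R]_N := (scale_R r z.1, scale_rV r z.2).

Lemma measurable_scale_pair N (r : R) : measurable_fun setT (@scale_pair N r).
Proof.
apply: measurable_fun_pair => /=.
  by apply: measurableT_comp (measurable_scale_R r) _; exact: measurable_fst.
by apply: measurableT_comp (measurable_scale_rV r) _; exact: measurable_snd.
Qed.

Lemma rcons0Z N (r u : R) (y : 'rV[R]_N) : r *: rcons0 u y = rcons0 (r * u) (r *: y).
Proof.
apply/rowP => i; rewrite mxE; case: (unliftP ord0 i) => [j|] ->.
  by rewrite /rcons0 !rV_cons_lift mxE.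
by rewrite /rcons0 !rV_cons_ord0.
Qed.

Lemma lebesgue_scale (r : R) (A : set (measurableTypeR R)) : 0 < r -> measurable A ->
  leb (scale_R r @^-1` A) = (r^-1%:E * leb A)%E.
Proof.
move=> r0 mA; have rn : 0 <= r by exact: ltW.
pose p : {measure set (measurableTypeR R) -> \bar R} :=
  pushforward_measure leb (measurable_scale_R r).
pose m : {measure set (measurableTypeR R) -> \bar R} := mscale (NngNum rn) p.
have -> : leb A = m A.
  apply: lebesgue_measure_unique => // _ [[a b] /= _ <-].
  rewrite (_ : m _ = (r%:E * leb (scale_R r @^-1` `]a, b]%classic))%E)//.
  have -> : scale_R r @^-1` `]a, b]%classic = `]a / r, b / r]%classic.
    apply/seteqP; split => x /=; rewrite !in_itv/= ltr_pdivrMr// ler_pdivlMr//;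
      by rewrite mulrC.
  rewrite !lebesgue_measure_itv/= !lte_fin ltr_pM2r ?invr_gt0//.
  case: ifP => _; last by rewrite mule0.
  by rewrite -!EFinB -EFinM; congr EFin; field; lra.
rewrite (_ : m _ = (r%:E * leb (scale_R r @^-1` A))%E)// muleA -EFinM mulVf ?mul1e//; lra.
Qed.

(** Induction on the dimension: the pushforward under scaling, renormalized, agrees with the product
    measure on rectangles, hence everywhere by uniqueness of product measures. *)
Lemma vol_scale N (r : R) (A : set 'rV[R]_N) : 0 < r -> measurable A ->
  vol N (@scale_rV N r @^-1` A) = ((r^-1 ^+ N)%:E * vol N A)%E.
Proof.
move=> r0; elim: N A => [|N IH] A mA.
  rewrite expr0 mul1e; congr (vol 0 _); apply/funext => x.
  by rewrite /preimage /= (_ : scale_rV r x = x)//; apply/rowP => -[].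
have rN : 0 <= r ^+ N.+1 by rewrite exprn_ge0// ltW.
pose p : {measure set (measurableTypeR R * 'rV[R]_N) -> \bar R} :=
  pushforward_measure (leb \x vol N)%E (@measurable_scale_pair N r).
pose m' : {measure set (measurableTypeR R * 'rV[R]_N) -> \bar R} := mscale (NngNum rN) p.
have mcA : measurable (@rV_cons R N @^-1` A).
  by rewrite -[X in measurable X]setTI; exact: measurable_rV_cons.
have E X : measurable X -> (leb \x vol N)%E X = m' X.
  apply: (@product_measure_unique _ _ _ _ R leb (vol N)).
  move=> B C mB mC.
  rewrite (_ : m' _ = ((r ^+ N.+1)%:E * (leb \x vol N) (@scale_pair N r @^-1` (B `*` C)))%E)//.
  have -> : @scale_pair N r @^-1` (B `*` C) = (scale_R r @^-1` B) `*` (@scale_rV N r @^-1` C) by [].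
  rewrite product_measure1E//; last 2 first.
  - by rewrite -[X in measurable X]setTI; exact: measurable_scale_R.
  - by rewrite -[X in measurable X]setTI; exact: measurable_scale_rV.
  transitivity ((r ^+ N.+1)%:E * ((r^-1%:E * leb B) * ((r^-1 ^+ N)%:E * vol N C)))%E.
    by congr (_ * (_ * _))%E; [exact: lebesgue_scale|exact: IH].
  rewrite muleACA !muleA -!EFinM (_ : _ * _ = 1) ?mul1e//.
  by rewrite exprS exprVn; field; rewrite expf_neq0//; lra.
have -> : vol N.+1 A = m' (@rV_cons R N @^-1` A) by rewrite -E.
rewrite (_ : m' _ = ((r ^+ N.+1)%:E * (leb \x vol N) (@scale_pair N r @^-1` (@rV_cons R N @^-1` A)))%E)// muleA -EFinM exprVn mulVf ?mul1e; last by rewrite expf_neq0//; lra.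
congr ((leb \x vol N)%E _); apply/funext => -[u y].
by rewrite /preimage /= /scale_rV -/(rcons0 u y) rcons0Z.
Qed.

Lemma Rintegral_scale N (r : R) (F : 'rV[R]_N -> R) : 0 < r ->
  measurable_fun setT (F : _ -> measurableTypeR R) ->
  (vol N).-integrable setT (EFin \o F) ->
  (vol N).-integrable setT (fun x => (F (r *: x))%:E) ->
  \int[vol N]_x F (r *: x) = r^-1 ^+ N * \int[vol N]_x F x.
Proof.
move=> r0 mF iF iFr.
have rN : 0 <= r^-1 ^+ N by rewrite exprn_ge0// invr_ge0 ltW.
have mE : measurable_fun setT (EFin \o F) by exact/measurable_EFinP.
rewrite /Rintegral; have := @integral_comp_mscale _ _ (vol N) (NngNum rN) (@scale_rV N r)
  (EFin \o F) (@measurable_scale_rV N r) (fun A mA => vol_scale r0 mA) mE iF iFr.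
by move=> /= ->; rewrite fineM//; exact: integrable_fin_num.
Qed.

End measures.

(** * Wallis integrals *)

Section trig_moments.
Context {R : realType}.
Local Notation intg a b F := (\int[@lebesgue_measure R]_(x in `[a, b]) F x).

Definition wallis (a m : nat) : R := intg 0 pi (fun x => cos x ^+ a * sin x ^+ m).

Lemma continuous_cos_sin a m : continuous (fun x : R => cos x ^+ a * sin x ^+ m).
Proof.
move=> x; apply: cvgM.
  by apply: (@continuous_comp _ _ _ cos (fun y => y ^+ a)); [exact: continuous_cos|exact: exprn_continuous].
by apply: (@continuous_comp _ _ _ sin (fun y => y ^+ m)); [exact: continuous_sin|exact: exprn_continuous].
Qed.

Lemma is_derive_cosX a (x : R) : is_derive x 1 (fun x => cos x ^+ a.+1)
  (- (a.+1%:R * cos x ^+ a * sin x)).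
Proof.
have h := @is_deriveX _ _ cos a.+1 (x : R) 1 _ (is_derive_cos x).
rewrite exprfctE in h.
by apply: (is_derive_eq h); rewrite /GRing.scale/=; ring.
Qed.

Lemma is_derive_sinX a (x : R) : is_derive x 1 (fun x => sin x ^+ a.+1)
  (a.+1%:R * sin x ^+ a * cos x).
Proof.
have h := @is_deriveX _ _ sin a.+1 (x : R) 1 _ (is_derive_sin x).
rewrite exprfctE in h.
by apply: (is_derive_eq h); rewrite /GRing.scale/=; ring.
Qed.

(** The difference of the two sides is the integral of the derivative of
    [- cos ^+ a.+1 * sin ^+ m.+1], which vanishes at 0 and at pi. *)
Lemma wallisSS a m : (m + a).+2%:R * wallis a m.+2 = m.+1%:R * wallis a m.
Proof.
have cW := continuous_cos_sin.
rewrite /wallis -!intgZ//; apply/eqP; rewrite -subr_eq0 -intgB; last 2 first.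
- by move=> x; apply: cvgM; [exact: cvg_cst|exact: cW].
- by move=> x; apply: cvgM; [exact: cvg_cst|exact: cW].
apply/eqP.
rewrite [RHS](_ : _ = (- (cos pi ^+ a.+1 * sin pi ^+ m.+1)) - (- (cos 0 ^+ a.+1 * sin 0 ^+ m.+1))); last first.
  by rewrite sinpi sin0 !expr0n/= !mulr0 subrr.
apply: (@intg_FTC R (fun x => - (cos x ^+ a.+1 * sin x ^+ m.+1))).
- exact: pi_ge0.
- by move=> x; apply: cvgB; apply: cvgM; [exact: cvg_cst|exact: cW|exact: cvg_cst|exact: cW].
move=> x _.
have h := is_deriveN (is_deriveM (is_derive_cosX a x) (is_derive_sinX m x)).
apply: (is_derive_eq h); rewrite /GRing.scale/=.
have s2 : sin x ^+ m.+2 = sin x ^+ m * (1 - cos x ^+ 2).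
  by rewrite -sin2cos2 -exprD addn2.
rewrite s2 (_ : sin x ^+ m.+1 * - (a.+1%:R * cos x ^+ a * sin x) =
  - (a.+1%:R * cos x ^+ a * sin x ^+ m.+2)); last by rewrite !exprS; ring.
have -> : (m + a).+2%:R = m.+1%:R + a.+1%:R :> R by rewrite -natrD addnS addSn.
rewrite s2 exprS.
by ring.
Qed.

Lemma intg_pi_sub (F : R -> R) : continuous F -> intg 0 pi (fun x => F (pi - x)) = intg 0 pi F.
Proof.
move=> cF; have pi0 := pi_ge0 R.
have [G dG] := antiderivative_ex (-1) (pi + 1) cF.
have -> : intg 0 pi F = G pi - G 0.
  by apply: intg_FTC => // x ?; apply: dG; lra.
have -> : G pi - G 0 = - G (pi - pi) - - G (pi - 0) by rewrite subrr subr0; ring.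
apply: (@intg_FTC R (fun x => - G (pi - x))) => //.
  by move=> x; apply: continuous_comp; [apply: cvgB; [exact: cvg_cst|exact: cvg_id]|exact: cF].
move=> x xpi.
have dGx : is_derive (pi - x) 1 G (F (pi - x)) by apply: dG; lra.
have dl : is_derive x 1 (fun x : R => pi - x) (- 1).
  have h := is_deriveB (is_derive_cst pi x 1) (is_derive_id x 1).
  by apply: (is_derive_eq h); rewrite sub0r.
have := is_deriveN (@is_derive1_comp _ G (fun x => pi - x) x _ _ dGx dl).
by rewrite mulrN1 opprK.
Qed.

Lemma wallis_odd a m : odd a -> wallis a m = 0.
Proof.
move=> oa; have cW := @continuous_cos_sin a m.
have : wallis a m = - wallis a m.
  rewrite /wallis -[in LHS]intg_pi_sub// -[RHS]mulN1r -intgZ//.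
  apply: eq_Rintegral => x _.
  have -> : cos (pi - x) = - cos x by rewrite cosB cospi sinpi; ring.
  have -> : sin (pi - x) = sin x by rewrite sinB cospi sinpi; ring.
  by rewrite exprNn -signr_odd oa expr1 -mulrA.
by move=> h; lra.
Qed.

Lemma wallis0_gt0 m : 0 < wallis 0 m.
Proof.
elim/cheb_ind: m => [||m IH _].
- rewrite /wallis; under eq_Rintegral do rewrite !expr0 mulr1.
  by rewrite intg_cst ?pi_ge0// mul1r subr0 pi_gt0.
- rewrite /wallis; under eq_Rintegral do rewrite expr0 mul1r expr1.
  have -> : intg 0 pi sin = - cos pi - - cos 0.
    apply: (@intg_FTC R (fun x => - cos x)); [exact: pi_ge0|exact: continuous_sin|].
    by move=> x _; have := is_deriveN (is_derive_cos x); rewrite opprK.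
  by rewrite cospi cos0; lra.
- have := wallisSS 0 m => e.
  have : 0 < m.+1%:R * wallis 0 m by rewrite mulr_gt0.
  by rewrite -e pmulr_rgt0.
Qed.

Lemma continuous_pow_sqrt a m :
  continuous (fun u : R => u ^+ a * Num.sqrt (1 - u ^+ 2) ^+ m).
Proof.
have c1 : continuous (fun u : R => 1 - u ^+ 2).
  by move=> u; apply: cvgB; [exact: cvg_cst|exact: exprn_continuous].
have c2 : continuous (fun u : R => Num.sqrt (1 - u ^+ 2)).
  by move=> u; apply: continuous_comp; [exact: c1|exact: sqrt_continuous].
move=> u; apply: cvgM; first exact: exprn_continuous.
by apply: (@continuous_comp _ _ _ (fun u : R => Num.sqrt (1 - u ^+ 2)) (fun y => y ^+ m)); [exact: c2|exact: exprn_continuous].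
Qed.

(* The substitution [u = cos x]. *)
Lemma wallis_sqrt a m :
  intg (-1) 1 (fun u => u ^+ a * Num.sqrt (1 - u ^+ 2) ^+ m) = wallis a m.+1.
Proof.
have pi0 := pi_ge0 R.
pose W (u : R) := u ^+ a * Num.sqrt (1 - u ^+ 2) ^+ m.
have cW : continuous W.
  exact: continuous_pow_sqrt.
have [G dG] := antiderivative_ex (-2) 2 cW.
have -> : intg (-1) 1 W = G 1 - G (-1).
  by apply: intg_FTC => [|//|x ?]; [lra|apply: dG; lra].
have -> : G 1 - G (-1) = - G (cos pi) - - G (cos 0) by rewrite cospi cos0; ring.
apply/esym; apply: (@intg_FTC R (fun x => - G (cos x))) => //; first exact: continuous_cos_sin.
move=> x /andP[x0 xpi].
have dGx : is_derive (cos x) 1 G (W (cos x)).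
  by apply: dG; have := cos_le1 x; have := cos_geN1 x; lra.
have := is_deriveN (is_derive1_comp dGx (is_derive_cos x)).
rewrite mulrN opprK /W -sin2cos2 sqrtr_sqr ger0_norm; last by rewrite sin_ge0_pi// x0.
by rewrite exprSr mulrA.
Qed.

End trig_moments.

(** * Moments of the ball by slicing *)

Section ball_moments.
Context {R : realType}.
Local Notation vol N := (@lebesgue_rV R N).
Local Notation leb := (@lebesgue_measure R).
Local Notation intg a b F := (\int[leb]_(x in `[a, b]) F x).

Lemma measurable_natb d (T : measurableType d) (P : T -> bool) :
  measurable_fun setT P -> measurable_fun setT (fun x => (P x)%:R : measurableTypeR R).
Proof.
move=> mP; rewrite (_ : (fun x => _) = fun x => if P x then 1 else 0).
  by apply: measurable_fun_ifT => //; exact: measurable_cst.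
by apply/funext => x; case: (P x).
Qed.

Lemma measurable_nsq_le N (c : R) :
  measurable_fun setT (fun x : 'rV[R]_N => ((nsq x <= c)%R%:R) : measurableTypeR R).
Proof.
apply: measurable_natb; apply: measurable_fun_ler; last exact: measurable_cst.
exact: measurable_nsq.
Qed.

Definition unit_support N (F : 'rV[R]_N -> R) := exists C,
  [/\ measurable_fun setT (F : _ -> measurableTypeR R), forall x, `|F x| <= C &
      forall x, 1 < nsq x -> F x = 0].

Lemma unit_support_bounded N (F : 'rV[R]_N -> R) : unit_support F -> bounded_support (vol N) F.
Proof.
move=> [C [mF FC F0]]; exists (unit_ball R N), C; split => //.
- exact: measurable_unit_ball.
- exact: lebesgue_unit_ball_lty.
- by move=> x /unit_ballE/negP; rewrite -ltNge => /F0.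
Qed.

Lemma unit_support_integrable N (F : 'rV[R]_N -> R) : unit_support F ->
  (vol N).-integrable setT (EFin \o F).
Proof. by move=> /unit_support_bounded/bounded_support_integrable. Qed.

Lemma measurable_rcons0 N (u : R) : measurable_fun setT (@rcons0 R N u).
Proof.
apply: measurableT_comp; first exact: measurable_rV_cons.
by apply: measurable_fun_pair; [exact: measurable_cst|exact: measurable_id].
Qed.

Lemma unit_support_rcons0 N (F : 'rV[R]_N.+1 -> R) u : unit_support F ->
  unit_support (fun y => F (rcons0 u y)).
Proof.
move=> [C [mF FC F0]]; exists C; split => //.
  by apply: (measurableT_comp mF); exact: measurable_rcons0.
move=> y y1; apply: F0; rewrite nsq_rcons0; apply: lt_le_trans y1 _.
by rewrite lerDr sqr_ge0.
Qed.

Lemma itv_lty (a b : R) : (leb `[a, b]%classic < +oo)%E.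
Proof. by rewrite (@lebesgue_measure_itv R `[a, b])/=; case: ifP; rewrite ltry. Qed.

Lemma itv_ball_lty N (a b : R) : ((leb \x vol N)%E (`[a, b] `*` unit_ball R N) < +oo)%E.
Proof.
have mI : measurable (`[a, b] : set (measurableTypeR R)) by exact: measurable_itv.
rewrite product_measure1E//; last exact: measurable_unit_ball.
rewrite lte_mul_pinfty//; [|exact: lebesgue_unit_ball_lty].
by rewrite ge0_fin_numE//; exact: itv_lty.
Qed.

Lemma Rintegral_rcons0 N (F : 'rV[R]_N.+1 -> R) : unit_support F ->
  \int[vol N.+1]_x F x = \int[leb]_u (\int[vol N]_y F (rcons0 u y)).
Proof.
move=> uF; have [C [mF FC F0]] := uF.
have bF : bounded_support (leb \x vol N)%E (F \o @rV_cons R N).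
  exists (`[(-1 : R), 1]%classic `*` unit_ball R N), C; split => //.
  - by apply: measurableX; [exact: measurable_itv|exact: measurable_unit_ball].
  - exact: itv_ball_lty.
  - by apply: (measurableT_comp mF); exact: measurable_rV_cons.
  - by move=> z; exact: FC.
  - move=> [u y] nD; apply: F0; rewrite -/(rcons0 u y) nsq_rcons0 ltNge; apply/negP => h.
    apply: nD; split => /=; last by apply/unit_ballE; have := sqr_ge0 u; lra.
    rewrite in_itv/= -ler_norml -(@expr_le1 _ 2)// real_normK ?num_real//.
    by have := nsq_ge0 y; lra.
transitivity (\int[(leb \x vol N)%E]_z F (rV_cons z)).
  congr fine; have := @integral_pushforward _ _ _ _ R _ (@measurable_rV_cons R N)
    (leb \x vol N)%E setT (EFin \o F).
  move=> <-//; first exact/measurable_EFinP.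
  exact: (bounded_support_integrable bF).
rewrite -Rfubini//; first exact: (bounded_support_integrable bF).
by move=> u; apply: unit_support_integrable; exact: unit_support_rcons0.
Qed.

Definition moment N (f : 'rV[R]_N -> R) : R := \int[vol N]_x (f x * ((nsq x <= 1)%R%:R)).

Lemma unit_support_moment N k (f : 'rV[R]_N -> R) (c : R) : hom k f -> c <= 1 ->
  unit_support (fun x => f x * ((nsq x <= c)%R%:R)).
Proof.
move=> hf c1; have [C C0 fC] := hom_bounded hf.
exists C; split.
- by apply: measurable_funM; [exact: hom_measurable hf|exact: measurable_nsq_le].
- move=> x; case: (leP (nsq x)) => [xc|_]; last by rewrite mulr0 normr0.
  by rewrite mulr1 fC// (le_trans xc).
- by move=> x x1; rewrite leNgt (le_lt_trans c1 x1) mulr0.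
Qed.

Lemma vol0_cst (f : 'rV[R]_0 -> R) (g : 'rV[R]_0 -> R) : f 0 = g 0 -> f = g.
Proof. by move=> e; apply/funext => x; rewrite (_ : x = 0)//; apply/rowP => -[]. Qed.

Lemma moment_scale N k (f : 'rV[R]_N -> R) (r : R) : hom k f -> 0 <= r -> r <= 1 ->
  \int[vol N]_x (f x * ((nsq x <= r ^+ 2)%R%:R)) = r ^+ (N + k) * moment f.
Proof.
move=> hf; rewrite le_eqVlt => /predU1P[<- _|r0 r1].
  (* For r = 0 the ball is a single point. In positive degree f vanishes there; in degree 0 the
     point is a null set in positive dimension, while in dimension 0 it is the whole space and the
     exponent is 0. *)
  have f00 : (0 < k)%N -> f 0 = 0.
    by move=> k0; rewrite -(scale0r 0) (hom_scale _ _ hf) expr0n; case: k k0 {hf} => //= k _; rewrite mul0r.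
  rewrite (expr0n _ 2)/=; have [k0|k0] := posnP k; last first.
    rewrite expr0n addn_eq0 (gtn_eqF k0) andbF mul0r.
    rewrite (_ : (fun x => _) = fun=> 0) ?Rintegral_cst ?mul0r//.
    by apply/funext => x; rewrite nsq_le0; case: eqP => [->|_]; rewrite ?mulr0// f00// mul0r.
  case: N f hf f00 => [|N] f hf f00.
    rewrite k0 addn0 expr0 mul1r /moment; congr Rintegral.
    by apply: vol0_cst; rewrite nsq0 lexx ler01.
  rewrite expr0n addSn/= mul0r.
  have us := @unit_support_moment N.+1 k f 0 hf ler01.
  rewrite (_ : (fun x => _) = (fun x => f x * ((nsq x <= 0)%R%:R)) \_ (@cube R N.+1 0)); last first.
    apply/funext => x; rewrite patchE; case: ifPn => // xc.
    rewrite nsq_le0; case: eqP => [e|_]; last by rewrite mulr0.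
    by case/negP: xc; rewrite e; apply/mem_set => i; rewrite mxE normr0.
  rewrite -Rintegral_mkcond /Rintegral null_set_integral//.
  - exact: measurable_cube.
  - by apply: measurable_funTS; apply/measurable_EFinP; have [C []] := us.
  - by apply: (etrans (@lebesgue_rV_cube R N.+1 0 (lexx _))); rewrite mulr0 expr0n.
pose F x := f x * ((nsq x <= 1)%R%:R).
have uF : unit_support F by apply: unit_support_moment hf (lexx 1).
have [C [mF FC F0]] := uF.
have r'0 : 0 < r^-1 by rewrite invr_gt0.
have E x : f x * ((nsq x <= r ^+ 2)%R%:R) = r ^+ k * F (r^-1 *: x).
  rewrite /F (hom_scale _ _ hf) nsqZ !mulrA -exprMn mulfV ?gt_eqF// expr1n mul1r.
  by rewrite exprVn [_^-1 * _]mulrC ler_pdivrMr ?exprn_gt0// mul1r.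
have iFr : (vol N).-integrable setT (fun x => (F (r^-1 *: x))%:E).
  apply: (@unit_support_integrable N (fun x => F (r^-1 *: x))); exists C; split => //.
    by apply: (measurableT_comp mF); exact: (@measurable_scale_rV R N r^-1).
  move=> x x1; apply: F0; rewrite nsqZ; apply: lt_le_trans x1 _.
  rewrite ler_peMl ?nsq_ge0// exprVn invf_ge1 ?exprn_gt0//.
  by rewrite exprn_ile1// ltW.
under eq_Rintegral do rewrite E.
rewrite RintegralZl// Rintegral_scale//; last exact: unit_support_integrable.
by rewrite invrK exprD /moment; ring.
Qed.

Lemma Rintegral_sum d (T : measurableType d) (m : {measure set T -> \bar R})
    (I : Type) (r : seq I) (F : I -> T -> R) :
  (forall i, m.-integrable setT (EFin \o F i)) ->
  \int[m]_x (\sum_(i <- r) F i x) = \sum_(i <- r) \int[m]_x F i x.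
Proof.
move=> iF; elim: r => [|i r IH].
  by rewrite big_nil; under eq_Rintegral do rewrite big_nil; rewrite Rintegral_cst ?mul0r.
rewrite big_cons -IH -RintegralD//; first by apply: eq_Rintegral => x _; rewrite big_cons.
rewrite (_ : _ \o _ = (fun x => \sum_(i <- r) (F i x)%:E)%E).
  by apply: integrable_sum => // j _; exact: iF.
by apply/funext => x; rewrite /= sumEFin.
Qed.

(** Slicing at height u leaves a ball of radius [Num.sqrt (1 - u ^+ 2)], where homogeneity of [g a]
    extracts the power N + (k - a) of the radius. The substitution u = cos x adds one more sine. *)
Lemma moment_rcons0 N k (f : 'rV[R]_N.+1 -> R) (g : nat -> 'rV[R]_N -> R) : hom k f ->
  (forall a, (a <= k)%N -> hom (k - a) (g a)) ->
  (forall u y, f (rcons0 u y) = \sum_(a < k.+1) u ^+ a * g a y) ->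
  moment f = \sum_(a < k.+1) wallis a (N + (k - a)).+1 * moment (g a).
Proof.
move=> hf hg fE; rewrite /moment Rintegral_rcons0; last exact: unit_support_moment hf (lexx 1).
pose S u := \sum_(a < k.+1) u ^+ a * Num.sqrt (1 - u ^+ 2) ^+ (N + (k - a)) * moment (g a).
have inner u : \int[vol N]_y (f (rcons0 u y) * ((nsq (rcons0 u y) <= 1)%R%:R)) =
    (S \_ `[-1, 1]) u.
  rewrite patchE mem_setE in_itv/= -ler_norml; case: leP => [|u1]; last first.
    rewrite (_ : (fun y : 'rV_N => _) = fun=> 0) ?Rintegral_cst ?mul0r//.
    apply/funext => y; rewrite nsq_rcons0 leNgt (_ : 1 < _) ?mulr0//.
    apply: (@lt_le_trans _ _ (u ^+ 2)); last by rewrite lerDl nsq_ge0.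
    by rewrite -(real_normK (num_real u)) expr_gt1.
  move=> u1; have u2 : u ^+ 2 <= 1 by rewrite -(real_normK (num_real u)) expr_le1.
  pose r := Num.sqrt (1 - u ^+ 2).
  have r2 : r ^+ 2 = 1 - u ^+ 2 by rewrite sqr_sqrtr//; lra.
  have r1 : r <= 1 by rewrite -(@expr_le1 _ 2) ?sqrtr_ge0// r2 gerBl sqr_ge0.
  have E y : f (rcons0 u y) * ((nsq (rcons0 u y) <= 1)%R%:R) =
     \sum_(a < k.+1) u ^+ a * (g a y * ((nsq y <= r ^+ 2)%R%:R)).
    rewrite fE nsq_rcons0 mulr_suml; apply: eq_bigr => a _.
    by rewrite r2 lerBrDl mulrA.
  under eq_Rintegral do rewrite E.
  have us (a : 'I_k.+1) : unit_support (fun y => g a y * ((nsq y <= r ^+ 2)%R%:R)).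
    apply: unit_support_moment (hg a _) _; first by rewrite -ltnS.
    by rewrite r2 gerBl sqr_ge0.
  rewrite (@Rintegral_sum _ _ _ _ _ (fun (a : 'I_k.+1) y => u ^+ a * (g a y * ((nsq y <= r ^+ 2)%R%:R)))); last first.
    by move=> a; apply: (integrableZl measurableT (u ^+ a) (unit_support_integrable (us a))).
  apply: eq_bigr => a _; rewrite RintegralZl//; last exact: unit_support_integrable.
  have ak : (a <= k)%N by rewrite -ltnS.
  by rewrite (moment_scale (hg a ak) (sqrtr_ge0 _) r1) mulrA.
under eq_Rintegral do rewrite inner.
rewrite -Rintegral_mkcond /S.
have cS (a m : nat) (c : R) : continuous (fun u : R => u ^+ a * Num.sqrt (1 - u ^+ 2) ^+ m * c).
  by move=> u; apply: cvgM; [exact: continuous_pow_sqrt|exact: cvg_cst].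
rewrite intg_sum//; apply: eq_bigr => a _.
rewrite -wallis_sqrt mulrC -intgZ.
  by apply: eq_Rintegral => u _; rewrite mulrC.
exact: continuous_pow_sqrt.
Qed.

(** Induction on the dimension: in each term of the slicing formula either a is odd and the Wallis
    integral vanishes, or k - a is odd. *)
Lemma moment_odd N k (f : 'rV[R]_N -> R) : hom k f -> odd k -> moment f = 0.
Proof.
elim: N k f => [|N IH] k f hf ok.
  rewrite /moment (_ : (fun x => _) = fun=> 0) ?Rintegral_cst ?mul0r//.
  apply: vol0_cst; suff -> : f 0 = 0 by rewrite mul0r.
  by rewrite -(scale0r 0) (hom_scale _ _ hf) expr0n; case: k ok {hf} => //= k _; rewrite mul0r.
have [g hg fE] := hom_rcons0 hf.
rewrite (moment_rcons0 hf hg fE) big1// => a _.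
have ak : (a <= k)%N by rewrite -ltnS.
have [oa|ea] := boolP (odd a); first by rewrite wallis_odd ?mul0r.
by rewrite (IH _ _ (hg _ ak)) ?mulr0// oddB// ok (negbTE ea).
Qed.

End ball_moments.

(** * The spherical integral and the latitude formula *)

Section sphere_integral.
Context {R : realType}.
Local Notation vol N := (@lebesgue_rV R N).
Local Notation leb := (@lebesgue_measure R).
Local Notation intg a b F := (\int[leb]_(x in `[a, b]) F x).

Lemma sphereE n (x : 'rV[R]_n.+1) : sphere R n x <-> nsq x = 1.
Proof. exact: enorm1E. Qed.

Section linearity.
Variable n : nat.
Implicit Types f g : 'rV[R]_n.+1 -> R.

Definition sphere_nice f := measurable_fun setT (f : _ -> measurableTypeR R) /\
  exists C, forall x, nsq x = 1 -> `|f x| <= C.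

Lemma sphere_nice_integrable f : sphere_nice f ->
  (sphere_measure R n).-integrable (sphere R n) (EFin \o f).
Proof.
move=> [mf [C fC]]; apply: measurable_bounded_integrable.
- exact: measurable_sphere.
- apply: (le_lt_trans (@probability_le1 _ _ _ (sphere_measure R n) _ (@measurable_sphere R n))).
  exact: ltry.
- exact: measurable_funTS.
- exists C; split; rewrite ?num_real// => x Cx y /sphereE y1.
  exact: le_trans (fC y y1) (ltW Cx).
Qed.

Lemma plt_nice t f : plt t f -> sphere_nice f.
Proof.
move=> pf; split; first exact: plt_measurable pf.
by have [C C0 fC] := plt_bounded pf; exists C => x x1; rewrite fC// x1.
Qed.

Lemma eq_sphere_int f g : (forall x, nsq x = 1 -> f x = g x) -> sphere_int f = sphere_int g.
Proof. by move=> fg; apply: eq_Rintegral => x; rewrite inE => /sphereE/fg. Qed.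

Lemma sphere_int_cst c : @sphere_int R n (fun=> c) = c.
Proof.
transitivity (c * fine (sphere_measure R n (sphere R n))).
  by apply: Rintegral_cst; exact: measurable_sphere.
by rewrite sphere_measure_sphere mulr1.
Qed.

Lemma sphere_intD f g : sphere_nice f -> sphere_nice g ->
  sphere_int (fun x => f x + g x) = sphere_int f + sphere_int g.
Proof.
move=> nf ng; apply: RintegralD; first exact: measurable_sphere;
  exact: sphere_nice_integrable.
Qed.

Lemma sphere_intZ c f : sphere_nice f ->
  sphere_int (fun x => c * f x) = c * sphere_int f.
Proof.
move=> nf; apply: RintegralZl; first exact: measurable_sphere.
exact: sphere_nice_integrable.
Qed.

Lemma sphere_int_le f B : sphere_nice f -> (forall x, nsq x = 1 -> `|f x| <= B) ->
  `|sphere_int f| <= B.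
Proof.
move=> nf fB; apply: le_trans (le_normr_Rintegral _ _) _.
- exact: measurable_sphere.
- exact: sphere_nice_integrable.
rewrite -[leRHS]sphere_int_cst; apply: le_Rintegral.
- exact: measurable_sphere.
- by have /integrable_norm := sphere_nice_integrable nf.
- by apply: (@sphere_nice_integrable (fun=> B)); split; [exact: measurable_cst|exists `|B|].
- by move=> x /sphereE/fB.
Qed.

Lemma sphere_int_sum t (F : nat -> 'rV[R]_n.+1 -> R) m :
  (forall i, (i < m)%N -> plt t (F i)) ->
  sphere_int (fun x => \sum_(i < m) F i x) = \sum_(i < m) sphere_int (F i).
Proof.
elim: m => [|m IH] hF.
  by rewrite big_ord0 -[RHS]sphere_int_cst; apply: eq_sphere_int => x _; rewrite big_ord0.
rewrite big_ord_recr/= -IH; last by move=> i im; apply: hF; exact: ltnW.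
rewrite -sphere_intD.
- by apply: eq_sphere_int => x _; rewrite big_ord_recr.
- by apply/plt_nice; apply: plt_sum => i; apply: hF; apply: ltnW; exact: ltn_ord.
- exact/plt_nice/hF.
Qed.

End linearity.

Section radial.
Variables (n k : nat).
Local Notation N := n.+1.
Variable f : 'rV[R]_N -> R.
Hypothesis hf : hom k f.

(* Unlike [radial], this pulls a subset of the sphere back into the unit ball. *)
Definition radial_cut (x : 'rV[R]_N) : 'rV[R]_N := (nsq x <= 1)%R%:R *: radial x.

Lemma measurable_radial_cut : measurable_fun setT radial_cut.
Proof.
apply: measurable_fun_rV => i.
rewrite (_ : _ \o _ = fun x => (nsq x <= 1)%R%:R * rV_coord i (radial x)); last first.
  by apply/funext => x; rewrite /rV_coord /= /radial_cut mxE.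
apply: measurable_funM; first exact: measurable_nsq_le.
by apply: measurableT_comp; [exact: measurable_rV_coord|exact: measurable_radial].
Qed.

(* [f \o radial], cut off outside the ball; it is 0 at the origin, where
   [radial] has the junk value 0. *)
Definition cone (x : 'rV[R]_N) : R :=
  f (radial x) * ((0 < nsq x)%R%:R * ((nsq x <= 1)%R%:R)).

Lemma nsq_radial (x : 'rV[R]_N) : 0 < nsq x -> nsq (radial x) = 1.
Proof.
move=> x0; rewrite /radial nsqZ exprVn enorm_sqr mulVf//.
by rewrite gt_eqF.
Qed.

Lemma unit_support_cone : unit_support cone.
Proof.
have [C C0 fC] := hom_bounded hf; exists C; split.
- apply: measurable_funM.
    by apply: (measurableT_comp (hom_measurable hf)); exact: measurable_radial.
  apply: measurable_funM; last exact: measurable_nsq_le.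
  apply: measurable_natb; apply: measurable_fun_ltr; first exact: measurable_cst.
  exact: measurable_nsq.
- move=> x; rewrite /cone; have [x0|_] := ltP 0 (nsq x); last by rewrite mul0r mulr0 normr0.
  rewrite mul1r normrM (le_trans _ (fC (radial x) _)) ?nsq_radial//.
  by rewrite ler_piMr//; case: (nsq x <= 1)%R; rewrite ?normr1 ?normr0.
- by move=> x x1; rewrite /cone (leNgt (nsq x)) x1 !mulr0.
Qed.

(** On subsets of the sphere, [sphere_measure] is the normalized pushforward of the volume under
    [radial_cut], because their preimages are exactly the cones inside the ball. *)
Lemma sphere_int_cone : sphere_int f * fine (vol N (unit_ball R N)) = \int[vol N]_x cone x.
Proof.
set v := fine _.
have v0 : 0 < v.
  by apply: fine_gt0; rewrite lebesgue_unit_ball_gt0 lebesgue_unit_ball_lty.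
pose mu := pushforward_measure (vol N) measurable_radial_cut.
have [C C0 fC] := hom_bounded hf.
have mS := @measurable_sphere R n.
have preS A : A `<=` sphere R n -> radial_cut @^-1` A = @radial R N @^-1` A `&` unit_ball R N.
  move=> AS; apply/seteqP; split => x; rewrite /preimage/= /radial_cut.
    case: leP => x1; first by rewrite scale1r => ?; split => //; apply/unit_ballE.
    rewrite scale0r => /AS/sphereE; rewrite /nsq big1 ?(eqxx, @oner_eq0 R)//.
      by move=> /esym/eqP; rewrite oner_eq0.
    by move=> i _; rewrite mxE expr0n.
  by move=> [Ax /unit_ballE ->]; rewrite scale1r.
have bs : bounded_support mu (f \_ (sphere R n)).
  exists (sphere R n), C; split => //.
  - rewrite /mu/= /pushforward preS//; apply: le_lt_trans (@lebesgue_unit_ball_lty R N).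
    apply: le_measure; rewrite ?inE; [|exact: measurable_unit_ball|exact: subIsetr].
    apply: measurableI; last exact: measurable_unit_ball.
    by rewrite -[X in measurable X]setTI; exact: measurable_radial.
  - apply/(measurable_restrictT _ mS); apply: measurable_funTS; exact: hom_measurable hf.
  - move=> x; rewrite patchE; case: ifPn; last by rewrite normr0.
    by rewrite inE => /sphereE x1; rewrite fC// x1.
  - by move=> x xS; rewrite patchE memNset.
have vi0 : 0 <= v^-1 by rewrite invr_ge0 ltW.
have -> : sphere_int f = fine (\int[mscale (NngNum vi0) mu]_(x in sphere R n) (f x)%:E).
  rewrite /sphere_int /Rintegral; apply: (congr1 fine).
  apply: eq_measure_integral => A mA AS.
  transitivity (v^-1%:E * vol N (radial_cut @^-1` A))%E; last by [].
  by rewrite preS.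
rewrite integral_mkcond.
have -> : (fun x => (f x)%:E) \_ (sphere R n) = EFin \o (f \_ (sphere R n)).
  by rewrite restrict_EFin.
have ib := bounded_support_integrable bs.
have coneE x : (f \_ (sphere R n)) (radial_cut x) = cone x.
  rewrite patchE /cone /radial_cut; case: (leP (nsq x) 1) => x1; last first.
    rewrite scale0r !mulr0 memNset// => /sphereE; rewrite nsq0.
    by move=> /esym/eqP; rewrite oner_eq0.
  rewrite scale1r; have [x0|x0] := ltP 0 (nsq x).
    by rewrite mem_set ?mul1r ?mulr1//; apply/sphereE; exact: nsq_radial.
  rewrite mul0r mulr0 memNset// => /sphereE; rewrite /radial nsqZ.
  have -> : nsq x = 0 by apply/eqP; rewrite eq_le x0 nsq_ge0.
  by rewrite mulr0 => /esym/eqP; rewrite oner_eq0.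
rewrite integral_mscale//; last exact: (measurable_int _ ib).
rewrite fineM//; last exact: integrable_fin_num.
have E : (\int[mu]_x (EFin \o (f \_ (sphere R n))) x = \int[vol N]_x (cone x)%:E)%E.
  rewrite /mu [LHS]integral_pushforward//.
  - by rewrite preimage_setT; apply: eq_integral => x _; rewrite /= coneE.
  - exact: measurable_radial_cut.
  - exact: (measurable_int _ ib).
  - rewrite preimage_setT (_ : _ \o _ = EFin \o cone).
      exact: (unit_support_integrable unit_support_cone).
    by apply/funext => x; rewrite /= coneE.
have cancel (x y z : R) : x * z = 1 -> x * y * z = y by move=> h; rewrite mulrAC h mul1r.
by rewrite E; apply: cancel; apply: mulVf; rewrite gt_eqF.
Qed.

Lemma coneZ (r : R) (x : 'rV[R]_N) : 0 < r ->
  cone (r *: x) = f (radial x) * ((0 < nsq x)%R%:R * (nsq x <= r ^- 2)%R%:R).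
Proof.
move=> r0; rewrite /cone nsqZ pmulr_rgt0 ?exprn_gt0//.
have -> : radial (r *: x) = radial x.
  rewrite /radial /enorm.
  have -> : \sum_(i < N) (r *: x) ord0 i ^+ 2 = r ^+ 2 * nsq x.
    by rewrite /nsq mulr_sumr; apply: eq_bigr => i _; rewrite mxE exprMn.
  rewrite sqrtrM ?sqr_ge0// sqrtr_sqr gtr0_norm// scalerA invfM mulrAC mulVf ?gt_eqF// mul1r.
  by [].
by rewrite -[r ^- 2]mul1r ler_pdivlMr ?exprn_gt0// [r ^+ 2 * _]mulrC.
Qed.

(** Before the cut-off, [cone] is constant along rays, so restricting it to the ball of radius u
    amounts to a dilation. *)
Lemma Rintegral_cone_le (u : R) : 0 < u -> u <= 1 ->
  \int[vol N]_x (cone x * (enorm x <= u)%R%:R) = u ^+ N * \int[vol N]_x cone x.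
Proof.
move=> u0 u1; have ui : 0 < u^-1 by rewrite invr_gt0.
have E x : cone x * (enorm x <= u)%R%:R = cone (u^-1 *: x).
  rewrite coneZ// exprVn invrK -enorm_sqr ler_pXn2r ?nnegrE ?enorm_ge0 ?(ltW u0)//.
  rewrite /cone; case: (leP (enorm x) u) => xu; last by rewrite !mulr0.
  by rewrite mulr1 -enorm_sqr expr_le1 ?enorm_ge0// (le_trans xu).
under eq_Rintegral do rewrite E.
have [C [mF FC F0]] := unit_support_cone.
rewrite Rintegral_scale//.
- by rewrite invrK.
- exact: (unit_support_integrable unit_support_cone).
- apply: (@unit_support_integrable R N (fun x => cone (u^-1 *: x))); exists C; split => //.
    by apply: (measurableT_comp mF); exact: (@measurable_scale_rV R N u^-1).
  move=> x x1; apply: F0; rewrite nsqZ; apply: lt_le_trans x1 _.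
  by rewrite ler_peMl ?nsq_ge0// exprVn invf_ge1 ?exprn_gt0// exprn_ile1// ltW.
Qed.

End radial.

End sphere_integral.

Section sphere_moment.
Context {R : realType}.
Local Notation vol N := (@lebesgue_rV R N).
Local Notation leb := (@lebesgue_measure R).
Local Notation intg a b F := (\int[leb]_(x in `[a, b]) F x).

(* For [k > 0], [f x = \int_0^(enorm x) k u^(k-1) f (radial x) du]; exchanging the
   integrals leaves only the degree-0 part of [f]. *)
Lemma moment_sphere n k (f : 'rV[R]_n.+1 -> R) : hom k f ->
  n.+1%:R * (sphere_int f * fine (vol n.+1 (unit_ball R n.+1))) =
  (n.+1 + k)%:R * moment f.
Proof.
move=> hf; set N := n.+1; case: k hf => [|k] hf.
  have fc x : f x = f 0 by have := hom_scale 0 x hf; rewrite scale0r expr0 mul1r.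
  rewrite addn0 (_ : f = fun=> f 0); last exact/funext.
  rewrite sphere_int_cst /moment; congr (_ * _).
  rewrite RintegralZl//; last first.
    rewrite (_ : _ \o _ = EFin \o (fun x : 'rV[R]_N => 1 * (nsq x <= 1)%R%:R)).
      exact: (unit_support_integrable (unit_support_moment (hom_one N) (lexx 1))).
    by apply/funext => x /=; rewrite mul1r.
  congr (_ * _); rewrite (_ : (fun x => _) = \1_(unit_ball R N)); last first.
    apply/funext => x; rewrite indicE; congr (nat_of_bool _)%:R.
    by apply/idP/idP => [|]; rewrite inE => /unit_ballE.
  by rewrite /Rintegral integral_indic ?setIT//; exact: measurable_unit_ball.
have hc := unit_support_cone hf; set H := \int[vol N]_x cone f x.
have [C [mc cC c0]] := hc.
rewrite (sphere_int_cone hf) -/H.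
pose w (u : R) := k.+1%:R * u ^+ k.
(* The product of [w u], the indicator of 0 <= u <= 1 and [cone f x] restricted to [u < enorm x].
   Integration in u gives f on the ball; integration in x gives [w u * (1 - u ^+ N)] times the
   integral of the cone. *)
pose E (z : measurableTypeR R * 'rV[R]_N) : R :=
  w z.1 * (0 <= z.1 <= 1)%R%:R * (cone f z.2 - cone f z.2 * (enorm z.2 <= z.1)%R%:R).
have cw : continuous w.
  by move=> u; apply: cvgM; [exact: cvg_cst|exact: exprn_continuous].
have w1 u : 0 <= u <= 1 -> `|w u| <= k.+1%:R.
  move=> /andP[u0 u1]; rewrite /w ger0_norm ?mulr_ge0 ?exprn_ge0//.
  by rewrite ler_piMr// exprn_ile1.
have mE : measurable_fun setT (E : _ -> measurableTypeR R).
  have m1 : measurable_fun setT (fun z : measurableTypeR R * 'rV[R]_N => z.1) by exact: measurable_fst.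
  have m2 : measurable_fun setT (fun z : measurableTypeR R * 'rV[R]_N => z.2) by exact: measurable_snd.
  have mcz : measurable_fun setT (fun z : measurableTypeR R * 'rV[R]_N => cone f z.2 : measurableTypeR R).
    exact: (measurableT_comp mc).
  apply: measurable_funM; first apply: measurable_funM.
  - by apply: (@measurableT_comp _ _ _ _ _ _ w) => //; exact: continuous_measurable_fun.
  - apply: (@measurable_natb R _ _ (fun z : measurableTypeR R * 'rV[R]_N => 0 <= z.1 <= 1)).
    by apply: measurable_and; apply: measurable_fun_ler => //; exact: measurable_cst.
  apply: measurable_funB => //; apply: measurable_funM => //.
  apply: (@measurable_natb R _ _ (fun z : measurableTypeR R * 'rV[R]_N => enorm z.2 <= z.1)).
  apply: measurable_fun_ler => //.
  by apply: (measurableT_comp (@measurable_enorm R N)).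
have EC z : `|E z| <= k.+1%:R * (C + C).
  rewrite /E; case: (boolP (0 <= z.1 <= 1)) => [z1|_]; last first.
    by rewrite mulr0 mul0r normr0 mulr_ge0// addr_ge0// (le_trans _ (cC 0)).
  rewrite mulr1 normrM ler_pM// ?w1// (le_trans (ler_normB _ _))// lerD// normrM.
  by apply: le_trans (cC z.2); rewrite ler_piMr//; case: (enorm _ <= _)%R; rewrite ?normr1 ?normr0.
have E0 z : (1 < z.1 \/ z.1 < 0 \/ 1 < nsq z.2) -> E z = 0.
  rewrite /E => -[|[|]] h; last by rewrite (c0 _ h) mul0r subrr mulr0.
    by rewrite (leNgt z.1) h andbF mulr0 mul0r.
  by rewrite (leNgt 0) h mulr0 mul0r.
have wX (a b : R) : a <= b -> intg a b w = b ^+ k.+1 - a ^+ k.+1.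
  move=> ab; apply: (@intg_FTC R (fun u => u ^+ k.+1)) => // u _.
  have h := @is_deriveX R _ id k.+1 u 1 _ (is_derive_id u 1).
  rewrite exprfctE in h; apply: (is_derive_eq h).
  by rewrite /GRing.scale/= mulr1.
have iw (a b : R) : leb.-integrable setT (EFin \o (w \_ `[a, b])).
  have mI : measurable (`[a, b] : set (measurableTypeR R)) by exact: measurable_itv.
  have ci := @continuous_integrable_itv R w a b cw.
  have := (@integrable_mkcond _ _ _ leb `[a, b] _ mI).1 ci.
  by rewrite restrict_EFin.
transitivity ((N + k.+1)%:R * \int[leb]_u \int[vol N]_x E (u, x)); last first.
  congr (_ * _); rewrite Rfubini_swap.
  - apply: eq_Rintegral => x _.
    have [x1|x1] := boolP (0 < nsq x <= 1); last first.
      rewrite (_ : (fun u => _) = fun=> 0).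
        rewrite Rintegral_cst// mul0r; case/nandP: x1 => x1; last first.
          by rewrite (negbTE x1) mulr0.
        rewrite (_ : f x = 0) ?mul0r//.
        have /eqP x0 : x == 0 by rewrite -nsq_le0 leNgt.
        by rewrite x0 -(scale0r 0) (hom_scale _ _ hf) exprS !mul0r.
      apply/funext => u; rewrite /E/= (_ : cone f x = 0) ?mul0r ?subrr ?mulr0//.
      by rewrite /cone; case/nandP: x1 => /negbTE ->; rewrite ?mul0r ?mulr0.
    have e0 : 0 < enorm x by rewrite sqrtr_gt0; case/andP: x1.
    have e1 : enorm x <= 1 by rewrite -(@expr_le1 _ 2) ?enorm_ge0// enorm_sqr; case/andP: x1.
    transitivity (\int[leb]_u (cone f x * ((w \_ `[0, 1]) u - (w \_ `[enorm x, 1]) u))).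
      apply: eq_Rintegral => u _; rewrite /E/= !patchE !mem_setE !in_itv/= (_ : point = 0 :> R)//.
      case: (leP (enorm x) u) => eu; last first.
        by rewrite /= mulr0 !subr0; case: ifP => _; rewrite ?mulr1 ?mulr0 ?mul0r//; ring.
      by rewrite (le_trans (ltW e0) eu)/=; case: ifP => _; rewrite ?mulr1 ?mulr0 ?mul0r; ring.
    rewrite RintegralZl//; last first.
      have := integrableB measurableT (iw 0 1) (iw (enorm x) 1).
      by apply: eq_integrable.
    rewrite RintegralB// -!Rintegral_mkcond !wX ?ler01// expr0n/= expr1n.
    rewrite /cone; case/andP: x1 => -> ->; rewrite !mulr1 subr0 opprB addrC subrK.
    rewrite mulrC -(hom_scale _ _ hf) /radial scalerA mulfV ?gt_eqF// scale1r.
    by [].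
  - apply: bounded_support_integrable; exists (`[0, 1]%classic `*` unit_ball R N), (k.+1%:R * (C + C)); split => //.
    + by apply: measurableX; [exact: measurable_itv|exact: measurable_unit_ball].
    + exact: itv_ball_lty.
    + move=> [u x] nD; apply: E0 => /=.
      have [u1|u1] := ltP 1 u; [by left|right].
      have [u0|u0] := ltP u 0; [by left|right].
      rewrite ltNge; apply/negP => x1; apply: nD; split; last exact/unit_ballE.
      by rewrite /= in_itv/= u0 u1.
  - move=> u; apply: (@unit_support_integrable R N (fun x => E (u, x))).
    exists (k.+1%:R * (C + C)); split => // [|x x1]; last by apply: E0; right; right.
    by apply: (measurableT_comp mE); exact: measurable_pair1.
  - move=> x; apply: (@bounded_support_integrable R _ _ leb (fun u => E (u, x))).
    exists (`[0, 1]%classic), (k.+1%:R * (C + C)); split => //.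
    + exact: itv_lty.
    + by apply: (measurableT_comp mE); exact: measurable_pair2.
    + move=> u nu; apply: E0 => /=.
      have [u1|u1] := ltP 1 u; [by left|right].
      have [u0|u0] := ltP u 0; [by left|right].
      by case: nu; rewrite /= in_itv/= u0 u1.
have ic : (vol N).-integrable setT (EFin \o cone f) by exact: unit_support_integrable.
have icu u : (vol N).-integrable setT (fun x => (cone f x * (enorm x <= u)%R%:R)%:E).
  apply: (@unit_support_integrable R N (fun x => cone f x * (enorm x <= u)%R%:R)).
  exists C; split.
  - apply: measurable_funM => //; apply: measurable_natb.
    by apply: measurable_fun_ler; [exact: measurable_enorm|exact: measurable_cst].
  - move=> x; rewrite normrM; apply: le_trans (cC x).
    by rewrite ler_piMr//; case: (enorm _ <= _)%R; rewrite ?normr1 ?normr0.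
  - by move=> x /c0 ->; rewrite mul0r.
have inner u : \int[vol N]_x E (u, x) = ((fun u => H * (w u - w u * u ^+ N)) \_ `[0, 1]) u.
  rewrite patchE mem_setE in_itv/= /E/=; case: ifP => [u01|_]; last first.
    by under eq_Rintegral do rewrite mulr0 mul0r; rewrite Rintegral_cst ?mul0r.
  rewrite RintegralZl//; last exact: (integrableB measurableT ic (icu u)).
  rewrite RintegralB//; last exact: icu.
  rewrite mulr1 -/H; suff -> : \int[vol N]_x (cone f x * (enorm x <= u)%R%:R) = u ^+ N * H by ring.
  case/andP: u01; rewrite le_eqVlt => /predU1P[<- _|u0 u1]; last exact: (Rintegral_cone_le hf).
  rewrite expr0n/= mul0r (_ : (fun x => _) = fun=> 0) ?Rintegral_cst ?mul0r//.
  apply/funext => x; rewrite /cone; have [x0|x0] := ltP 0 (nsq x); last by rewrite mul0r mulr0 mul0r.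
  by rewrite (_ : enorm x <= 0 = false) ?mulr0//; apply/negbTE; rewrite -ltNge sqrtr_gt0.
under eq_Rintegral do rewrite inner.
rewrite -Rintegral_mkcond intgZ; last first.
  by move=> u; apply: cvgB; [exact: cw|apply: cvgM; [exact: cw|exact: exprn_continuous]].
have -> : intg 0 1 (fun u => w u - w u * u ^+ N) =
    (1 ^+ k.+1 - k.+1%:R / (N + k.+1)%:R * 1 ^+ (N + k.+1)) -
    (0 ^+ k.+1 - k.+1%:R / (N + k.+1)%:R * 0 ^+ (N + k.+1)).
  apply: (@intg_FTC R (fun u => u ^+ k.+1 - k.+1%:R / (N + k.+1)%:R * u ^+ (N + k.+1))) => //.
    by move=> u; apply: cvgB; [exact: cw|apply: cvgM; [exact: cw|exact: exprn_continuous]].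
  move=> u _.
  have h m := @is_deriveX R _ id m u 1 _ (is_derive_id u 1).
  have h2 := is_deriveB (h k.+1) (is_deriveZ (k.+1%:R / (N + k.+1)%:R) (h (N + k.+1)%N)).
  rewrite !exprfctE in h2; apply: (is_derive_eq h2).
  rewrite (_ : (N + k.+1).-1 = (N + k)%N) ?addnS//.
  have cN0 : (N + k).+1%:R != 0 :> R by rewrite pnatr_eq0.
  rewrite /GRing.scale/= !mulr1 mulrA mulfVK// /w exprD; ring.
have cN0 : (N + k.+1)%:R != 0 :> R by rewrite pnatr_eq0 addnS.
rewrite !expr1n !expr0n addnS/= -addnS !mulr0 !mulr1 !subr0 mulrCA mulrBr mulr1 mulrCA mulfV// mulr1.
by rewrite natrD addrK mulrC.
Qed.

End sphere_moment.

Section latitude.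
Context {R : realType}.
Local Notation vol N := (@lebesgue_rV R N).
Local Notation leb := (@lebesgue_measure R).
Local Notation intg a b F := (\int[leb]_(x in `[a, b]) F x).

Lemma vol_ball_gt0 N : 0 < fine (vol N (unit_ball R N)).
Proof. by apply: fine_gt0; rewrite lebesgue_unit_ball_gt0 lebesgue_unit_ball_lty. Qed.

Lemma hom_nice n k (f : 'rV[R]_n.+1 -> R) : hom k f -> sphere_nice f.
Proof. by move=> hf; apply: (@plt_nice _ _ k.+1); exact: plt_hom hf. Qed.

Lemma sphere_int_odd n k (f : 'rV[R]_n.+1 -> R) : hom k f -> odd k -> sphere_int f = 0.
Proof.
move=> hf ok; have := moment_sphere hf; rewrite (moment_odd hf ok) mulr0.
move/eqP; rewrite !mulf_eq0 pnatr_eq0/= => /orP[/eqP//|].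
by rewrite gt_eqF// vol_ball_gt0.
Qed.

(** The degree factors of [moment_sphere] in the two dimensions are exchanged by [wallisSS], which
    also lowers the power of the sine by 2. No factor depending on the degree of [g a] is left. *)
Lemma latitude_sum n K (f : 'rV[R]_n.+2 -> R) (g : nat -> 'rV[R]_n.+1 -> R) : hom K f ->
  (forall a, (a <= K)%N -> hom (K - a) (g a)) ->
  (forall u y, f (rcons0 u y) = \sum_(a < K.+1) u ^+ a * g a y) ->
  n.+2%:R * (sphere_int f * fine (vol n.+2 (unit_ball R n.+2))) =
  n.+1%:R * fine (vol n.+1 (unit_ball R n.+1)) *
    \sum_(a < K.+1) wallis a (n + (K - a)) * sphere_int (g a).
Proof.
move=> hf hg fE; rewrite (moment_sphere hf) (moment_rcons0 hf hg fE) !mulr_sumr.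
apply: eq_bigr => a _; have ak : (a <= K)%N by rewrite -ltnS.
have e1 := moment_sphere (hg a ak); have e2 := @wallisSS R a (n + (K - a)).
rewrite addSn mulrA.
have -> : (n.+2 + K)%:R * wallis a (n + (K - a)).+2 =
  (n + (K - a)).+1%:R * wallis a (n + (K - a)) :> R.
  by rewrite -e2; congr (_%:R * _); lia.
rewrite -mulrA mulrCA -addSn -e1; ring.
Qed.

Lemma latitude_hom n K (f : 'rV[R]_n.+2 -> R) : hom K f -> exists P : {poly R},
  [/\ (size P <= K.+1)%N,
      forall x, sphere_int (fun y => f (rcons0 (cos x) (sin x *: y))) = P.[cos x] &
      intg 0 pi (fun x => P.[cos x] * sin x ^+ n) = wallis 0 n * sphere_int f].
Proof.
move=> hf; have [g hg fE] := hom_rcons0 hf.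
pose L a := sphere_int (g a).
(* Only even K - a contribute, since odd homogeneous functions integrate to zero; for these,
   [sin x ^+ (K - a)] is a polynomial in [cos x]. *)
pose Q a : {poly R} := 'X^a * (1 - 'X^2) ^+ ((K - a)./2).
have QE (a : 'I_K.+1) x : L a * (Q a).[cos x] = L a * (cos x ^+ a * sin x ^+ (K - a)).
  have ak : (a <= K)%N by rewrite -ltnS.
  have [oka|eka] := boolP (odd (K - a)); first by rewrite /L (sphere_int_odd (hg a ak) oka) !mul0r.
  rewrite /Q !hornerE (_ : (1 - _ ^+ 2) ^+ _ = sin x ^+ (K - a))//.
  by rewrite -sin2cos2 -exprM mul2n even_halfK//.
exists (\sum_(a < K.+1) L a *: Q a); split.
- apply: leq_trans (size_sum _ _ _) _; apply/bigmax_leqP => a _.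
  have ak : (a <= K)%N by rewrite -ltnS.
  apply: leq_trans (size_scale_leq _ _) _.
  apply: leq_trans (size_polyMleq _ _) _; rewrite size_polyXn/=.
  have : (size ((1 - 'X^2) ^+ ((K - a)./2) : {poly R}) <= ((K - a)./2).*2.+1)%N.
    apply: leq_trans (size_poly_exp_leq _ _) _; rewrite ltnS -mul2n leq_mul2r.
    apply/orP; right; rewrite -subn1 leq_subLR.
    by rewrite (leq_trans (size_polyD _ _))// size_polyN size_polyXn size_poly1.
  move=> sz; apply: leq_trans (leq_add (leqnn a) sz) _.
  by rewrite addnS ltnS -leq_subRL// -[leqRHS]odd_double_half leq_addl.
- move=> x; rewrite horner_sum.
  transitivity (sphere_int (fun y => \sum_(a < K.+1) (cos x ^+ a * sin x ^+ (K - a)) * g a y)).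
    apply: eq_sphere_int => y _; rewrite fE; apply: eq_bigr => a _.
    by rewrite (hom_scale _ _ (hg a _)) ?mulrA// -ltnS.
  have hF (a : nat) : (a < K.+1)%N -> plt K.+1 (fun y => (cos x ^+ a * sin x ^+ (K - a)) * g a y).
    by move=> ak; apply: pltZ; apply: plt_hom (hg a ak); rewrite ltnS leq_subr.
  rewrite (sphere_int_sum hF); apply: eq_bigr => a _.
  rewrite sphere_intZ; last by apply: hom_nice (hg a _); rewrite -ltnS.
  by rewrite hornerZ QE mulrC.
have S0 := latitude_sum hf hg fE.
(* The ratio of the ball volumes is found by applying the same identity to the constant function
   1. *)
have [g1 hg1 gE1] := @hom_rcons0 R _ _ _ (hom_one n.+2).
have := @latitude_sum _ _ _ _ (hom_one n.+2) hg1 gE1.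
rewrite sphere_int_cst mul1r big_ord1 subn0 addn0.
have -> : sphere_int (g1 0) = 1.
  rewrite -[RHS](sphere_int_cst n); apply: eq_sphere_int => y _.
  by have := gE1 0 y; rewrite big_ord1 expr0 mul1r => <-.
rewrite mulr1 => S1.
have -> : intg 0 pi (fun x => (\sum_(a < K.+1) L a *: Q a).[cos x] * sin x ^+ n) =
    \sum_(a < K.+1) wallis a (n + (K - a)) * L a.
  transitivity (intg 0 pi (fun x => \sum_(a < K.+1) L a * (cos x ^+ a * sin x ^+ (n + (K - a))))).
    apply: eq_Rintegral => x _; rewrite horner_sum mulr_suml; apply: eq_bigr => a _.
    by rewrite hornerZ QE exprD; ring.
  have cF (a : 'I_K.+1) : continuous (fun x : R => L a * (cos x ^+ a * sin x ^+ (n + (K - a)))).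
    by move=> x; apply: cvgM; [exact: cvg_cst|exact: continuous_cos_sin].
  rewrite intg_sum//; apply: eq_bigr => a _.
  transitivity (L a * wallis a (n + (K - a))); last exact: mulrC.
  by apply: intgZ; exact: continuous_cos_sin.
have v0 := vol_ball_gt0 n.+1; set v1 := fine _ in v0 S0 S1.
have nv : n.+1%:R * v1 != 0 by rewrite mulf_neq0 ?pnatr_eq0// gt_eqF.
have S2 : n.+2%:R * fine (vol n.+2 (unit_ball R n.+2)) = n.+1%:R * v1 * wallis 0 n := S1.
by apply: (mulfI nv); rewrite /L -S0 [RHS]mulrA -S2; ring.
Qed.

(** Besides the integral formula, the point is that the layer averages form a polynomial in [cos x]
    whose degree does not exceed that of f, as the midpoint rule requires. *)
Lemma latitude n t (f : 'rV[R]_n.+2 -> R) : plt t f -> exists P : {poly R},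
  [/\ (size P <= t)%N,
      forall x, sphere_int (fun y => f (rcons0 (cos x) (sin x *: y))) = P.[cos x] &
      intg 0 pi (fun x => P.[cos x] * sin x ^+ n) = wallis 0 n * sphere_int f].
Proof.
move=> [F hF ->]; have [P HP] := choice (fun k => latitude_hom (hF k)).
exists (\sum_(k < t) P k); split.
- apply: leq_trans (size_sum _ _ _) _; apply/bigmax_leqP => k _.
  by have [sP _ _] := HP k; exact: leq_trans sP _.
- move=> x; rewrite horner_sum.
  have pF k : (k < t)%N -> plt t (fun y => F k (rcons0 (cos x) (sin x *: y))).
    by move=> kt; apply: plt_subst; exact: plt_hom (hF k).
  rewrite (sphere_int_sum pF); apply: eq_bigr => k _.
  by have [_ -> _] := HP k.
have pF k : (k < t)%N -> plt t (F k) by move=> kt; exact: plt_hom (hF k).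
rewrite (sphere_int_sum pF) mulr_sumr.
transitivity (intg 0 pi (fun x => \sum_(k < t) (P k).[cos x] * sin x ^+ n)).
  by apply: eq_Rintegral => x _; rewrite horner_sum mulr_suml.
rewrite intg_sum; first by apply: eq_bigr => k _; have [_ _ ->] := HP k.
move=> k x; apply: cvgM; first exact: continuous_horner_cos.
by apply: (@continuous_comp _ _ _ sin (fun y => y ^+ n)); [exact: continuous_sin|exact: exprn_continuous].
Qed.

Definition pt1 (s : R) : 'rV[R]_1 := rcons0 s 0.

Lemma pt1Z (r s : R) : r *: pt1 s = pt1 (r * s).
Proof. by rewrite /pt1 rcons0Z scaler0. Qed.

(** On S^0, the two points, parts of odd degree average to zero and parts of even degree are
    constant. *)
Lemma sphere_int0 t (f : 'rV[R]_1 -> R) : plt t f ->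
  sphere_int f = (f (pt1 1) + f (pt1 (- 1))) / 2.
Proof.
move=> [F hF ->].
have pF k : (k < t)%N -> plt t (F k) by move=> kt; exact: plt_hom (hF k).
rewrite (sphere_int_sum pF) -big_split/= mulr_suml; apply: eq_bigr => k _.
have -> : pt1 (- 1) = (- 1) *: pt1 1 by rewrite pt1Z mulr1.
rewrite (hom_scale _ _ (hF k)).
have [ok|ek] := boolP (odd k).
  by rewrite (sphere_int_odd (hF k) ok) -signr_odd ok expr1 mulN1r subrr mul0r.
rewrite -signr_odd (negbTE ek) expr0 mul1r.
have -> : (F k (pt1 1) + F k (pt1 1)) / 2 = F k (pt1 1) by field.
rewrite -[RHS](sphere_int_cst 0); apply: eq_sphere_int => x x1.
have x2 : x ord0 ord0 ^+ 2 = 1 by rewrite -x1 /nsq big_ord1.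
have -> : x = x ord0 ord0 *: pt1 1.
  rewrite pt1Z mulr1; apply/rowP => i; rewrite (ord1 i).
  by rewrite /pt1 /rcons0 rV_cons_ord0.
by rewrite (hom_scale _ _ (hF k)) -(odd_double_half k) (negbTE ek) add0n -mul2n exprM x2 expr1n mul1r.
Qed.

(** The latitude formula over S^0: the layer at x consists of the points of angle x and -x, so
    integration over [0, pi] covers a full period. *)
Lemma sphere_int1 t (f : 'rV[R]_2 -> R) : plt t f ->
  intg 0 (2 * pi) (fun x => f (rcons0 (cos x) (pt1 (sin x)))) = 2 * pi * sphere_int f.
Proof.
move=> pf; have [P [_ PE PI]] := latitude pf.
pose h x : R := f (rcons0 (cos x) (pt1 (sin x))).
have pi0 := pi_ge0 R.
have ch : continuous h.
  apply: (plt_continuous_path pf) => i.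
  case: (unliftP ord0 i) => [j|] ->.
    rewrite (ord1 j) (_ : (fun s => _) = sin); first exact: continuous_sin.
    by apply/funext => s; rewrite /rcons0 rV_cons_lift /= /pt1 /rcons0 rV_cons_ord0.
  rewrite (_ : (fun s => _) = cos); first exact: continuous_cos.
  by apply/funext => s; rewrite /rcons0 rV_cons_ord0.
have chN : continuous (fun x => h (- x)).
  by move=> x; apply: continuous_comp; [exact: continuousN|exact: ch].
have PhE x : P.[cos x] = (h x + h (- x)) / 2.
  rewrite -PE (sphere_int0 (plt_subst _ _ pf)) /h !pt1Z mulr1 mulrN1.
  by rewrite cosN sinN.
have W : wallis 0 0 = pi :> R.
  rewrite /wallis; under eq_Rintegral do rewrite !expr0 mulr1.
  by rewrite intg_cst// mul1r subr0.
move: PI; rewrite W => PI; rewrite -mulrA -PI.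
have -> : intg 0 pi (fun x => P.[cos x] * sin x ^+ 0) = (intg 0 pi h + intg 0 pi (fun x => h (- x))) / 2.
  rewrite -intgD// mulrC -intgZ; last by move=> x; apply: cvgD; [exact: ch|exact: chN].
  by apply: eq_Rintegral => x _; rewrite PhE expr0 mulr1 mulrC.
rewrite mulrCA mulfV ?mulr1 ?pnatr_eq0//.
have pi2 : pi <= 2 * pi :> R by lra.
rewrite -(intg_cat ch pi0 pi2) (intg_opp ch pi0) oppr0; congr (_ + _).
have p2 x : h (1 * x + 2 * pi) = h x.
  by rewrite /h mul1r mulrC mulr_natr cosD2pi sinD2pi.
have := @intg_affine R h (- pi) 0 1 (2 * pi) ch.
under eq_Rintegral do rewrite p2.
rewrite mulr1 => ->//; last by rewrite oppr_le0.
have -> : 1 * - pi + 2 * pi = pi :> R by ring.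
by rewrite mulr0 add0r.
Qed.

End latitude.

(** * Families of circles *)

Section circles.
Context {R : realType}.
Local Notation leb := (@lebesgue_measure R).
Local Notation intg a b F := (\int[leb]_(x in `[a, b]) F x).

Definition lastc m (p : 'rV[R]_m.+1) : R := p ord0 ord_max.

(* [p] is the meridian profile of a circle: its last coordinate is the radius. *)
Definition circ m (p : 'rV[R]_m.+1) (th : R) : 'rV[R]_m.+2 :=
  \row_i (if (i < m)%N then p ord0 (inord i)
          else lastc p * (if i == m :> nat then cos th else sin th)).

Lemma circE m (p : 'rV[R]_m.+1) th i : circ p th ord0 i =
  if (i < m)%N then p ord0 (inord i)
  else lastc p * (if i == m :> nat then cos th else sin th).
Proof. by rewrite mxE. Qed.

Lemma rcons0_0 n (u : R) (y : 'rV[R]_n) : rcons0 u y ord0 ord0 = u.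
Proof. exact: rV_cons_ord0. Qed.

Lemma rcons0_lift n (u : R) (y : 'rV[R]_n) i : rcons0 u y ord0 (lift ord0 i) = y ord0 i.
Proof. exact: rV_cons_lift. Qed.

Lemma rcons0_inj n u v (x y : 'rV[R]_n) : rcons0 u x = rcons0 v y -> u = v /\ x = y.
Proof.
move=> e; split; first by rewrite -(rcons0_0 u x) e rcons0_0.
by apply/rowP => i; rewrite -(rcons0_lift u x) e rcons0_lift.
Qed.

Lemma lastc_rcons0 m u (p : 'rV[R]_m.+1) : lastc (rcons0 u p) = lastc p.
Proof.
rewrite /lastc (_ : ord_max = lift ord0 ord_max) ?rcons0_lift//.
exact: val_inj.
Qed.

Lemma lastcZ m s (p : 'rV[R]_m.+1) : lastc (s *: p) = s * lastc p.
Proof. by rewrite /lastc mxE. Qed.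

Lemma lastc_pt1 s : lastc (pt1 s : 'rV[R]_1) = s.
Proof. by rewrite /lastc (_ : ord_max = ord0) ?rcons0_0//; exact: val_inj. Qed.

Lemma circ_rcons0 m u (p : 'rV[R]_m.+1) th : circ (rcons0 u p) th = rcons0 u (circ p th).
Proof.
apply/rowP => i; rewrite circE lastc_rcons0; case: (unliftP ord0 i) => [j|] ->.
  rewrite rcons0_lift circE lift0 ltnS eqSS; case: ifP => // jm.
  rewrite (_ : inord j.+1 = lift ord0 (inord j)) ?rcons0_lift//.
  by apply: ord_inj; rewrite lift0 !inordK ?ltnS// ltnW.
rewrite ltn0Sn (_ : inord ord0 = ord0) ?rcons0_0//.
by apply: ord_inj; rewrite inordK.
Qed.

Lemma circ_pt1 s th : circ (pt1 s) th = rcons0 (s * cos th) (pt1 (s * sin th)).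
Proof.
apply/rowP => i; rewrite circE lastc_pt1 ltn0; case: (unliftP ord0 i) => [j|] ->.
  by rewrite (ord1 j) rcons0_lift rcons0_0.
by rewrite rcons0_0.
Qed.

Lemma circZ m s (p : 'rV[R]_m.+1) th : circ (s *: p) th = s *: circ p th.
Proof.
apply/rowP => i; rewrite !mxE lastcZ; case: ifP => _; by rewrite ?mxE ?mulrA.
Qed.

Lemma circD m (p q : 'rV[R]_m.+1) th : circ (p + q) th = circ p th + circ q th.
Proof.
apply/rowP => i; rewrite !mxE /lastc; case: ifP => _; rewrite ?mxE//.
by rewrite mulrDl.
Qed.

Lemma nsq_circ m (p : 'rV[R]_m.+1) th : nsq (circ p th) = nsq p.
Proof.
rewrite /nsq !big_ord_recr/= !mxE/= ltnn eqxx ltnNge leqnSn/= gtn_eqF//.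
rewrite -addrA !exprMn -mulrDr cos2Dsin2 mulr1; congr (_ + _).
apply: eq_bigr => i _; rewrite circE /= ltn_ord; congr (p _ _ ^+ 2).
by apply: val_inj; rewrite /= inordK// ltnS ltnW.
Qed.

Lemma continuous_circ m (p : 'rV[R]_m.+1) i : continuous (fun th => circ p th ord0 i).
Proof.
case: (ltnP i m) => im.
  rewrite (_ : (fun th => _) = fun=> p ord0 (inord i)); first by move=> x; exact: cvg_cst.
  by apply/funext => th; rewrite mxE im.
rewrite (_ : (fun th => _) = fun th => lastc p * (if i == m :> nat then cos th else sin th)).
  move=> x; apply: cvgM; first exact: cvg_cst.
  by case: ifP => _; [exact: continuous_cos|exact: continuous_sin].
by apply/funext => th; rewrite mxE ltnNge im.
Qed.

Definition circle_mean m (p : 'rV[R]_m.+1) (f : 'rV[R]_m.+2 -> R) : R :=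
  (2 * pi)^-1 * intg 0 (2 * pi) (fun th => f (circ p th)).

(** Each mean is weighted with the radius, so 2 pi times this sum is the integral along the circles
    with respect to arc length. *)
Definition circle_sum m (ps : seq 'rV[R]_m.+1) (f : 'rV[R]_m.+2 -> R) : R :=
  \sum_(p <- ps) lastc p * circle_mean p f.

Lemma circle_mean_cst m (p : 'rV[R]_m.+1) c : circle_mean p (fun=> c) = c.
Proof.
have pi0 := pi_gt0 R; rewrite /circle_mean intg_cst; last lra.
rewrite subr0; field; lra.
Qed.

Section circle_sums.
Variable m : nat.
Implicit Types (p : 'rV[R]_m.+1) (ps : seq 'rV[R]_m.+1) (f g : 'rV[R]_m.+2 -> R).

Lemma continuous_plt_circ t f p : plt t f -> continuous (fun th => f (circ p th)).
Proof. by move=> pf; apply: (plt_continuous_path pf) => i; exact: continuous_circ. Qed.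

Lemma circle_mean_le t p f B : plt t f -> nsq p = 1 ->
  (forall x, nsq x = 1 -> `|f x| <= B) -> `|circle_mean p f| <= B.
Proof.
move=> pf p1 fB; have pi0 := pi_gt0 R.
rewrite /circle_mean normrM ger0_norm; last by rewrite invr_ge0; lra.
rewrite mulrC ler_pdivrMr; last lra.
apply: le_trans (intg_le (continuous_plt_circ (p := p) pf) _ (B := B) _) _.
- lra.
- by move=> th _; apply: fB; rewrite nsq_circ.
- by rewrite subr0.
Qed.

Lemma circle_meanB t p f g : plt t f -> plt t g ->
  circle_mean p (fun x => f x - g x) = circle_mean p f - circle_mean p g.
Proof.
move=> pf pg; rewrite /circle_mean -mulrBr; congr (_ * _).
by apply: intgB; [exact: continuous_plt_circ pf|exact: continuous_plt_circ pg].
Qed.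

Definition profile p := nsq p = 1 /\ 0 < lastc p.

Lemma circle_sumB t ps f g : plt t f -> plt t g ->
  circle_sum ps (fun x => f x - g x) = circle_sum ps f - circle_sum ps g.
Proof.
move=> pf pg; rewrite /circle_sum -sumrB; apply: eq_bigr => p _.
by rewrite (circle_meanB _ pf pg) mulrBr.
Qed.

Lemma circle_sum_le t ps f B : plt t f -> (forall p, p \in ps -> profile p) ->
  (forall x, nsq x = 1 -> `|f x| <= B) ->
  `|circle_sum ps f| <= B * circle_sum ps (fun=> 1).
Proof.
move=> pf gp fB; rewrite /circle_sum mulr_sumr.
apply: le_trans (ler_norm_sum _ _ _) _; rewrite big_seq [leRHS]big_seq.
apply: ler_sum => p /gp[p1 l0]; rewrite normrM gtr0_norm// circle_mean_cst mulr1 mulrC.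
by rewrite ler_pM2r// (circle_mean_le pf).
Qed.

Lemma circle_sum_cat ps qs f : circle_sum (ps ++ qs) f = circle_sum ps f + circle_sum qs f.
Proof. by rewrite /circle_sum big_cat. Qed.

Lemma circle_sum_flatten (I : Type) (r : seq I) (F : I -> seq 'rV[R]_m.+1) f :
  circle_sum (flatten [seq F i | i <- r]) f = \sum_(i <- r) circle_sum (F i) f.
Proof.
elim: r => [|i r IH] /=; first by rewrite /circle_sum !big_nil.
by rewrite circle_sum_cat IH big_cons.
Qed.

End circle_sums.

Definition layer m (c s : R) (p : 'rV[R]_m.+1) : 'rV[R]_m.+2 := rcons0 c (s *: p).

Lemma circle_sum_layer m c s (ps : seq 'rV[R]_m.+1) (f : 'rV[R]_m.+3 -> R) :
  circle_sum (map (layer c s) ps) f =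
  s * circle_sum ps (fun y => f (rcons0 c (s *: y))).
Proof.
rewrite /circle_sum big_map mulr_sumr; apply: eq_bigr => p _.
rewrite /layer lastc_rcons0 lastcZ -mulrA; congr (_ * (_ * (_ * _))).
by apply: eq_Rintegral => th _; rewrite circ_rcons0 circZ.
Qed.

Lemma nsq_layer m c s (p : 'rV[R]_m.+1) : c ^+ 2 + s ^+ 2 = 1 -> nsq p = 1 -> nsq (layer c s p) = 1.
Proof. by move=> cs p1; rewrite /layer nsq_rcons0 nsqZ p1 mulr1. Qed.

Lemma profile_layer m c s (p : 'rV[R]_m.+1) : c ^+ 2 + s ^+ 2 = 1 -> 0 < s ->
  profile p -> profile (layer c s p).
Proof.
move=> cs s0 [p1 l0]; split; first exact: nsq_layer.
by rewrite /layer lastc_rcons0 lastcZ mulr_gt0.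
Qed.

Lemma layer_inj m c s : s != 0 -> injective (@layer m c s).
Proof. by move=> s0 p q /rcons0_inj[_]; exact: scalerI. Qed.

Lemma enormZ n s (x : 'rV[R]_n) : enorm (s *: x) = `|s| * enorm x.
Proof.
apply/eqP; rewrite -(@eqrXn2 _ 2) ?enorm_ge0 ?mulr_ge0 ?enorm_ge0//.
by rewrite exprMn !enorm_sqr nsqZ real_normK ?num_real.
Qed.

Lemma rcons0B n u v (x y : 'rV[R]_n) : rcons0 u x - rcons0 v y = rcons0 (u - v) (x - y).
Proof.
apply/rowP => i; rewrite mxE [X in _ + X]mxE; case: (unliftP ord0 i) => [j|] ->.
  by rewrite !rcons0_lift !mxE.
by rewrite !rcons0_0.
Qed.

Lemma enorm_layerB m c s (p q : 'rV[R]_m.+1) : enorm (layer c s p - layer c s q) = `|s| * enorm (p - q).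
Proof.
rewrite /layer rcons0B subrr -scalerBr -enormZ.
apply/eqP; rewrite -(@eqrXn2 _ 2) ?enorm_ge0//.
by rewrite !enorm_sqr nsq_rcons0 expr0n add0r.
Qed.

Lemma nsq_subr_le4 n (x y : 'rV[R]_n) : nsq x = 1 -> nsq y = 1 -> nsq (x - y) <= 4.
Proof.
move=> x1 y1; have : 0 <= nsq (x + y) by exact: nsq_ge0.
have : nsq (x + y) + nsq (x - y) = 2 * nsq x + 2 * nsq y.
  rewrite /nsq -big_split !mulr_sumr -big_split; apply: eq_bigr => i _.
  by rewrite /= !mxE; ring.
rewrite x1 y1; lra.
Qed.

Lemma enorm_subr_le2 n (x y : 'rV[R]_n) : nsq x = 1 -> nsq y = 1 -> enorm (x - y) <= 2.
Proof.
move=> x1 y1; rewrite -(@ler_pXn2r _ 2) ?nnegrE ?enorm_ge0// enorm_sqr.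
by apply: le_trans (nsq_subr_le4 x1 y1) _; rewrite expr2; lra.
Qed.

(** Length of the polygon through successive profiles. It controls the length of the great arcs that
    will join the circles. *)
Fixpoint conn n (p : 'rV[R]_n) (ps : seq 'rV[R]_n) : R :=
  if ps is q :: qs then enorm (p - q) + conn q qs else 0.

Definition connl n (ps : seq 'rV[R]_n) : R := if ps is p :: qs then conn p qs else 0.

Lemma connl_cat n (ps qs : seq 'rV[R]_n) : (forall p, p \in ps ++ qs -> nsq p = 1) ->
  connl (ps ++ qs) <= connl ps + connl qs + 2.
Proof.
case: ps => [|p ps]; first by rewrite /= add0r lerDl.
elim: ps p => [|p' ps IH] p h /=.
  case: qs h => [|q qs] h /=; first by rewrite !add0r.
  rewrite add0r addrC lerD2l; apply: enorm_subr_le2; apply: h; rewrite !inE eqxx ?orbT//.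
have h' x : x \in (p' :: ps) ++ qs -> nsq x = 1.
  by move=> xin; apply: h; rewrite cat_cons inE xin orbT.
have := IH p' h'; rewrite /= => hIH.
by rewrite -(lerD2l (enorm (p - p'))) in hIH; apply: le_trans hIH _; lra.
Qed.

Lemma connl_layer m c s (ps : seq 'rV[R]_m.+1) : connl (map (layer c s) ps) = `|s| * connl ps.
Proof.
case: ps => [|p ps] /=; first by rewrite mulr0.
elim: ps p => [|q ps IH] p /=; first by rewrite mulr0.
by rewrite IH enorm_layerB mulrDr.
Qed.

Lemma connl_flatten n (F : nat -> seq 'rV[R]_n) (D : R) (r : seq nat) :
  (forall i p, i \in r -> p \in F i -> nsq p = 1) -> (forall i, i \in r -> connl (F i) <= D) ->
  connl (flatten [seq F i | i <- r]) <= (D + 2) * (size r)%:R.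
Proof.
elim: r => [|i r IH] hF hD /=; first by rewrite mulr0.
apply: le_trans (connl_cat _) _.
  move=> p; rewrite mem_cat => /orP[pi|/flatten_mapP[j jr pj]].
    by apply: hF pi; rewrite inE eqxx.
  by apply: hF pj; rewrite inE jr orbT.
rewrite -(addn1 (size r)) natrD mulrDr mulr1 addrAC [leRHS]addrC; apply: lerD.
  by rewrite lerD2r hD// inE eqxx.
by apply: IH => [j p jr|j jr]; [apply: hF|apply: hD]; rewrite inE jr orbT.
Qed.

Lemma connl_iota n (F : nat -> 'rV[R]_n) (D : R) k N : 0 <= D ->
  (forall i, enorm (F i - F i.+1) <= D) -> connl [seq F i | i <- iota k N] <= D * N%:R.
Proof.
move=> D0 hD; case: N => [|N] /=; first by rewrite mulr0.
apply: (@le_trans _ _ (D * N%:R)); last by rewrite ler_wpM2l// ler_nat.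
elim: N k => [|N IH] k /=; first by rewrite mulr0.
by rewrite -(addn1 N) natrD mulrDr mulr1 addrC lerD.
Qed.

(** The midpoint rule multiplied by M / pi: the error becomes independent of M, that is, of the size
    of a single layer. *)
Lemma layer_quadrature n t M (f : 'rV[R]_n.+2 -> R) B : plt t f ->
  (forall x, nsq x = 1 -> `|f x| <= B) -> (t + n <= M)%N -> (0 < M)%N ->
  `|\sum_(j < M) sin (node M j) ^+ n *
      sphere_int (fun y => f (rcons0 (cos (node M j)) (sin (node M j) *: y))) -
    M%:R * (wallis 0 n / pi * sphere_int f)| <= 2 * pi * B.
Proof.
move=> pf fB tM M0; have [P [sP PE PI]] := latitude pf.
have pi0 := pi_gt0 R; have M0' : 0 < M%:R :> R by rewrite ltr0n.
have PB x : `|P.[cos x]| <= B.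
  rewrite -PE; apply: sphere_int_le; first exact: plt_nice (plt_subst _ _ pf).
  by move=> y y1; apply: fB; rewrite nsq_rcons0 nsqZ y1 mulr1 cos2Dsin2.
have := @midpoint_cos_sinX _ n M P B (leq_trans (leq_add sP (leqnn n)) tM) M0 PB.
rewrite PI.
have -> : \sum_(j < M) sin (node M j) ^+ n *
      sphere_int (fun y => f (rcons0 (cos (node M j)) (sin (node M j) *: y))) =
    \sum_(j < M) P.[cos (node M j)] * sin (node M j) ^+ n.
  by apply: eq_bigr => j _; rewrite PE mulrC.
set S := \sum_(j < M) _; set W := wallis 0 n * _ => h.
have -> : S - M%:R * (wallis 0 n / pi * sphere_int f) = (M%:R / pi) * (pi / M%:R * S - W).
  by rewrite /W; field; lra.
rewrite normrM gtr0_norm ?divr_gt0//.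
apply: le_trans (ler_wpM2l _ h) _; first by rewrite divr_ge0// ltW.
by rewrite le_eqVlt; apply/orP; left; apply/eqP; field; lra.
Qed.

End circles.

(** * Circle families and their base case on S^2 *)

Section design.
Context {R : realType}.
Local Notation leb := (@lebesgue_measure R).
Local Notation intg a b F := (\int[leb]_(x in `[a, b]) F x).

(* [T] plays the role of the degree; the total length [2 * pi * circle_sum ps 1]
   is then [2 * pi * kap * T ^+ n.+1] up to [O(T ^+ n)]. *)
Definition circle_design n (kap C T : R) (ps : seq 'rV[R]_n.+2) : Prop :=
  [/\ forall p, p \in ps -> profile p, uniq ps, connl ps <= C * T ^+ n &
      forall t f B, t%:R <= T -> plt t.+1 f -> (forall x, nsq x = 1 -> `|f x| <= B) ->
        `|circle_sum ps f - kap * T ^+ n.+1 * sphere_int f| <= C * T ^+ n * B].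

(** The constants do not depend on T. With one [kap] for all real T, families built for different
    degrees can be combined with a predictable total weight. *)
Definition designs n := exists kap C : R, [/\ 0 < kap, 0 < C &
  forall T, 1 <= T -> exists ps : seq 'rV[R]_n.+2, circle_design kap C T ps].

Lemma node_inj M : {in gtn M &, injective (@node R M)}.
Proof.
move=> i j iM jM; have M0 : (0 < M)%N by apply: leq_ltn_trans iM.
have p0 := pi_gt0 R; have M0' : 0 < M%:R :> R by rewrite ltr0n.
rewrite /node => /divIf e; apply/eqP; rewrite -(@eqr_nat R); apply/eqP.
have /mulfI : pi != 0 :> R by rewrite gt_eqF.
move=> /(_ _ _ (e _)) h; have : 2 * i%:R + 1 = 2 * j%:R + 1 :> R by apply: h; lra.
lra.
Qed.

Lemma node_cos_inj M i j : (i < M)%N -> (j < M)%N -> cos (node M i) = cos (node M j) :> R -> i = j.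
Proof.
move=> iM jM; have M0 : (0 < M)%N by apply: leq_ltn_trans iM.
move=> /cos_inj e; apply: (@node_inj M) => //; apply: e;
  by rewrite in_itv/= !ltW ?node_gt0 ?node_ltpi.
Qed.

Lemma sin_node_gt0 M j : (j < M)%N -> 0 < sin (node M j) :> R.
Proof.
move=> jM; have M0 : (0 < M)%N by apply: leq_ltn_trans jM.
by apply: sin_gt0_pi; rewrite node_gt0// node_ltpi.
Qed.

Lemma nodeS M j : (0 < M)%N -> node M j.+1 - node M j = pi / M%:R :> R.
Proof.
move=> M0; have M0' : 0 < M%:R :> R by rewrite ltr0n.
by rewrite /node -(addn1 j) natrD; field; lra.
Qed.

Lemma enorm_arc (a b : R) : a <= b ->
  enorm (rcons0 (cos a) (pt1 (sin a)) - rcons0 (cos b) (pt1 (sin b))) <= b - a.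
Proof.
move=> ab; rewrite -(@ler_pXn2r _ 2) ?nnegrE ?enorm_ge0 ?subr_ge0// enorm_sqr.
rewrite rcons0B /pt1 rcons0B nsq_rcons0 nsq_rcons0 subrr.
have -> : nsq (0 : 'rV[R]_0) = 0 by rewrite /nsq big_ord0.
have h := one_sub_cos_le (b - a); have c := cosB b a.
have a1 := cos2Dsin2 a; have b1 := cos2Dsin2 b.
rewrite addr0; apply: (@le_trans _ _ (2 * (1 - cos (b - a)))); last lra.
rewrite c le_eqVlt; apply/orP; left; apply/eqP.
transitivity ((cos a ^+ 2 + sin a ^+ 2) + (cos b ^+ 2 + sin b ^+ 2) - 2 * (cos b * cos a + sin b * sin a)).
  by rewrite !expr2; ring.
by rewrite a1 b1; ring.
Qed.

Lemma truncn_bounds (T : R) : 0 <= T -> (Num.truncn T)%:R <= T < (Num.truncn T).+1%:R.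
Proof. by move=> T0; exact: truncn_itv. Qed.

(** Parallels on S^2 at the midpoint latitudes: the radius that weights each circle is already the
    density [sin] of the latitude formula. *)
Lemma designs0 : designs 0.
Proof.
have p0 := pi_gt0 R; have w0 : 0 < wallis 0 1 :> R by exact: wallis0_gt0.
pose kap : R := wallis 0 1 / pi; have k0 : 0 < kap by exact: divr_gt0.
exists kap, (2 * pi + 2 * kap); split=> // [|T T1]; first by lra.
have T0 : 0 <= T by lra.
have /andP[tr1 tr2] := truncn_bounds T0.
(* The summand 2 ensures [t.+1 + 1 <= M] for every degree t up to T. *)
pose M := (Num.truncn T + 2)%N; have M0 : (0 < M)%N by rewrite /M addn2.
have M0' : 0 < M%:R :> R by rewrite ltr0n.
have MT : `|M%:R - T| <= 2 :> R.
  rewrite /M natrD ler_norml; apply/andP; split; first by move: tr2; rewrite -natr1; lra.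
  by lra.
pose P j : 'rV[R]_2 := rcons0 (cos (node M j)) (pt1 (sin (node M j))).
exists [seq P j | j <- iota 0 M]; split.
- move=> p /mapP[j]; rewrite mem_iota add0n => jM ->; split.
    rewrite /P /pt1 !nsq_rcons0 /nsq big_ord0 addr0; exact: cos2Dsin2.
  by rewrite /P lastc_rcons0 lastc_pt1 sin_node_gt0.
- rewrite map_inj_in_uniq ?iota_uniq// => i j; rewrite !mem_iota !add0n => iM jM.
  by move=> /rcons0_inj[/node_cos_inj e _]; exact: e.
- have hc : connl [seq P j | j <- iota 0 M] <= pi / M%:R * M%:R.
    apply: connl_iota => [|j]; first by rewrite divr_ge0// ltW.
    rewrite -(nodeS j M0); apply: enorm_arc.
    by rewrite -subr_ge0 nodeS// divr_ge0// ltW.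
  rewrite expr0 mulr1; apply: le_trans hc _.
  by rewrite divfK ?gt_eqF//; lra.
move=> t f B tT pf fB; rewrite expr0 mulr1 expr1.
have tM : (t.+1 + 1 <= M)%N.
  by rewrite /M addn1 addn2 !ltnS truncn_ge_nat// .
have := layer_quadrature pf fB tM M0; set S := \sum_(j < M) _ => h.
have -> : circle_sum [seq P j | j <- iota 0 M] f = S.
  rewrite /circle_sum big_map -{1}(subn0 M) big_mkord; apply: eq_bigr => j _.
  rewrite /P lastc_rcons0 lastc_pt1 expr1; congr (_ * _).
  have pfj := plt_subst (cos (node M j)) (sin (node M j)) pf.
  have := sphere_int1 pfj; set L := sphere_int _ => e.
  rewrite /circle_mean; apply: (@mulfI _ (2 * pi)); first by rewrite mulf_neq0 ?pnatr_eq0// gt_eqF.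
  rewrite mulrA mulfV ?mul1r; last by rewrite mulf_neq0 ?pnatr_eq0// gt_eqF.
  rewrite -e; apply: eq_Rintegral => th _.
  by rewrite circ_rcons0 circ_pt1 rcons0Z pt1Z.
have L1 : `|sphere_int f| <= B by apply: sphere_int_le => //; exact: plt_nice pf.
have -> : S - kap * T * sphere_int f =
    (S - M%:R * (wallis 0 1 / pi * sphere_int f)) + (M%:R - T) * (kap * sphere_int f).
  by rewrite -/kap; ring.
apply: le_trans (ler_normD _ _) _; rewrite [leRHS]mulrDl lerD// normrM -mulrA ler_pM//.
by rewrite normrM gtr0_norm// ler_pM2l.
Qed.

(** Cube of the inequality [x / 12 <= expR (x / 12)]. *)
Lemma expR_quarter (x : R) : 0 < x -> x ^+ 3 * expR (- (x / 4)) <= 12 ^+ 3.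
Proof.
move=> x0; have h : x / 12 <= expR (x / 12) by apply: le_trans (expR_ge1Dx _); lra.
have h3 : (x / 12) ^+ 3 <= expR (x / 4).
  have -> : x / 4 = 3%:R * (x / 12) by field.
  rewrite expRM_natl ler_pXn2r ?nnegrE ?expR_ge0//; lra.
rewrite expRN ler_pdivrMr ?expR_gt0//.
have -> : x ^+ 3 = 12 ^+ 3 * (x / 12) ^+ 3 by rewrite -exprMn mulrC divfK// pnatr_eq0.
by rewrite ler_wpM2l// exprn_ge0.
Qed.

(** With U = 64 T s, the growth factor is at most e^(U/4), and 2^-tau is at most e^(-U/2) because
    1/2 <= e^(-1/2). The hypothesis [T <= U ^+ 2] turns the factor t + 1 into 2 U^2, so all is
    bounded by 24 U^3 e^(-U/4). The extra factor U in the statement makes the reduction error of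
    order 1 / U. *)
Lemma reduction_error t tau (s T : R) : t.+1%:R <= 2 * T -> 0 < s -> 0 < T ->
  T <= (64 * T * s) ^+ 2 -> 64 * T * s <= tau%:R ->
  12 * t.+1%:R * (1 + 8 * s) ^+ t.+1 * 2^-1 ^+ tau * (64 * T * s) <= 12 * (2 * 12 ^+ 3).
Proof.
move=> tT s0 T0 TT tau1; set U := 64 * T * s in TT tau1 *.
have U0 : 0 < U by rewrite /U !mulr_gt0.
have h1 : (1 + 8 * s) ^+ t.+1 <= expR (U / 4).
  apply: (@le_trans _ _ (expR (8 * s) ^+ t.+1)).
    by rewrite ler_pXn2r ?nnegrE ?expR_ge0 ?expR_ge1Dx//; lra.
  rewrite -expRM_natl ler_expR /U.
  have : t.+1%:R * (8 * s) <= 2 * T * (8 * s) by rewrite ler_wpM2r//; lra.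
  lra.
have h2 : (2^-1 : R) ^+ tau <= expR (- (U / 2)).
  apply: (@le_trans _ _ (expR (- 2^-1) ^+ tau)).
    apply: lerXn2r; rewrite ?nnegrE ?expR_ge0//.
    by apply: le_trans (expR_ge1Dx _); lra.
  by rewrite -expRM_natl ler_expR; lra.
have h3 : (1 + 8 * s) ^+ t.+1 * 2^-1 ^+ tau <= expR (- (U / 4)).
  have -> : - (U / 4) = U / 4 - U / 2 by field.
  rewrite expRD; apply: ler_pM => //; rewrite exprn_ge0//; lra.
have h4 : t.+1%:R <= 2 * U ^+ 2 by lra.
have h5 := expR_quarter U0.
set X := (1 + 8 * s) ^+ t.+1 * _ in h3.
have X0 : 0 <= X by rewrite /X mulr_ge0// exprn_ge0//; lra.
have -> : 12 * t.+1%:R * (1 + 8 * s) ^+ t.+1 * 2^-1 ^+ tau * U = 12 * (t.+1%:R * U * X) by rewrite /X; ring.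
have h6 : t.+1%:R * U * X <= 2 * U ^+ 2 * U * expR (- (U / 4)).
  apply: ler_pM => //; first by rewrite mulr_ge0// ltW.
  by rewrite ler_wpM2r// ltW.
set D := 12 ^+ 3 in h5 *.
rewrite ler_pM2l//; apply: le_trans h6 _.
have -> : 2 * U ^+ 2 * U * expR (- (U / 4)) = 2 * (U ^+ 3 * expR (- (U / 4))) by rewrite [U ^+ 3]exprSr; ring.
by rewrite ler_pM2l.
Qed.

Lemma sphere_intB n t (f g : 'rV[R]_n.+1 -> R) : plt t f -> plt t g ->
  sphere_int (fun x => f x - g x) = sphere_int f - sphere_int g.
Proof.
move=> pf pg; have e : (fun x => f x - g x) = (fun x => f x + (-1) * g x).
  by apply/funext => x; rewrite mulN1r.
rewrite e sphere_intD ?sphere_intZ ?mulN1r//.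
- exact: plt_nice pg.
- exact: plt_nice pf.
- exact: plt_nice (pltZ (-1) pg).
Qed.

Lemma circle_sum1_le n kap C T (ps : seq 'rV[R]_n.+2) : 0 < C -> 1 <= T ->
  circle_design kap C T ps -> circle_sum ps (fun=> 1) <= (kap + C) * T ^+ n.+1.
Proof.
move=> C0 T1 [_ _ _ h]; have T0 : 0 < T by lra.
have := h 0 (fun=> 1) 1 _ (plt_cst _ _ _) _; rewrite sphere_int_cst !mulr1.
move=> /(_ _ _)/(le_trans (ler_norm _)) h1.
have {}h1 : circle_sum ps (fun=> 1) - kap * T ^+ n.+1 <= C * T ^+ n.
  by apply: h1 => [|x _]; rewrite ?normr1//; lra.
have h2 : C * T ^+ n <= C * T ^+ n.+1 by rewrite ler_pM2l// exprS ler_peMl// exprn_ge0//; lra.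
by rewrite mulrDl; lra.
Qed.

(** Transfers the estimate from a low-degree g to a nearby f of possibly larger degree. The total
    weight of the family is O(T^(n+1)), so an approximation error of order B / T costs no more than
    the error T^n B already present. *)
Lemma design_approx n kap C T (ps : seq 'rV[R]_n.+2) t (f g : 'rV[R]_n.+3 -> R) (B eps E : R) :
  0 < kap -> 0 < C -> 1 <= T -> circle_design kap C T ps -> plt t f ->
  plt (Num.truncn T).+1 g -> (forall x, nsq x = 1 -> `|f x| <= B) ->
  (forall x, nsq x = 1 -> `|f x - g x| <= eps) -> 0 <= B -> 0 <= E -> eps * T <= E * B ->
  `|circle_sum ps f - kap * T ^+ n.+1 * sphere_int f| <=
    ((kap + C) * E + C * (1 + E) + kap * E) * T ^+ n * B.
Proof.
move=> k0 C0 T1 des pf pg fB fg B0 E0 epsT; have T0 : 0 < T by lra.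
have eps0 : 0 <= eps.
  apply: le_trans (normr_ge0 (sphere_int (fun x => f x - g x))) _.
  pose u := maxn t (Num.truncn T).+1.
  apply: sphere_int_le => //; apply: (@plt_nice _ _ u).
  have := pltD (plt_widen (leq_maxl _ _ : (t <= u)%N) pf) (pltN (plt_widen (leq_maxr _ _ : (_ <= u)%N) pg)).
  by [].
have epsE : eps <= E * B by apply: le_trans epsT; rewrite ler_peMr.
pose u := maxn t (Num.truncn T).+1.
have {}pf : plt u f by apply: plt_widen pf; exact: leq_maxl.
have pg' : plt u g by apply: plt_widen pg; exact: leq_maxr.
have pfg : plt u (fun x => f x - g x) := pltD pf (pltN pg').
have /andP[tr _] := truncn_bounds (ltW T0).
have [gp _ _ hd] := des.
have gB x : nsq x = 1 -> `|g x| <= (1 + E) * B.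
  move=> x1; have -> : g x = f x - (f x - g x) by ring.
  apply: le_trans (ler_normB _ _) _; rewrite mulrDl mul1r lerD ?fB//.
  exact: le_trans (fg x x1) epsE.
have h1 : `|circle_sum ps (fun x => f x - g x)| <= (kap + C) * E * T ^+ n * B.
  apply: le_trans (circle_sum_le pfg gp fg) _.
  apply: (@le_trans _ _ (eps * ((kap + C) * T ^+ n.+1))).
    by rewrite ler_wpM2l//; exact: circle_sum1_le des.
  have -> : eps * ((kap + C) * T ^+ n.+1) = (kap + C) * T ^+ n * (eps * T) by rewrite exprS; ring.
  have -> : (kap + C) * E * T ^+ n * B = (kap + C) * T ^+ n * (E * B) by ring.
  by rewrite ler_wpM2l// mulr_ge0 ?exprn_ge0//; lra.
have h2 := hd _ _ _ tr pg gB.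
have h3 : `|kap * T ^+ n.+1 * sphere_int (fun x => f x - g x)| <= kap * E * T ^+ n * B.
  have k1 : 0 <= kap * T ^+ n.+1 by rewrite mulr_ge0 ?exprn_ge0//; lra.
  rewrite normrM ger0_norm//; apply: (@le_trans _ _ (kap * T ^+ n.+1 * eps)).
    by rewrite ler_wpM2l//; apply: sphere_int_le => //; exact: plt_nice pfg.
  have -> : kap * T ^+ n.+1 * eps = kap * T ^+ n * (eps * T) by rewrite exprS; ring.
  have -> : kap * E * T ^+ n * B = kap * T ^+ n * (E * B) by ring.
  by rewrite ler_wpM2l// mulr_ge0 ?exprn_ge0//; lra.
rewrite (sphere_intB pf pg') in h3; rewrite (circle_sumB _ pf pg') in h1.
set Sf := circle_sum ps f in h1 *; set Sg := circle_sum ps g in h1 h2.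
set K := kap * T ^+ n.+1 in h2 h3 *.
have -> : Sf - K * sphere_int f = (Sf - Sg) + (Sg - K * sphere_int g) - K * (sphere_int f - sphere_int g) by ring.
have -> : ((kap + C) * E + C * (1 + E) + kap * E) * T ^+ n * B =
  (kap + C) * E * T ^+ n * B + C * T ^+ n * ((1 + E) * B) + kap * E * T ^+ n * B by ring.
apply: le_trans (ler_normB _ _) _; rewrite lerD//.
by apply: le_trans (ler_normD _ _) _; rewrite lerD.
Qed.

End design.

(** * Induction on the dimension *)

Section design_step.
Context {R : realType}.

Lemma uniq_flatten_map (I T : eqType) (F : I -> seq T) (r : seq I) : uniq r ->
  (forall i, i \in r -> uniq (F i)) ->
  (forall i j x, i \in r -> j \in r -> x \in F i -> x \in F j -> i = j) ->
  uniq (flatten [seq F i | i <- r]).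
Proof.
elim: r => [|i r IH] //= /andP[ir ur] uF disj; rewrite cat_uniq uF ?inE ?eqxx//=.
rewrite IH ?andbT//.
- apply/hasPn => x /flatten_mapP[j jr xj]; apply/negP => xi.
  have := disj i j x; rewrite !inE eqxx jr orbT => /(_ isT isT xi xj) ij.
  by move: ir; rewrite ij jr.
- by move=> j jr; apply: uF; rewrite inE jr orbT.
- by move=> j k x jr kr; apply: disj; rewrite inE ?jr ?kr orbT.
Qed.

(* The layer of radius [s] uses the family for the degree [64 * T * s]: there the
   factor [(1 + 8 * s) ^+ t.+1 <= expR (16 * T * s)] of [degree_reduction] is
   beaten by [2^-1 ^+ tau].  Layers with [(64 * T * s) ^+ 2 < T] contribute
   little and are left empty. *)
Lemma designsS n : @designs R n -> @designs R n.+1.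
Proof.
move=> [kap [C [k0 C0 hd]]].
have /choice[L hL] : forall T : R, exists ps : seq 'rV[R]_n.+2, 1 <= T -> circle_design kap C T ps.
  move=> T; have [/hd[ps ?]|_] := boolP (1 <= T); [by exists ps|by exists [::]].
have p0 := pi_gt0 R; have w0 : 0 < wallis 0 n.+2 :> R by exact: wallis0_gt0.
pose A : R := 64; have A0 : 0 < A by rewrite /A.
pose W : R := wallis 0 n.+2 / pi; have W0 : 0 < W by exact: divr_gt0.
pose kap' := kap * A ^+ n.+1 * W.
have k0' : 0 < kap' by rewrite /kap'; apply: mulr_gt0 => //; apply: mulr_gt0 => //; exact: exprn_gt0.
pose E : R := 12 * (2 * 12 ^+ 3); have E0 : 0 <= E by rewrite /E !mulr_ge0 ?exprn_ge0.
pose C1 := (kap + C) * E + C * (1 + E) + kap * E.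
have C10 : 0 <= C1 by rewrite /C1 !addr_ge0 ?mulr_ge0 ?addr_ge0// ltW.
pose b : R := n%:R + 5.
have b0 : 5 <= b by rewrite /b lerDr.
(* The summands account for the layers, nonempty ([C1]) or left empty ([kap]), for the midpoint
   rule, for replacing M by T, and for the length of the polygon. *)
pose Ctot := b * (C1 + kap) * A ^+ n + kap * A ^+ n.+1 * (2 * pi) + kap' * b + (C * A ^+ n + 2) * b.
have An0 k : 0 < A ^+ k by exact: exprn_gt0.
have b0' : 0 <= b by lra.
have C1k : 0 <= C1 + kap by rewrite addr_ge0// ltW.
have c1 : 0 <= b * (C1 + kap) * A ^+ n by apply: mulr_ge0; [exact: mulr_ge0|exact: ltW].
have c2 : 0 <= kap * A ^+ n.+1 * (2 * pi).
  by apply: mulr_ge0; [apply: mulr_ge0; exact: ltW|apply: mulr_ge0 => //; exact: ltW].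
have c3 : 0 < kap' * b by rewrite mulr_gt0//; lra.
have c4' : 0 <= C * A ^+ n + 2 by apply: addr_ge0 => //; apply: mulr_ge0; exact: ltW.
have c4 : 0 <= (C * A ^+ n + 2) * b by exact: mulr_ge0.
exists kap', Ctot; split=> // [|T T1]; first by rewrite /Ctot; lra.
have T0 : 0 < T by lra.
have /andP[tr1 tr2] := truncn_bounds (ltW T0).
(* The summand n + 3 ensures [t.+1 + n.+2 <= M]: degree at most T together with the density of
   exponent n + 2. *)
pose M := (Num.truncn T + n.+3)%N; have M0 : (0 < M)%N by rewrite /M addnS.
have ME : M%:R = (Num.truncn T)%:R + n%:R + 3 :> R.
  by rewrite /M natrD -(addn3 n) natrD addrA.
have n0 : 0 <= n%:R :> R by exact: ler0n.
have MT : `|M%:R - T| <= b.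
  by rewrite ME ler_norml /b; move: tr2; rewrite -natr1 => tr2; apply/andP; split; lra.
have Mb : M%:R <= b * T.
  have : n%:R <= n%:R * T by rewrite ler_peMr.
  by rewrite ME /b mulrDl; lra.
pose s j : R := sin (node M j); pose c j : R := cos (node M j).
have cs j : c j ^+ 2 + s j ^+ 2 = 1 by exact: cos2Dsin2.
have s0 j : (j < M)%N -> 0 < s j by exact: sin_node_gt0.
have s1 j : s j <= 1 by exact: sin_le1.
pose U j := A * T * s j.
pose ps j := if T <= U j ^+ 2 then map (layer (c j) (s j)) (L (U j)) else [::].
have U0 j : (j < M)%N -> 0 < U j by move=> jM; rewrite /U !mulr_gt0// s0.
have UAT j : U j <= A * T by rewrite /U ler_piMr ?mulr_ge0// ltW.
have U1 j : (j < M)%N -> T <= U j ^+ 2 -> 1 <= U j.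
  move=> jM TU; have u0 := ltW (U0 j jM).
  by rewrite -(@ler_pXn2r _ 2) ?nnegrE// expr1n; lra.
have des j : (j < M)%N -> T <= U j ^+ 2 -> circle_design kap C (U j) (L (U j)).
  by move=> jM TU; apply: hL; exact: U1.
have Un j : (j < M)%N -> U j ^+ n <= A ^+ n * T ^+ n.
  move=> jM; rewrite -exprMn; apply: lerXn2r => //; rewrite nnegrE ltW//; first exact: U0.
  exact: mulr_gt0.
have Tn k : 0 < T ^+ k by exact: exprn_gt0.
exists (flatten [seq ps j | j <- iota 0 M]); split.
- move=> p /flatten_mapP[j]; rewrite mem_iota add0n => jM; rewrite /ps; case: ifP => // TU.
  move=> /mapP[q qL ->]; apply: profile_layer; rewrite ?cs ?s0//.
  by have [h _ _ _] := des j jM TU; exact: h.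
- apply: uniq_flatten_map; first exact: iota_uniq.
    move=> j; rewrite mem_iota add0n => jM; rewrite /ps; case: ifP => // TU.
    rewrite map_inj_uniq; first by have [_ h _ _] := des j jM TU.
    by apply: layer_inj; rewrite gt_eqF// s0.
  move=> i j x; rewrite !mem_iota !add0n => iM jM; rewrite /ps; case: ifP => // _; case: ifP => // _.
  by move=> /mapP[q _ ->] /mapP[q' _ /rcons0_inj[/node_cos_inj h _]]; exact: h.
- apply: le_trans (connl_flatten (D := C * A ^+ n * T ^+ n) _ _) _.
  + move=> j p; rewrite mem_iota add0n => jM; rewrite /ps; case: ifP => // TU.
    move=> /mapP[q qL ->]; apply: nsq_layer; rewrite ?cs//.
    by have [h _ _ _] := des j jM TU; case: (h q qL).
  + move=> j; rewrite mem_iota add0n => jM; rewrite /ps; case: ifP => TU; last first.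
      by rewrite /= !mulr_ge0 ?ltW.
    rewrite connl_layer gtr0_norm ?s0//; have [_ _ h _] := des j jM TU.
    apply: (@le_trans _ _ (1 * (C * U j ^+ n))).
      apply: ler_pM => //; first exact: ltW (s0 j jM).
      by case: (L (U j)) => [|p q] //=; elim: q p => [|q r IH] p //=; rewrite addr_ge0 ?enorm_ge0.
    by rewrite mul1r -mulrA ler_pM2l// Un.
  rewrite size_iota; apply: (@le_trans _ _ ((C * A ^+ n + 2) * T ^+ n * (b * T))).
    apply: ler_pM => //; first by rewrite addr_ge0// !mulr_ge0 ?ltW.
    rewrite mulrDl lerD2l ler_peMr//.
    exact: exprn_ege1.
  have -> : (C * A ^+ n + 2) * T ^+ n * (b * T) = (C * A ^+ n + 2) * b * T ^+ n.+1 by rewrite exprS; ring.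
  by rewrite ler_pM2r// /Ctot; lra.
move=> t f B tT pf fB.
have L1 : `|sphere_int f| <= B by apply: sphere_int_le => //; exact: plt_nice pf.
have B0 : 0 <= B by apply: le_trans L1; exact: normr_ge0.
pose F j (y : 'rV[R]_n.+3) := f (rcons0 (c j) (s j *: y)).
have pF j : plt t.+1 (F j) by exact: plt_subst.
have FB j y : nsq y = 1 -> `|F j y| <= B.
  by move=> y1; apply: fB; rewrite nsq_rcons0 nsqZ y1 mulr1 cs.
have LF j : `|sphere_int (F j)| <= B by apply: sphere_int_le => //; [exact: plt_nice (pF j)|exact: FB].
(* The coefficient [kap * s j * U j ^+ n.+1] equals [kap * (A * T) ^+ n.+1] times [s j ^+ n.+2], the
   latitude density. One factor s comes from shrinking the circles, the others from lowering the
   degree. *)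
have layerE j : (j < M)%N ->
    `|circle_sum (ps j) f - kap * s j * U j ^+ n.+1 * sphere_int (F j)| <=
    (C1 + kap) * (A ^+ n * T ^+ n) * B.
  move=> jM; have sj0 := s0 j jM; have Uj0 := U0 j jM.
  have Unj : 0 < U j ^+ n by exact: exprn_gt0.
  rewrite /ps; case: (leP T (U j ^+ 2)) => TU.
    rewrite circle_sum_layer.
    have -> : s j * circle_sum (L (U j)) (F j) - kap * s j * U j ^+ n.+1 * sphere_int (F j) =
      s j * (circle_sum (L (U j)) (F j) - kap * U j ^+ n.+1 * sphere_int (F j)) by ring.
    rewrite normrM gtr0_norm//.
    (* The truncation order exceeds U, which gives the decay, while G still has degree at most U and
       is handled by the family for U. *)
    have [G pG FG] := degree_reduction (Num.truncn (U j)).+1 pf fB sj0 (cs j).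
    have /andP[_ trU] := truncn_bounds (ltW Uj0).
    have red : 12 * B * t.+1%:R * (1 + 8 * s j) ^+ t.+1 * 2^-1 ^+ (Num.truncn (U j)).+1 * U j <= E * B.
      have tT2 : t.+1%:R <= 2 * T by rewrite -natr1; lra.
      have h := reduction_error tT2 sj0 T0 TU (ltW trU).
      have -> : 12 * B * t.+1%:R * (1 + 8 * s j) ^+ t.+1 * 2^-1 ^+ (Num.truncn (U j)).+1 * U j =
        12 * t.+1%:R * (1 + 8 * s j) ^+ t.+1 * 2^-1 ^+ (Num.truncn (U j)).+1 * U j * B by ring.
      by rewrite ler_wpM2r.
    have := design_approx k0 C0 (U1 j jM TU) (des j jM TU) (pF j) pG (FB j) FG B0 E0 red.
    rewrite -/C1 => h; apply: (@le_trans _ _ (1 * (C1 * U j ^+ n * B))).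
      by apply: ler_pM => //; exact: ltW.
    rewrite mul1r ler_wpM2r//; apply: ler_pM => //; [exact: ltW|by rewrite lerDl ltW|exact: Un].
  rewrite /circle_sum big_nil sub0r normrN normrM.
  have pos : 0 <= kap * s j * U j ^+ n.+1 by rewrite !mulr_ge0 ?exprn_ge0// ltW.
  rewrite ger0_norm//; apply: ler_pM => //.
  (* [A * T * (s j * U j)] is [U j ^+ 2], which is below T on an empty layer; so the expected
     contribution drops from order U^(n+1) to order U^n. *)
  have sU : s j * U j <= 1.
    have e : A * T * (s j * U j) = U j ^+ 2 by rewrite /U; ring.
    rewrite -(ler_pM2l (mulr_gt0 A0 T0)) e mulr1; apply: le_trans (ltW TU) _.
    by rewrite ler_peMl ?ltW// /A ltr1n.
  have -> : kap * s j * U j ^+ n.+1 = kap * U j ^+ n * (s j * U j) by rewrite exprS; ring.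
  apply: (@le_trans _ _ (kap * U j ^+ n)); first by rewrite ler_piMr// mulr_ge0// ltW.
  apply: ler_pM; [exact: ltW|exact: ltW|by rewrite lerDr|exact: Un].
have tM : (t.+1 + n.+2 <= M)%N.
  by rewrite /M addSnnS leq_add2r truncn_ge_nat// ltW.
have := layer_quadrature pf fB tM M0; rewrite -/W; set S := \sum_(j < M) _ => hS.
rewrite circle_sum_flatten -{1}(subn0 M) big_mkord.
set Q := \sum_(j < M) circle_sum _ _.
have QS : `|Q - kap * (A * T) ^+ n.+1 * S| <= M%:R * ((C1 + kap) * (A ^+ n * T ^+ n) * B).
  rewrite /Q /S mulr_sumr -sumrB; apply: le_trans (ler_norm_sum _ _ _) _.
  rewrite [leRHS]mulrC; apply: ler_sum_cst => j; have := layerE j (ltn_ord j).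
  have -> // : kap * s j * U j ^+ n.+1 * sphere_int (F j) =
    kap * (A * T) ^+ n.+1 * (sin (node M j) ^+ n.+2 * sphere_int (F j)).
  by rewrite /U !exprMn -/(s j) [s j ^+ n.+2]exprS; ring.
(* Three errors, in this order: quadrature inside the layers, the midpoint rule across them, and M
   in place of T. *)
have -> : Q - kap' * T ^+ n.+2 * sphere_int f =
    (Q - kap * (A * T) ^+ n.+1 * S) + kap * (A * T) ^+ n.+1 * (S - M%:R * (W * sphere_int f)) +
    kap' * T ^+ n.+1 * ((M%:R - T) * sphere_int f).
  by rewrite /kap' !exprMn [T ^+ n.+2]exprS; ring.
have kAT : 0 <= kap * (A * T) ^+ n.+1 by rewrite mulr_ge0 ?exprn_ge0 ?mulr_ge0// ltW.
have i1 : `|Q - kap * (A * T) ^+ n.+1 * S| <= b * (C1 + kap) * A ^+ n * T ^+ n.+1 * B.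
  apply: le_trans QS _.
  have -> : b * (C1 + kap) * A ^+ n * T ^+ n.+1 * B = b * T * ((C1 + kap) * (A ^+ n * T ^+ n) * B).
    by rewrite exprS; ring.
  have q0 : 0 <= (C1 + kap) * (A ^+ n * T ^+ n) * B.
    by apply: mulr_ge0 => //; apply: mulr_ge0 => //; apply: mulr_ge0; exact: ltW.
  by rewrite ler_wpM2r.
have i2 : `|kap * (A * T) ^+ n.+1 * (S - M%:R * (W * sphere_int f))| <= kap * A ^+ n.+1 * (2 * pi) * T ^+ n.+1 * B.
  rewrite normrM ger0_norm//.
  have -> : kap * A ^+ n.+1 * (2 * pi) * T ^+ n.+1 * B = kap * (A * T) ^+ n.+1 * (2 * pi * B).
    by rewrite exprMn; ring.
  by rewrite ler_wpM2l.
have i3 : `|kap' * T ^+ n.+1 * ((M%:R - T) * sphere_int f)| <= kap' * b * T ^+ n.+1 * B.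
  have q0 : 0 <= kap' * T ^+ n.+1 by apply: mulr_ge0; exact: ltW.
  rewrite normrM (ger0_norm q0) normrM.
  have -> : kap' * b * T ^+ n.+1 * B = kap' * T ^+ n.+1 * (b * B) by ring.
  by rewrite ler_wpM2l// ler_pM.
have i4 : 0 <= (C * A ^+ n + 2) * b * T ^+ n.+1 * B.
  by apply: mulr_ge0 => //; apply: mulr_ge0 => //; exact: ltW.
have -> : Ctot * T ^+ n.+1 * B = b * (C1 + kap) * A ^+ n * T ^+ n.+1 * B +
  kap * A ^+ n.+1 * (2 * pi) * T ^+ n.+1 * B + kap' * b * T ^+ n.+1 * B +
  (C * A ^+ n + 2) * b * T ^+ n.+1 * B by rewrite /Ctot; ring.
rewrite -[leLHS]addr0 lerD//; apply: le_trans (ler_normD _ _) _; rewrite lerD//.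
by apply: le_trans (ler_normD _ _) _; rewrite lerD.
Qed.

Lemma designs_exist n : @designs R n.
Proof. by elim: n => [|n IH]; [exact: designs0|exact: designsS]. Qed.

End design_step.

(** * Concatenation of circular arcs *)

Section arcs.
Context {R : realType} (d : nat).
Implicit Types (X Y Z : 'rV[R]_d.+1) (a b x : R).
Local Notation leb := (@lebesgue_measure R).
Local Notation intg a b F := (\int[leb]_(x in `[a, b]) F x).

(** A common form for the circles and for the great arcs between them. It is stable under
    differentiation, which gives smoothness of every order. *)
Definition arc Z X Y a b x : 'rV[R]_d.+1 := Z + cos (a + b * x) *: X + sin (a + b * x) *: Y.

Definition dot n (x y : 'rV[R]_n) : R := \sum_(i < n) x ord0 i * y ord0 i.

Lemma nsq_comb n s t (x y : 'rV[R]_n) :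
  nsq (s *: x + t *: y) = s ^+ 2 * nsq x + 2 * (s * t * dot x y) + t ^+ 2 * nsq y.
Proof.
rewrite /nsq /dot !mulr_sumr -!big_split; apply: eq_bigr => i _.
by rewrite /= !mxE; ring.
Qed.

Lemma arc_coord Z X Y a b x i :
  arc Z X Y a b x ord0 i = Z ord0 i + cos (a + b * x) * X ord0 i + sin (a + b * x) * Y ord0 i.
Proof. by rewrite !mxE. Qed.

Lemma arc_is_derive Z X Y a b x :
  derivable (arc Z X Y a b) x 1 /\ derive1 (arc Z X Y a b) x = arc 0 (b *: Y) (- b *: X) a b x.
Proof.
have h i : is_derive x 1 (fun x => arc Z X Y a b x ord0 i) (arc 0 (b *: Y) (- b *: X) a b x ord0 i).
  rewrite (_ : (fun x => _) = (fun x => Z ord0 i + cos (a + b * x) * X ord0 i + sin (a + b * x) * Y ord0 i)); last first.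
    by apply/funext => y; rewrite arc_coord.
  have dl : is_derive x 1 (fun x : R => a + b * x) b.
    have := is_deriveD (is_derive_cst a x 1) (is_derive_mull b x).
    by move=> /(is_derive_eq); apply; rewrite add0r.
  have dc := @is_derive1_comp _ (@cos R) _ x _ _ (is_derive_cos _) dl.
  have ds := @is_derive1_comp _ (@sin R) _ x _ _ (is_derive_sin _) dl.
  have h1 := is_deriveM dc (is_derive_cst (X ord0 i) x 1).
  have h2 := is_deriveM ds (is_derive_cst (Y ord0 i) x 1).
  have h3 := is_deriveD (is_deriveD (is_derive_cst (Z ord0 i) x 1) h1) h2.
  apply: (is_derive_eq h3); rewrite arc_coord !mxE /GRing.scale/=; ring.
have dA : derivable (arc Z X Y a b) x 1.
  by apply/derivable_mxP => i j; rewrite (ord1 i); have [] := h j.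
split=> //; rewrite derive1E derive_mx//; apply/rowP => j; rewrite mxE.
by have [_ <-] := h j; rewrite (ord1 0).
Qed.

Lemma arc_smooth Z X Y a b : smooth (arc Z X Y a b).
Proof.
have H n : exists Z' X' Y', derive1n n (arc Z X Y a b) = arc Z' X' Y' a b.
  elim: n => [|n [Z' [X' [Y' IH]]]]; first by exists Z, X, Y.
  exists 0, (b *: Y'), (- b *: X'); rewrite derive1nS IH.
  by apply/funext => x; have [_ ->] := arc_is_derive Z' X' Y' a b x.
move=> n x; have [Z' [X' [Y' ->]]] := H n.
by have [] := arc_is_derive Z' X' Y' a b x.
Qed.

Lemma arc_continuous Z X Y a b : continuous (arc Z X Y a b).
Proof.
move=> x; apply/differentiable_continuous/derivable1_diffP.
by have [] := arc_is_derive Z X Y a b x.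
Qed.

Lemma arc_coord_continuous Z X Y a b i : continuous (fun x => arc Z X Y a b x ord0 i).
Proof.
move=> x; apply/differentiable_continuous/derivable1_diffP.
by have [/derivable_mxP h _] := arc_is_derive Z X Y a b x; exact: h.
Qed.

Lemma arc_speed Z X Y a b (r : R) x : nsq X = r ^+ 2 -> nsq Y = r ^+ 2 -> dot X Y = 0 -> 0 <= r ->
  enorm (derive1 (arc Z X Y a b) x) = `|b| * r.
Proof.
move=> nX nY XY r0; have [_ ->] := arc_is_derive Z X Y a b x.
apply/eqP; rewrite -(@eqrXn2 _ 2) ?enorm_ge0 ?mulr_ge0// enorm_sqr; apply/eqP.
have -> : arc 0 (b *: Y) (- b *: X) a b x = (- b * sin (a + b * x)) *: X + (b * cos (a + b * x)) *: Y.
  by rewrite /arc add0r !scalerA addrC; congr (_ *: _ + _ *: _); ring.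
rewrite nsq_comb XY nX nY mulr0 mulr0 addr0 -mulrDl !exprMn sqrrN -mulrDr addrC cos2Dsin2 mulr1.
by rewrite real_normK ?num_real.
Qed.

Lemma arc_affine Z X Y a b (K i : R) x : arc Z X Y a b (K * x - i) = arc Z X Y (a - b * i) (b * K) x.
Proof. by rewrite /arc (_ : a + b * (K * x - i) = a - b * i + b * K * x)//; ring. Qed.

(** Half-open intervals let consecutive pieces be added as disjoint sets, and equality is asked in
    the interior only, since the derivative of the curve is arbitrary at the break points. *)
Lemma piece_integral (h g : R -> R) a b : a < b -> continuous g ->
  (forall x, a < x < b -> h x = g x) ->
  leb.-integrable `[a, b[ (EFin \o h) /\ \int[leb]_(x in `[a, b[) h x = intg a b g.
Proof.
move=> ab cg hg.
have hg' : {in [set` `]a, b[], (EFin \o g) =1 (EFin \o h)}.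
  by move=> x; rewrite inE /= in_itv/= => /hg ->.
have moo : measurable (`]a, b[ : set (measurableTypeR R)) by exact: measurable_itv.
have ig : leb.-integrable `]a, b[ (EFin \o g).
  apply: (@integrableS _ _ _ leb `[a, b]) => //; first exact: subset_itv_oo_cc.
  exact: continuous_integrable_itv.
have ih : leb.-integrable `]a, b[ (EFin \o h) by apply: (eq_integrable moo) ig.
have [mh fh] := integrableP _ _ _ ih.
have mh' : measurable_fun `[a, b[ (EFin \o h) by exact/emeasurable_fun_itv_obnd_cbndP.
split.
  apply/integrableP; split => //.
  rewrite integral_itv_bndoo//.
  exact: measurableT_comp.
rewrite /Rintegral; congr fine.
rewrite integral_itv_bndoo// [RHS]integral_itv_bndoo; last by case/integrableP: ig.
by apply: eq_integral => x xab; have /= -> := hg' x xab.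
Qed.

Section concatenation.
Variables (K : nat) (Z X Y : nat -> 'rV[R]_d.+1) (a b r : nat -> R).
Hypothesis K0 : (0 < K)%N.
Local Notation c i := (arc (Z i) (X i) (Y i) (a i) (b i)).
Local Notation KR := (K%:R : R).
Hypothesis c_sphere : forall i x, nsq (c i x) = 1.
Hypothesis c_glue : forall i, c i 1 = c i.+1 0.
Hypothesis c_close : c K 0 = c 0%N 0.
Hypothesis c_speed : forall i, [/\ nsq (X i) = r i ^+ 2, nsq (Y i) = r i ^+ 2, dot (X i) (Y i) = 0 & 0 <= r i].
(** For i = j this says that a piece does not meet itself; for distinct i and j, that the two pieces
    meet at no more than one parameter of the first, and by exchanging them, at no more than one of
    the second. *)
Hypothesis c_cross : forall i j x y x' y', (i < K)%N -> (j < K)%N ->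
  0 <= x < 1 -> 0 <= y < 1 -> 0 <= x' < 1 -> 0 <= y' < 1 ->
  c i x = c j y -> c i x' = c j y' -> if i == j then x = y else x = x'.

(** At s = 1 the index is K, so the value is the start of piece K; [c_close] identifies it with the
    start of piece 0. *)
Definition concat (s : R) : 'rV[R]_d.+1 :=
  c (Num.truncn (KR * s)) (KR * s - (Num.truncn (KR * s))%:R).

Let KR0 : 0 < KR. Proof. by rewrite ltr0n. Qed.

Lemma concat_piece i s : i%:R <= KR * s <= i.+1%:R -> concat s = c i (KR * s - i%:R).
Proof.
move=> /andP[si]; rewrite le_eqVlt => /predU1P[e|si1]; rewrite /concat.
  by rewrite e natrK subrr -c_glue -natr1 addrAC subrr add0r.
have s0 : 0 <= KR * s by apply: le_trans si; exact: ler0n.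
by have /eqP -> : Num.truncn (KR * s) == i by rewrite truncn_eq// si si1.
Qed.

Lemma concat_sphere s : sphere R d (concat s).
Proof. by apply/sphereE; exact: c_sphere. Qed.

Lemma concat_closed : concat 0 = concat 1.
Proof. by rewrite /concat mulr0 mulr1 truncn0 natrK !subrr c_close. Qed.

Lemma concat_piecewise_smooth : piecewise_smooth concat.
Proof.
exists K, (fun i => i%:R / KR); split; first by rewrite mul0r.
  by rewrite divff// gt_eqF.
move=> i iK; split; first by rewrite ltr_pM2r ?invr_gt0// ltr_nat.
exists (fun x => c i (KR * x - i%:R)).
  rewrite (_ : (fun x => _) = arc (Z i) (X i) (Y i) (a i - b i * i%:R) (b i * KR)).
    exact: arc_smooth.
  by apply/funext => x; rewrite arc_affine.
move=> x; rewrite ler_pdivrMr// ler_pdivlMr// => xi.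
by apply: concat_piece; rewrite mulrC.
Qed.

Lemma concat_continuous : {within `[0, 1], continuous concat}.
Proof.
have H j : {within `[0, j%:R / KR], continuous concat}.
  elim: j => [|j IH]; first by rewrite mul0r set_itv1; exact: continuous_subspace1.
  rewrite (_ : `[0, j.+1%:R / KR]%classic = `[0, j%:R / KR] `|` `[j%:R / KR, j.+1%:R / KR]).
    apply: withinU_continuous => //; [exact: interval_closed|exact: interval_closed|].
    apply: (@subspace_eq_continuous _ _ _ (fun x => c j (KR * x - j%:R))).
      move=> x; rewrite inE /= in_itv/= ler_pdivrMr// ler_pdivlMr// => xi.
      by apply/esym/concat_piece; rewrite mulrC.
    apply: continuous_subspaceT.
    rewrite (_ : (fun x => _) = arc (Z j) (X j) (Y j) (a j - b j * j%:R) (b j * KR)).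
      exact: arc_continuous.
    by apply/funext => x; rewrite arc_affine.
  have j1 : j%:R / KR <= j.+1%:R / KR by rewrite ler_pM2r ?invr_gt0// ler_nat.
  have j0 : 0 <= j%:R / KR by rewrite divr_ge0.
  apply/seteqP; split => x /=; rewrite !in_itv/=.
    by move=> /andP[x0 x1]; case: (leP x (j%:R / KR)) => xj; [left; rewrite x0|right; rewrite ltW].
  by move=> [|] /andP[x0 x1]; rewrite ?x0 ?x1 ?(le_trans x1 j1)// (le_trans j0 x0).
by have := H K; rewrite divff// gt_eqF.
Qed.

(** Each pair of piece indices contributes at most one self-intersection, by [c_cross] used in both
    orders; on a single piece there is none. *)
Lemma concat_self_intersections : finite_set (self_intersections concat).
Proof.
pose ix s := Num.truncn (KR * s); pose fr s := KR * s - (ix s)%:R.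
have ixK s : 0 <= s -> s < 1 -> (ix s < K)%N /\ 0 <= fr s < 1.
  move=> s0 s1; have Ks : 0 <= KR * s by rewrite mulr_ge0// ltW.
  have /andP[t1 t2] := truncn_itv Ks; split.
    by rewrite /ix truncn_lt_nat// gtr_pMr.
  by rewrite /fr subr_ge0 t1/= ltrBlDl natr1.
have fr_inj s s' : ix s = ix s' -> fr s = fr s' -> s = s'.
  rewrite /fr => -> /addIr; apply: mulfI; by rewrite gt_eqF.
pose S ij := [set st | self_intersections concat st /\ (ix st.1, ix st.2) = ij].
have -> : self_intersections concat =
    \bigcup_(i in `I_K) \bigcup_(j in `I_K) S (i, j).
  apply/seteqP; split => [[s t] h|st [i _ [j _ [h _]]]//].
  have [/= s0 st t1 _] := h.
  have [iK _] := ixK s s0 (lt_trans st t1).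
  have [jK _] := ixK t (le_trans s0 (ltW st)) t1.
  by exists (ix s) => //; exists (ix t).
apply: bigcup_finite => // i iK; apply: bigcup_finite => // j jK.
have sub st st' : S (i, j) st -> S (i, j) st' -> st = st'.
  case: st st' => [s t] [s' t'] [/= [/= s0 st t1 e] [is_ jt]] [/= [/= s0' st' t1' e'] [is_' jt']].
  have [_ f1] := ixK s s0 (lt_trans st t1).
  have [_ f2] := ixK t (le_trans s0 (ltW st)) t1.
  have [_ f3] := ixK s' s0' (lt_trans st' t1').
  have [_ f4] := ixK t' (le_trans s0' (ltW st')) t1'.
  have g1 : c i (fr s) = c j (fr t) by rewrite -is_ -jt.
  have g2 : c i (fr s') = c j (fr t') by rewrite -is_' -jt'.
  have := c_cross iK jK f1 f2 f3 f4 g1 g2.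
  have := c_cross jK iK f2 f1 f4 f3 (esym g1) (esym g2).
  rewrite eq_sym; case: eqP => [ij _ fe|_ e1 e2].
    have : s = t by apply: fr_inj => //; rewrite is_ jt.
    by move=> h; move: st; rewrite h ltxx.
  congr pair; apply: fr_inj => //; by rewrite ?is_ ?is_' ?jt ?jt'.
have [[st Sst]|no] := pselect (exists st, S (i, j) st).
  apply: (@sub_finite_set _ _ [set st]); last exact: finite_set1.
  by move=> st' Sst'; rewrite /=; exact: sub.
apply: (@sub_finite_set _ _ set0) => // st Sst; by case: no; exists st.
Qed.

Lemma concat_curve : sphere_curve concat.
Proof.
split.
- by move=> s _; exact: concat_sphere.
- exact: concat_continuous.
- exact: concat_piecewise_smooth.
- exact: concat_closed.
- exact: concat_self_intersections.
Qed.

Lemma concat_speed i s : i%:R < KR * s < i.+1%:R ->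
  enorm (derive1 concat s) = KR * (`|b i| * r i).
Proof.
move=> /andP[s1 s2].
have e : \forall x \near s, arc (Z i) (X i) (Y i) (a i - b i * i%:R) (b i * KR) x = concat x.
  have sI : s \in `]i%:R / KR, i.+1%:R / KR[.
    by rewrite in_itv/= ltr_pdivrMr// ltr_pdivlMr// mulrC s1 s2.
  apply: filterS (near_in_itvoo sI) => x; rewrite in_itv/= ltr_pdivrMr// ltr_pdivlMr// => /andP[x1 x2].
  by rewrite (@concat_piece i) ?arc_affine// mulrC !ltW.
have [nX nY XY r0] := c_speed i.
rewrite derive1E -(near_eq_derive _ e) -derive1E (arc_speed _ _ _ _ nX nY XY r0).
by rewrite normrM (gtr0_norm KR0); ring.
Qed.

Lemma concat_int (f : 'rV[R]_d.+1 -> R) : (forall i, continuous (fun x => f (c i x))) ->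
  curve_int concat f = \sum_(i < K) `|b i| * r i * intg 0 1 (fun x => f (c i x)).
Proof.
move=> cf; pose h s := f (concat s) * enorm (derive1 concat s).
have P i : leb.-integrable `[i%:R / KR, i.+1%:R / KR[ (EFin \o h) /\
    \int[leb]_(x in `[i%:R / KR, i.+1%:R / KR[) h x = `|b i| * r i * intg 0 1 (fun x => f (c i x)).
  have lt1 : i%:R / KR < i.+1%:R / KR by rewrite ltr_pM2r ?invr_gt0// ltr_nat.
  have cg0 : continuous (fun x => f (c i (KR * x + - i%:R))).
    move=> x; apply: (@continuous_comp _ _ _ (fun x => KR * x + - i%:R) (fun x => f (c i x))).
      by apply: cvgD; [apply: cvgM; [exact: cvg_cst|exact: cvg_id]|exact: cvg_cst].
    exact: cf.
  have cg : continuous (fun x => (KR * (`|b i| * r i)) * f (c i (KR * x + - i%:R))).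
    by move=> x; apply: cvgM; [exact: cvg_cst|exact: cg0].
  have [|ih ->] := piece_integral lt1 cg (h := h).
    move=> x; rewrite ltr_pdivrMr// ltr_pdivlMr// mulrC => /[dup] xi /andP[x1 x2].
    by rewrite /h (concat_speed xi) (@concat_piece i) ?(ltW x1) ?(ltW x2)// mulrC.
  split=> //; rewrite intgZ//.
  have := intg_affine (- i%:R) (cf i) (ltW lt1) KR0.
  have kk (z : R) : KR * (z / KR) = z by rewrite mulrC divfK// gt_eqF.
  rewrite !kk subrr -natr1 addrAC subrr add0r => <-.
  by set J := Rintegral _ _ _; ring.
have Q j : leb.-integrable `[0, j%:R / KR[ (EFin \o h) /\
    \int[leb]_(x in `[0, j%:R / KR[) h x = \sum_(i < j) `|b i| * r i * intg 0 1 (fun x => f (c i x)).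
  elim: j => [|j [IH1 IH2]].
    by rewrite mul0r set_itvco0 big_ord0 Rintegral_set0; split=> //; exact: integrable_set0.
  have [P1 P2] := P j.
  have j1 : j%:R / KR <= j.+1%:R / KR by rewrite ler_pM2r ?invr_gt0// ler_nat.
  have j0 : 0 <= j%:R / KR by rewrite divr_ge0.
  have U : `[0, j.+1%:R / KR[%classic = `[0, j%:R / KR[ `|` `[j%:R / KR, j.+1%:R / KR[.
    by rewrite -itv_bndbnd_setU// bnd_simp.
  have disj : [disjoint `[0, j%:R / KR[ & `[j%:R / KR, j.+1%:R / KR[]%classic.
    apply/disj_setPS => x /=; rewrite !in_itv/= => -[/andP[_ x1] /andP[x2 _]].
    by move: (lt_le_trans x1 x2); rewrite ltxx.
  have iU : leb.-integrable (`[0, j%:R / KR[ `|` `[j%:R / KR, j.+1%:R / KR[) (EFin \o h).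
      have [m1 f1] := integrableP _ _ _ IH1; have [m2 f2] := integrableP _ _ _ P1.
    apply/integrableP; split; first exact/measurable_funU.
    rewrite ge0_integral_setU//; first exact: lte_add_pinfty.
    by apply: measurableT_comp => //; exact/measurable_funU.
  rewrite U; split=> //.
  rewrite Rintegral_setU//.
  by rewrite IH2 P2 big_ord_recr.
have [Q1 Q2] := Q K; rewrite divff ?gt_eqF// in Q1 Q2.
by rewrite -Q2 Rintegral_itv_bndo_bndc.
Qed.

End concatenation.
End arcs.

(** * Great arcs joining the circles *)

Section slerp.
Context {R : realType}.
Local Notation leb := (@lebesgue_measure R).
Local Notation intg a b F := (\int[leb]_(x in `[a, b]) F x).

Lemma nsqD n (x y : 'rV[R]_n) : nsq (x + y) = nsq x + 2 * dot x y + nsq y.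
Proof. by have := nsq_comb 1 1 x y; rewrite !scale1r !expr1n !mul1r. Qed.

Lemma nsqB n (x y : 'rV[R]_n) : nsq (x - y) = nsq x - 2 * dot x y + nsq y.
Proof.
have := nsq_comb 1 (-1) x y; rewrite scale1r scaleN1r => ->.
by rewrite sqrrN !expr1n !mul1r; ring.
Qed.

Lemma dotC n (x y : 'rV[R]_n) : dot x y = dot y x.
Proof. by apply: eq_bigr => i _; rewrite mulrC. Qed.

Lemma dot_comb n s t (x y z : 'rV[R]_n) : dot z (s *: x + t *: y) = s * dot z x + t * dot z y.
Proof.
rewrite /dot !mulr_sumr -big_split; apply: eq_bigr => i _.
by rewrite /= !mxE; ring.
Qed.

Lemma dotxx n (x : 'rV[R]_n) : dot x x = nsq x.
Proof. by apply: eq_bigr => i _; rewrite expr2. Qed.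

Lemma dot_circ m (p q : 'rV[R]_m.+1) th : dot (circ p th) (circ q th) = dot p q.
Proof.
have := nsqD (circ p th) (circ q th); rewrite -circD !nsq_circ nsqD => h.
lra.
Qed.

(** A point of a circle determines its profile: the first m coordinates are copied, and the radius
    is the norm of the last two. Distinct circles are therefore disjoint. *)
Lemma circ_inj m (p q : 'rV[R]_m.+1) th ph : 0 < lastc p -> 0 < lastc q ->
  circ p th = circ q ph -> [/\ p = q, cos th = cos ph & sin th = sin ph].
Proof.
move=> p0 q0 e.
have h i : circ p th ord0 i = circ q ph ord0 i by rewrite e.
have low (i : 'I_m.+1) : (i < m)%N -> p ord0 i = q ord0 i.
  move=> im; have := h (widen_ord (leqnSn m.+1) i); rewrite !circE /= im.
  by rewrite inord_val.
have hc : lastc p * cos th = lastc q * cos ph.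
  by have := h (inord m); rewrite !circE inordK ?leqnSn// ltnn eqxx.
have hs : lastc p * sin th = lastc q * sin ph.
  have := h ord_max; rewrite !circE /= ltnNge leqnSn/= gtn_eqF//.
have pq : lastc p = lastc q.
  apply/eqP; rewrite -(@eqrXn2 _ 2) ?ltW//; apply/eqP.
  rewrite -[LHS]mulr1 -(cos2Dsin2 th) -[RHS]mulr1 -(cos2Dsin2 ph) !mulrDr -!exprMn.
  by rewrite hc hs.
rewrite pq in hc hs; have q1 : lastc q != 0 by rewrite gt_eqF.
split; [|exact: (mulfI q1)|exact: (mulfI q1)].
apply/rowP => i; have [im|] := ltnP i m; first exact: low.
move=> mi; suff -> : i = ord_max by [].
by apply: ord_inj; apply/eqP; rewrite eqn_leq mi -ltnS ltn_ord.
Qed.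

Lemma cos_eq1 (x : R) : `|x| < 2 * pi -> cos x = 1 -> x = 0.
Proof.
wlog x0 : x / 0 <= x => [H xpi cx|xpi cx].
  have [/H|x0] := leP 0 x; first exact.
  suff : - x = 0 by move/eqP; rewrite oppr_eq0 => /eqP.
  by apply: H; rewrite ?normrN ?cosN// oppr_ge0 ltW.
apply/eqP; rewrite eq_le x0 andbT leNgt; apply/negP => x1.
have s0 : 0 < sin (x / 2).
  by apply: sin_gt0_pi; move: xpi; rewrite ger0_norm// => xpi; lra.
have : cos x = 1 - 2 * sin (x / 2) ^+ 2.
  have {1}-> : x = x / 2 + x / 2 by field.
  rewrite cosD -!expr2; have := cos2Dsin2 (x / 2); lra.
rewrite cx; have : 0 < sin (x / 2) ^+ 2 by exact: exprn_gt0.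
lra.
Qed.

Lemma cos_sin_inj (x y : R) : `|x - y| < 2 * pi -> cos x = cos y -> sin x = sin y -> x = y.
Proof.
move=> xy c s; apply/eqP; rewrite -subr_eq0; apply/eqP; apply: cos_eq1 => //.
by rewrite cosB c s -!expr2 cos2Dsin2.
Qed.

Section angle.
Variable m : nat.
Implicit Types p q : 'rV[R]_m.+1.

Definition ang p q : R := acos (dot p q).
(** Gram-Schmidt: the unit tangent at p pointing towards q. *)
Definition perp p q : 'rV[R]_m.+1 := (sin (ang p q))^-1 *: (q - dot p q *: p).
Definition slerp p q x : 'rV[R]_m.+1 := cos (ang p q * x) *: p + sin (ang p q * x) *: perp p q.

Variables p q : 'rV[R]_m.+1.
Hypotheses (gp : profile p) (gq : profile q) (pq : p <> q).

(** The lower bound is strict because two profiles with positive last coordinates cannot be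
    antipodal. *)
Lemma dot_bounds : -1 < dot p q < 1.
Proof.
have [p1 p0] := gp; have [q1 q0] := gq; apply/andP; split.
  have : 0 < nsq (p + q).
    apply: (@lt_le_trans _ _ (lastc (p + q) ^+ 2)).
      by rewrite exprn_gt0// /lastc mxE addr_gt0.
    by rewrite /nsq (bigD1 ord_max)//= lerDl sumr_ge0// => j _; exact: sqr_ge0.
  by rewrite nsqD p1 q1; lra.
have : 0 < nsq (p - q).
  by rewrite ltNge nsq_le0 subr_eq0; apply/eqP.
by rewrite nsqB p1 q1; lra.
Qed.

Lemma cos_ang : cos (ang p q) = dot p q.
Proof. by have := dot_bounds => ?; rewrite /ang acosK// in_itv/= !ltW//; lra. Qed.

Lemma ang_bounds : 0 < ang p q < pi.
Proof.
by have /andP[h1 h2] := dot_bounds; rewrite /ang acos_gt0 ?acos_ltpi ?h1 ?h2 ?ltW.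
Qed.

Lemma sin_ang_gt0 : 0 < sin (ang p q).
Proof. exact: sin_gt0_pi ang_bounds. Qed.

Lemma dot_perp : dot p (perp p q) = 0.
Proof.
have [p1 _] := gp; have -> : perp p q = (sin (ang p q))^-1 *: q + (- (sin (ang p q))^-1 * dot p q) *: p.
  by rewrite /perp scalerBr mulNr scaleNr scalerA.
by rewrite dot_comb dotxx p1; ring.
Qed.

Lemma nsq_perp : nsq (perp p q) = 1.
Proof.
have [p1 _] := gp; have [q1 _] := gq; have s0 := sin_ang_gt0.
have -> : perp p q = (sin (ang p q))^-1 *: q + (- (sin (ang p q))^-1 * dot p q) *: p.
  by rewrite /perp scalerBr mulNr scaleNr scalerA.
rewrite nsq_comb p1 q1 (dotC q p) -cos_ang; have := cos2Dsin2 (ang p q) => e.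
have e2 : cos (ang p q) ^+ 2 = 1 - sin (ang p q) ^+ 2 by lra.
transitivity ((sin (ang p q))^-2 * (1 - cos (ang p q) ^+ 2)); first by field; lra.
by rewrite e2; field; lra.
Qed.

Lemma slerp0 : slerp p q 0 = p.
Proof. by rewrite /slerp mulr0 cos0 sin0 scale1r scale0r addr0. Qed.

Lemma slerp1 : slerp p q 1 = q.
Proof.
have s0 := sin_ang_gt0.
by rewrite /slerp mulr1 cos_ang /perp scalerA mulfV ?gt_eqF// scale1r addrC subrK.
Qed.

Lemma nsq_slerp x : nsq (slerp p q x) = 1.
Proof. by have [p1 _] := gp; rewrite nsq_comb p1 nsq_perp dot_perp !mulr1 !mulr0 addr0 cos2Dsin2. Qed.

(** The component along p is [cos (ang p q * x)], injective since the angle is below pi. *)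
Lemma slerp_inj x y : 0 <= x < 1 -> 0 <= y < 1 -> slerp p q x = slerp p q y -> x = y.
Proof.
move=> /andP[x0 x1] /andP[y0 y1] e; have /andP[a0 api] := ang_bounds.
have [p1 _] := gp.
have : dot p (slerp p q x) = dot p (slerp p q y) by rewrite e.
rewrite !dot_comb dot_perp dotxx p1 !mulr0 !addr0 !mulr1 => /cos_inj h.
have itv z : 0 <= z -> z < 1 -> ang p q * z \in `[0, pi].
  move=> z0 z1; rewrite in_itv/= mulr_ge0 ?(ltW a0)//=.
  by apply: le_trans (ltW api); rewrite ler_piMr ?ltW.
have a1 : ang p q != 0 by rewrite gt_eqF.
by apply: (mulfI a1); apply: h; exact: itv.
Qed.

(** Up to the factor [sin (ang p q)], the arc is a combination of p and q with coefficients sin(ang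
    (1 - x)) > 0 and sin(ang x) >= 0. Keeping the radius positive makes [circ_inj] available for the
    connectors too. *)
Lemma lastc_slerp x : 0 <= x < 1 -> 0 < lastc (slerp p q x).
Proof.
move=> /andP[x0 x1]; have /andP[a0 api] := ang_bounds; have s0 := sin_ang_gt0.
have [_ p0] := gp; have [_ q0] := gq.
have : 0 < sin (ang p q) * lastc (slerp p q x); last by rewrite pmulr_rgt0.
have -> : sin (ang p q) * lastc (slerp p q x) =
    sin (ang p q - ang p q * x) * lastc p + sin (ang p q * x) * lastc q.
  rewrite sinB cos_ang /lastc /slerp /perp !mxE; field; lra.
have ax : 0 <= ang p q * x by rewrite mulr_ge0// ltW.
have ax1 : ang p q * x < ang p q by rewrite gtr_pMr.
rewrite ltr_wpDr//.
  by apply: mulr_ge0; [apply: sin_ge0_pi; rewrite ax; lra|exact: ltW].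
by rewrite mulr_gt0// sin_gt0_pi//; lra.
Qed.

(* [|p - q| = 2 sin (ang / 2)] *)
Lemma ang_le : ang p q <= 2 * enorm (p - q).
Proof.
have [p1 _] := gp; have [q1 _] := gq; have /andP[a0 api] := ang_bounds.
have h : ang p q / 2 / 2 <= sin (ang p q / 2) by apply: half_le_sin; lra.
have -> : enorm (p - q) = 2 * sin (ang p q / 2); last by lra.
have s0 : 0 <= sin (ang p q / 2) by lra.
apply/eqP; rewrite -(@eqrXn2 _ 2) ?enorm_ge0 ?mulr_ge0// enorm_sqr nsqB p1 q1 -cos_ang.
have {1}-> : ang p q = ang p q / 2 + ang p q / 2 by field.
have e := cos2Dsin2 (ang p q / 2).
rewrite cosD -!expr2 exprMn; apply/eqP; lra.
Qed.

End angle.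

End slerp.

(** * The closed curve through all circles *)

Section closed_curve.
Context {R : realType} (m : nat).
Local Notation leb := (@lebesgue_measure R).
Local Notation intg a b F := (\int[leb]_(x in `[a, b]) F x).
Implicit Types p q : 'rV[R]_m.+1.

(** Together with [axis1] and [axis2]: the centre and the two perpendicular radii that present the
    circle of profile p as an [arc]. *)
Definition flat p : 'rV[R]_m.+2 := \row_i (if (i < m)%N then p ord0 (inord i) else 0).
Definition axis1 p : 'rV[R]_m.+2 := \row_i (if i == m :> nat then lastc p else 0).
Definition axis2 p : 'rV[R]_m.+2 := \row_i (if i == m.+1 :> nat then lastc p else 0).

Lemma circ_arc p a b x : circ p (a + b * x) = arc (flat p) (axis1 p) (axis2 p) a b x.
Proof.
apply/rowP => i; rewrite circE arc_coord !mxE.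
have [im|mi] := ltnP i m.
  by rewrite !ltn_eqF ?mulr0 ?addr0// ltnW.
case: eqP => [->|im]; first by rewrite ltn_eqF// mulr0 addr0 add0r mulrC.
have -> : i == m.+1 :> nat.
  by rewrite eqn_leq -ltnS ltn_ord/= ltn_neqAle eq_sym mi andbT; apply/eqP.
by rewrite mulr0 !add0r mulrC.
Qed.

Lemma nsq_axis1 p : nsq (axis1 p) = lastc p ^+ 2.
Proof.
rewrite /nsq !big_ord_recr/= !mxE/= eqxx gtn_eqF// expr0n addr0 big1 ?add0r// => i _.
by rewrite mxE /= ltn_eqF ?expr0n.
Qed.

Lemma nsq_axis2 p : nsq (axis2 p) = lastc p ^+ 2.
Proof.
rewrite /nsq !big_ord_recr/= !mxE/= eqxx ltn_eqF// expr0n addr0 big1 ?add0r// => i _.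
by rewrite mxE /= ltn_eqF ?expr0n// ltnS ltnW.
Qed.

Lemma dot_axes p : dot (axis1 p) (axis2 p) = 0.
Proof.
rewrite /dot big1// => i _; rewrite !mxE; case: eqP => [->|_]; last by rewrite mul0r.
by rewrite ltn_eqF ?mulr0.
Qed.

(** [circ] is linear in the profile, so a great arc of profiles at a fixed angle is a great arc of
    the sphere. *)
Lemma circ_slerp_arc p q th x :
  circ (slerp p q x) th = arc 0 (circ p th) (circ (perp p q) th) 0 (ang p q) x.
Proof. by rewrite /slerp circD !circZ /arc !add0r. Qed.

Lemma circ_periodic p th k : circ p (th + 2 * pi * k%:R) = circ p th.
Proof.
apply/rowP => i; rewrite !circE.
have -> : 2 * pi * k%:R = pi *+ 2 *+ k :> R by rewrite mulr_natr mulr2n mulrDl mul1r.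
by rewrite (periodicn (@cosD2pi R)) (periodicn (@sinD2pi R)).
Qed.

Variable ps : seq 'rV[R]_m.+1.
Hypothesis psP : forall p, p \in ps -> profile p.
Hypothesis ps_uniq : uniq ps.
Hypothesis ps_size : (1 < size ps)%N.
Local Notation N := (size ps).
Local Notation NR := ((size ps)%:R : R).

Let N0 : (0 < N)%N. Proof. exact: ltnW. Qed.
Let NR0 : 0 < NR. Proof. by rewrite ltr0n. Qed.
Let NR1 : 2 <= NR. Proof. by rewrite ler_nat. Qed.
Let NRn0 : NR != 0. Proof. by rewrite gt_eqF. Qed.

(** Indices are cyclic, so that the last circle is joined to the first. *)
Definition prof k : 'rV[R]_m.+1 := nth 0 ps (k %% N).
(* Circle [k] is followed from the angle [turn k] to [turn k.+1], slightly less
   than a full turn.  The connectors then run at angles that are distinct modulo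
   [2 * pi], so that two pieces of the curve meet at most once, while after all
   circles the angle is back to 0. *)
Definition sweep : R := 2 * pi - 2 * pi / NR.
Definition turn k : R := k%:R * sweep.

Lemma prof_profile k : profile (prof k).
Proof. by apply: psP; rewrite mem_nth// ltn_mod. Qed.

Lemma prof_inj k l : (k < N)%N -> (l < N)%N -> prof k = prof l -> k = l.
Proof.
by move=> kN lN; rewrite /prof !modn_small// => /eqP; rewrite nth_uniq// => /eqP.
Qed.

Lemma prof_neq k : prof k <> prof k.+1.
Proof.
rewrite /prof => /eqP; rewrite nth_uniq ?ltn_mod// => /eqP e.
have : (k + 0 == k + 1 %[mod N])%N by rewrite addn0 addn1; apply/eqP.
by rewrite eqn_modDl mod0n modn_small.
Qed.

Lemma sweep_bounds : 0 < sweep < 2 * pi.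
Proof.
have p0 := pi_gt0 R; have h : 0 < 2 * pi / NR by rewrite divr_gt0 ?mulr_gt0.
have h2 : 2 * pi / NR <= pi by rewrite ler_pdivrMr// mulrC ler_wpM2l// ltW.
by rewrite /sweep; lra.
Qed.

(** Each sweep falls short of a full turn by 2 pi / N, so modulo 2 pi the angle [turn k] is - 2 pi k
    / N. *)
Lemma turnE k th : circ (prof k) (turn k + th) = circ (prof k) (th - 2 * pi * k%:R / NR).
Proof.
rewrite -(circ_periodic _ (th - _) k); congr circ; rewrite /turn /sweep;
  by field.
Qed.

Lemma cos_turn k : cos (turn k) = cos (2 * pi * k%:R / NR).
Proof.
rewrite -[RHS]cosN.
have -> : turn k = - (2 * pi * k%:R / NR) + pi *+ 2 *+ k.
  rewrite -mulr_natr -[pi *+ 2]mulr_natr /turn /sweep;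
  by field.
by rewrite (periodicn (@cosD2pi R)).
Qed.

Lemma sin_turn k : sin (turn k) = - sin (2 * pi * k%:R / NR).
Proof.
rewrite -sinN.
have -> : turn k = - (2 * pi * k%:R / NR) + pi *+ 2 *+ k.
  rewrite -mulr_natr -[pi *+ 2]mulr_natr /turn /sweep;
  by field.
by rewrite (periodicn (@sinD2pi R)).
Qed.

Lemma turn_inj k l : (k < N)%N -> (l < N)%N ->
  cos (turn k.+1) = cos (turn l.+1) -> sin (turn k.+1) = sin (turn l.+1) -> k = l.
Proof.
move=> kN lN; rewrite !cos_turn !sin_turn => c /oppr_inj s.
have p0 := pi_gt0 R.
have bnd (i j : nat) : (i < N)%N -> 2 * pi * i.+1%:R / NR - 2 * pi * j.+1%:R / NR < 2 * pi.
  move=> iN; have -> : 2 * pi * i.+1%:R / NR - 2 * pi * j.+1%:R / NR = 2 * pi * ((i.+1%:R - j.+1%:R) / NR).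
    by field.
  rewrite gtr_pMr ?mulr_gt0// ltr_pdivrMr// mul1r.
  have : i.+1%:R <= NR by rewrite ler_nat.
  have : 0 <= j%:R :> R by exact: ler0n.
  by rewrite -(natr1 j); lra.
have : 2 * pi * k.+1%:R / NR = 2 * pi * l.+1%:R / NR.
  by apply: cos_sin_inj => //; rewrite ltr_norml; have := bnd k l kN; have := bnd l k lN; lra.
move=> /(divIf (lt0r_neq0 NR0)) => /mulfI e; have : k.+1%:R = l.+1%:R :> R by apply: e; lra.
by move=> /eqP; rewrite eqr_nat eqSS => /eqP.
Qed.

(* Even pieces are circles, odd pieces are connectors. *)
Definition pZ i : 'rV[R]_m.+2 := if odd i then 0 else flat (prof i./2).
Definition pX i : 'rV[R]_m.+2 := if odd i then circ (prof i./2) (turn i./2.+1) else axis1 (prof i./2).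
Definition pY i : 'rV[R]_m.+2 :=
  if odd i then circ (perp (prof i./2) (prof i./2.+1)) (turn i./2.+1) else axis2 (prof i./2).
Definition pa i : R := if odd i then 0 else turn i./2.
Definition pb i : R := if odd i then ang (prof i./2) (prof i./2.+1) else sweep.
Definition pr i : R := if odd i then 1 else lastc (prof i./2).
Definition piece i x : 'rV[R]_m.+2 := arc (pZ i) (pX i) (pY i) (pa i) (pb i) x.

Lemma piece_even k x : piece k.*2 x = circ (prof k) (turn k + sweep * x).
Proof. by rewrite /piece /pZ /pX /pY /pa /pb odd_double/= doubleK -circ_arc. Qed.

Lemma piece_odd k x :
  piece k.*2.+1 x = circ (slerp (prof k) (prof k.+1) x) (turn k.+1).
Proof.
by rewrite /piece /pZ /pX /pY /pa /pb /= odd_double/= uphalf_double -circ_slerp_arc.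
Qed.

Lemma halfP (i : nat) : exists k, i = k.*2 \/ i = k.*2.+1.
Proof. by exists i./2; rewrite -{1 3}(odd_double_half i); case: (odd i); [right|left]. Qed.

Lemma piece_sphere i x : nsq (piece i x) = 1.
Proof.
have [k [->|->]] := halfP i; rewrite ?piece_even ?piece_odd nsq_circ.
  by have [] := prof_profile k.
by apply: nsq_slerp; [exact: prof_profile|exact: prof_profile|exact: prof_neq].
Qed.

Lemma piece_glue i : piece i 1 = piece i.+1 0.
Proof.
have [k [->|->]] := halfP i.
  rewrite piece_even piece_odd slerp0 mulr1 /turn -(natr1 k) mulrDl mul1r.
  by [].
rewrite -doubleS piece_even piece_odd slerp1 ?mulr0 ?addr0//;
  [exact: prof_profile|exact: prof_profile|exact: prof_neq].
Qed.

Lemma piece_close : piece N.*2 0 = piece 0 0.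
Proof.
rewrite piece_even (piece_even 0) !mulr0 turnE /prof modnn mod0n.
have -> : 0 - 2 * pi * NR / NR = - (2 * pi) :> R by field.
rewrite /turn mul0r addr0 -(circ_periodic _ (- (2 * pi)) 1).
by congr circ; ring.
Qed.

Lemma piece_speed i : [/\ nsq (pX i) = pr i ^+ 2, nsq (pY i) = pr i ^+ 2,
  dot (pX i) (pY i) = 0 & 0 <= pr i].
Proof.
rewrite /pX /pY /pr; case: ifP => _; last first.
  rewrite nsq_axis1 nsq_axis2 dot_axes; split=> //.
  by have [_ /ltW] := prof_profile i./2.
have g1 := prof_profile i./2; have g2 := prof_profile i./2.+1; have ne := @prof_neq i./2.
rewrite !nsq_circ dot_circ (@nsq_perp _ _ _ _ g1 g2 ne) (@dot_perp _ _ _ _ g1) expr1n; split=> //.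
by case: g1.
Qed.

(** Two circles are disjoint unless equal, and two connectors run at different angles unless equal.
    A connector meets a circle only at the fixed angle of the connector, which fixes the parameter
    on the circle, and only where its profile is that of the circle, which fixes the parameter on
    the connector. *)
Lemma piece_cross i j x y x' y' : (i < N.*2)%N -> (j < N.*2)%N ->
  0 <= x < 1 -> 0 <= y < 1 -> 0 <= x' < 1 -> 0 <= y' < 1 ->
  piece i x = piece j y -> piece i x' = piece j y' -> if i == j then x = y else x = x'.
Proof.
have /andP[w0 wpi] := sweep_bounds.
have lp k : 0 < lastc (prof k) by have [] := prof_profile k.
have ls k z : 0 <= z < 1 -> 0 < lastc (slerp (prof k) (prof k.+1) z).
  by apply: lastc_slerp; [exact: prof_profile|exact: prof_profile|exact: prof_neq].
have si k u v : 0 <= u < 1 -> 0 <= v < 1 ->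
    slerp (prof k) (prof k.+1) u = slerp (prof k) (prof k.+1) v -> u = v.
  by apply: slerp_inj; [exact: prof_profile|exact: prof_profile|exact: prof_neq].
have sw k u v : 0 <= u < 1 -> 0 <= v < 1 -> cos (turn k + sweep * u) = cos (turn k + sweep * v) ->
    sin (turn k + sweep * u) = sin (turn k + sweep * v) -> u = v.
  move=> /andP[u0 u1] /andP[v0 v1] c s.
  have : turn k + sweep * u = turn k + sweep * v.
    apply: cos_sin_inj => //.
    have -> : turn k + sweep * u - (turn k + sweep * v) = sweep * (u - v) by ring.
    rewrite normrM gtr0_norm//; apply: le_lt_trans wpi; rewrite ler_piMr ?(ltW w0)//.
    by rewrite ler_norml; lra.
  by move/addrI; apply: mulfI; rewrite gt_eqF.
move=> iN jN hx hy hx' hy'.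
have [k ik] := halfP i; have [l jl] := halfP j.
case: ik jl => ik [] jl; rewrite {}ik {}jl ?ltn_double ?ltn_Sdouble in iN jN *.
- rewrite !piece_even => /circ_inj[]// e c s _.
  have kl : k = l by exact: prof_inj.
  by rewrite kl eqxx; rewrite kl in c s; exact: sw c s.
- rewrite !piece_even !piece_odd => /circ_inj[]//; first exact: ls.
  move=> _ c s /circ_inj[]//; first exact: ls.
  move=> _ c' s'; rewrite ifF; last by apply/negP => /eqP/(congr1 odd); rewrite /= !odd_double.
  by apply: (sw k) => //; rewrite ?c ?c' ?s ?s'.
- rewrite !piece_even !piece_odd => /circ_inj[]//; first exact: ls.
  move=> e _ _ /circ_inj[]//; first exact: ls.
  move=> e' _ _; rewrite ifF; last by apply/negP => /eqP/(congr1 odd); rewrite /= !odd_double.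
  by apply: (si k) => //; rewrite e e'.
- rewrite !piece_odd => /circ_inj[]; [exact: ls|exact: ls|move=> e c s _].
  have kl : k = l by exact: turn_inj.
  by rewrite kl eqxx; rewrite kl in e; exact: si e.
Qed.

Definition tour := concat N.*2 pZ pX pY pa pb.

Lemma tour_curve : sphere_curve tour.
Proof.
apply: concat_curve.
- by rewrite double_gt0.
- exact: piece_sphere.
- exact: piece_glue.
- exact: piece_close.
- exact: piece_cross.
Qed.

Lemma sum_double n (F : nat -> R) : \sum_(i < n.*2) F i = \sum_(k < n) (F k.*2 + F k.*2.+1).
Proof.
by elim: n => [|n IH]; rewrite ?big_ord0// doubleS !big_ord_recr/= IH addrA.
Qed.

Lemma connl_sum p qs : connl (p :: qs) =
  \sum_(k < size qs) enorm (nth 0 (p :: qs) k - nth 0 (p :: qs) k.+1).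
Proof.
elim: qs p => [|q qs IH] p; first by rewrite big_ord0.
rewrite big_ord_recl; have := IH q; rewrite /= => ->; congr (_ + _).
Qed.

(** The 2 bounds the chord from the last profile back to the first. *)
Lemma sum_prof_le : \sum_(k < N) enorm (prof k - prof k.+1) <= connl ps + 2.
Proof.
have last2 k : enorm (prof k - prof k.+1) <= 2.
  by apply: enorm_subr_le2; [have [] := prof_profile k|have [] := prof_profile k.+1].
have [p [qs e]] : exists p qs, ps = p :: qs by case: (ps) N0 => // p qs _; exists p, qs.
have eN : N = (size qs).+1 by rewrite e.
have -> : \sum_(k < N) enorm (prof k - prof k.+1) = \sum_(k < (size qs).+1) enorm (prof k - prof k.+1).
  by rewrite -eN.
rewrite big_ord_recr/=; apply: lerD => //.
rewrite [in leRHS]e connl_sum le_eqVlt; apply/orP; left; apply/eqP.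
apply: eq_bigr => k _; rewrite /prof e !modn_small//= ltnS ?ltn_ord// ltnW// ltn_ord.
Qed.

(** By periodicity the sweep misses just an interval of angles of length 2 pi / N, on which the
    integrand is at most B. *)
Lemma circle_arc_int t (f : 'rV[R]_m.+2 -> R) B k : (k < N)%N -> plt t f ->
  (forall x, nsq x = 1 -> `|f x| <= B) ->
  `|sweep * intg 0 1 (fun x => f (piece k.*2 x)) - 2 * pi * circle_mean (prof k) f| <= B * (2 * pi / NR).
Proof.
move=> kN pf fB; have p0 := pi_gt0 R; have /andP[w0 wpi] := sweep_bounds.
pose g th := f (circ (prof k) th).
have cg : continuous g by exact: continuous_plt_circ pf.
have gB th : `|g th| <= B by apply: fB; rewrite nsq_circ; have [] := prof_profile k.
pose y := 2 * pi * k%:R / NR.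
have y0 : 0 <= y by rewrite /y divr_ge0// ?mulr_ge0// ltW.
(* Since k < N, the window from - y to [sweep - y] contains 0, so it can be cut there and its
   negative part moved by one period. *)
have yw : y <= sweep.
  have -> : sweep = 2 * pi * (NR - 1) / NR by rewrite /sweep; field.
  rewrite /y ler_pM2r ?invr_gt0// ler_pM2l ?mulr_gt0// lerBrDr natr1 ler_nat.
  by [].
have gp th : g (1 * th + 2 * pi) = g th.
  by rewrite /g mul1r -(circ_periodic _ th 1) mulr1.
have e1 : sweep * intg 0 1 (fun x => f (piece k.*2 x)) = intg (- y) (sweep - y) g.
  rewrite mulrC; have := @intg_affine R g 0 1 sweep (- y) cg ler01 w0.
  rewrite mulr0 mulr1 add0r => <-; congr (_ * _).
  by apply: eq_Rintegral => x _; rewrite piece_even turnE.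
have e2 : 2 * pi * circle_mean (prof k) f = intg 0 (2 * pi) g.
  by rewrite /circle_mean mulrA mulfV ?mul1r// mulf_neq0 ?pnatr_eq0// gt_eqF.
have e3 : intg (- y) 0 g = intg (2 * pi - y) (2 * pi) g.
  have := @intg_affine R g (- y) 0 1 (2 * pi) cg; rewrite oppr_le0 => /(_ y0 ltr01).
  rewrite mulr1 mulr0 add0r mul1r addrC => <-.
  by apply: eq_Rintegral => x _; rewrite gp.
rewrite e1 e2 -(@intg_cat _ g (- y) 0)//; [|by rewrite ?oppr_le0 ?subr_ge0..].
have c1 : 0 <= sweep - y by lra.
have c2 : sweep - y <= 2 * pi - y by lra.
have d : intg 0 (2 * pi) g = intg 0 (sweep - y) g + (intg (sweep - y) (2 * pi - y) g + intg (2 * pi - y) (2 * pi) g).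
  have c3 : 2 * pi - y <= 2 * pi by lra.
  by rewrite (intg_cat cg c2 c3) (intg_cat cg c1 (le_trans c2 c3)).
rewrite d.
rewrite e3; set u1 := Rintegral _ _ _; set u2 := Rintegral _ _ _; set u3 := Rintegral _ _ _.
have -> : u1 + u2 - (u2 + (u3 + u1)) = - u3 by ring.
rewrite normrN; apply: le_trans (intg_le cg c2 (fun th _ => gB th)) _.
by rewrite le_eqVlt; apply/orP; left; apply/eqP; rewrite /sweep; ring.
Qed.

(** The gaps left on the N circles, whose radii are at most 1, cost 2 pi B in all; the connectors
    are at most twice as long as the closed polygon of the profiles. *)
Lemma tour_int t (f : 'rV[R]_m.+2 -> R) B : plt t f ->
  (forall x, nsq x = 1 -> `|f x| <= B) ->
  `|curve_int tour f - 2 * pi * circle_sum ps f| <= (2 * pi + 2 * (connl ps + 2)) * B.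
Proof.
move=> pf fB; have p0 := pi_gt0 R; have /andP[w0 wpi] := sweep_bounds.
have B0 : 0 <= B by apply: le_trans (fB _ (piece_sphere 0 0)); exact: normr_ge0.
have cf i : continuous (fun x => f (piece i x)).
  by apply: (plt_continuous_path pf) => j; exact: arc_coord_continuous.
have N20 : (0 < N.*2)%N by rewrite double_gt0.
rewrite (concat_int N20 piece_glue piece_speed cf).
rewrite (sum_double N (fun i => `|pb i| * pr i * intg 0 1 (fun x => f (piece i x)))).
have -> : circle_sum ps f = \sum_(k < N) lastc (prof k) * circle_mean (prof k) f.
  rewrite /circle_sum (big_nth 0) big_mkord; apply: eq_bigr => k _.
  by rewrite /prof modn_small.
rewrite mulr_sumr -sumrB.
apply: (@le_trans _ _ (\sum_(k < N) (B * (2 * pi / NR) + 2 * enorm (prof k - prof k.+1) * B))); last first.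
  rewrite big_split/= sumr_const card_ord -mulr_suml -mulr_sumr [leRHS]mulrDl lerD//.
    by rewrite -mulr_natr le_eqVlt; apply/orP; left; apply/eqP; field.
  by rewrite ler_wpM2r// ler_wpM2l// sum_prof_le.
apply: le_trans (ler_norm_sum _ _ _) _; apply: ler_sum => k _.
have [k1 k0] := prof_profile k; have k2 := prof_profile k.+1; have kn := @prof_neq k.
have lc1 : lastc (prof k) <= 1.
  by apply: le_trans (ler_norm _) _; apply: coord_le; rewrite k1.
rewrite /pb /pr odd_double/= uphalf_double odd_double/= doubleK.
set I1 := Rintegral _ _ _; set I2 := Rintegral _ _ _.
have h1 := circle_arc_int (ltn_ord k) pf fB; rewrite -/I1 in h1.
have /andP[a0 _] := ang_bounds (prof_profile k) k2 kn.
have h2 : `|I2| <= B.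
  have := intg_le (cf k.*2.+1) ler01 (fun x _ => fB _ (piece_sphere k.*2.+1 x)).
  by rewrite subr0 mulr1.
rewrite (gtr0_norm w0) (gtr0_norm a0) mulr1.
have -> : sweep * lastc (prof k) * I1 + ang (prof k) (prof k.+1) * I2 -
    2 * pi * (lastc (prof k) * circle_mean (prof k) f) =
  lastc (prof k) * (sweep * I1 - 2 * pi * circle_mean (prof k) f) + ang (prof k) (prof k.+1) * I2 by ring.
apply: le_trans (ler_normD _ _) _; apply: lerD.
  rewrite normrM gtr0_norm//; apply: le_trans h1; rewrite ler_piMl//.
rewrite normrM gtr0_norm//; apply: ler_pM => //; first exact: ltW.
exact: ang_le.
Qed.

End closed_curve.

(** * Design curves *)

Section curve_family.
Context {R : realType}.

Lemma curve_family n : exists m M E T0 : R, [/\ 0 < m, 0 < E, 1 <= T0 &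
  forall T, T0 <= T -> exists gamma : R -> 'rV[R]_n.+3, [/\ sphere_curve gamma,
    m * T ^+ n.+1 <= curve_length gamma <= M * T ^+ n.+1 &
    forall t f B, t%:R <= T -> plt t.+1 f -> (forall x, nsq x = 1 -> `|f x| <= B) ->
      `|(curve_length gamma)^-1 * curve_int gamma f - sphere_int f| <= E / T * B]].
Proof.
have [kap [C [k0 C0 hd]]] := @designs_exist R n.
have p0 := pi_gt0 R.
pose K0 := 2 * pi * kap; have K00 : 0 < K0 by rewrite /K0 !mulr_gt0.
pose D := 2 * pi * C + 2 * pi + 2 * C + 4.
have piC : 0 < pi * C by exact: mulr_gt0.
have D0 : 0 < D by rewrite /D; lra.
(* The second summand guarantees at least two circles; the third makes the main term of the length
   at least twice its error. *)
pose T0 := 1 + (C + 2) / kap + 2 * D / K0.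
have q1 : 0 < (C + 2) / kap by rewrite divr_gt0//; lra.
have q2 : 0 < 2 * D / K0 by rewrite divr_gt0//; lra.
exists (K0 / 2), (2 * K0), (4 * D / K0), T0; split.
- by rewrite divr_gt0.
- by rewrite divr_gt0//; lra.
- by rewrite /T0; lra.
move=> T TT0; have T1 : 1 <= T by move: TT0; rewrite /T0; lra.
have Tpos : 0 < T by lra.
have Tn k : 1 <= T ^+ k by exact: exprn_ege1.
have kT : C + 2 <= kap * T.
  by rewrite mulrC -ler_pdivrMr//; move: TT0; rewrite /T0; lra.
have DT : 2 * D <= K0 * T.
  rewrite [leRHS]mulrC -ler_pdivrMr//; apply: le_trans TT0; rewrite /T0 lerDr.
  by rewrite addr_ge0// ltW.
have [ps [gp up cp hps]] := hd T T1.
have one_le (x : 'rV[R]_n.+3) : nsq x = 1 -> `|1 : R| <= 1 by rewrite normr1.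
(* The constant function 1 shows that the radii sum to at least [2 * T ^+ n], and each radius is at
   most 1. *)
have sz : (1 < size ps)%N.
  have t0 : 0%:R <= T by rewrite mulr0n ltW.
  have := hps 0 _ 1 t0 (plt_cst _ _ 1) one_le.
  rewrite sphere_int_cst !mulr1 ler_norml => /andP[h _].
  have h2 : circle_sum ps (fun=> 1) <= (size ps)%:R.
    rewrite /circle_sum -sum1_size natr_sum big_seq [leRHS]big_seq.
    apply: ler_sum => p /gp[pn _]; rewrite circle_mean_cst mulr1.
    by apply: le_trans (ler_norm _) _; apply: coord_le; rewrite pn.
  have h3 : 2 * T ^+ n <= kap * T ^+ n.+1 - C * T ^+ n.
    have : (C + 2) * T ^+ n <= kap * T * T ^+ n by rewrite ler_pM2r//; have := Tn n; lra.
    by rewrite exprS mulrA mulrDl; lra.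
  have : (2 : R) <= (size ps)%:R by have := Tn n; lra.
  by rewrite ler_nat.
have tc := tour_curve gp up sz.
have est t f B : t%:R <= T -> plt t.+1 f -> (forall x, nsq x = 1 -> `|f x| <= B) ->
    `|curve_int (tour ps) f - K0 * T ^+ n.+1 * sphere_int f| <= D * T ^+ n * B.
  move=> tT pf fB; have h1 := tour_int gp up sz pf fB; have h2 := hps t f B tT pf fB.
  have B0 : 0 <= B.
    by apply: le_trans (sphere_int_le (plt_nice pf) fB); exact: normr_ge0.
  have -> : curve_int (tour ps) f - K0 * T ^+ n.+1 * sphere_int f =
      (curve_int (tour ps) f - 2 * pi * circle_sum ps f) +
      2 * pi * (circle_sum ps f - kap * T ^+ n.+1 * sphere_int f) by rewrite /K0; ring.
  apply: le_trans (ler_normD _ _) _.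
  have h3 : `|2 * pi * (circle_sum ps f - kap * T ^+ n.+1 * sphere_int f)| <= 2 * pi * (C * T ^+ n * B).
    by rewrite normrM gtr0_norm ?mulr_gt0// ler_pM2l ?mulr_gt0.
  have h4 : (2 * pi + 2 * (connl ps + 2)) * B <= (2 * pi + 2 * C + 4) * T ^+ n * B.
    rewrite ler_wpM2r//.
    have : 2 * pi + 4 <= (2 * pi + 4) * T ^+ n by rewrite ler_peMr//; lra.
    have : 2 * (C * T ^+ n) = 2 * C * T ^+ n by rewrite mulrA.
    by rewrite !mulrDl; lra.
  have -> : D * T ^+ n * B = (2 * pi + 2 * C + 4) * T ^+ n * B + 2 * pi * (C * T ^+ n * B).
    by rewrite /D; ring.
  by apply: lerD h3; apply: le_trans h4.
have Tn0 : 0 < T ^+ n by have := Tn n; lra.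
have TS : T ^+ n.+1 = T * T ^+ n by exact: exprS.
have DK : 2 * (D * T ^+ n) <= K0 * T ^+ n.+1.
  by rewrite TS !mulrA ler_pM2r.
set L := curve_length (tour ps).
have hL : `|L - K0 * T ^+ n.+1| <= D * T ^+ n.
  have t0 : 0%:R <= T by rewrite mulr0n ltW.
  by have := est 0 _ 1 t0 (plt_cst _ _ 1) one_le; rewrite sphere_int_cst !mulr1.
have /andP[L1 L2] : K0 / 2 * T ^+ n.+1 <= L <= 2 * K0 * T ^+ n.+1.
  have K1 : 0 < K0 * T ^+ n.+1 by rewrite mulr_gt0// exprn_gt0.
  have e1 : K0 / 2 * T ^+ n.+1 = (K0 * T ^+ n.+1) / 2 by rewrite mulrAC.
  rewrite e1 -mulrA; move: hL; rewrite ler_norml => /andP[u v].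
  by apply/andP; split; lra.
have L0 : 0 < L.
  by apply: lt_le_trans L1; rewrite mulr_gt0 ?exprn_gt0// divr_gt0.
exists (tour ps); split=> //; first by rewrite L1 L2.
move=> t f B tT pf fB; rewrite -/L.
have LB : `|sphere_int f| <= B by exact: sphere_int_le (plt_nice pf) fB.
have B0 : 0 <= B by apply: le_trans LB.
have h := est t f B tT pf fB.
set I := curve_int _ f in h *; set S := sphere_int f in h LB *.
(* Both the integral and the length are compared with the same main term [K0 * T ^+ n.+1], so
   normalizing by the actual length only doubles the error. *)
have -> : L^-1 * I - S = L^-1 * ((I - K0 * T ^+ n.+1 * S) - (L - K0 * T ^+ n.+1) * S).
  by field; rewrite gt_eqF.
rewrite normrM gtr0_norm ?invr_gt0// mulrC ler_pdivrMr//.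
apply: (@le_trans _ _ (2 * D * T ^+ n * B)).
  apply: le_trans (ler_normB _ _) _.
  have -> : 2 * D * T ^+ n * B = D * T ^+ n * B + D * T ^+ n * B by ring.
  by apply: lerD => //; rewrite normrM ler_pM.
have -> : 2 * D * T ^+ n * B = 4 * D / K0 / T * B * (K0 / 2 * T ^+ n.+1).
  by rewrite TS; field; rewrite !gt_eqF.
by rewrite ler_wpM2l// mulr_ge0// !divr_ge0 ?mulr_ge0// ltW.
Qed.

Lemma sphere_sup_ge d t (f : 'rV[R]_d.+1 -> R) x : sphere_poly t f -> nsq x = 1 ->
  `|f x| <= sphere_sup f.
Proof.
move=> /sphere_poly_plt[F pF fF] x1; have [C C0 FC] := plt_bounded pF.
apply: ub_le_sup; last by exists x => //; exact/sphereE.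
by exists C => _ [y yS <-]; rewrite fF// FC//; move/sphereE: yS => ->.
Qed.

(** Passes from polynomial functions with an arbitrary bound B on the sphere to the supremum norm,
    replacing f by a polynomial function that agrees with it on the sphere. *)
Lemma design_of_family n t (gamma : R -> 'rV[R]_n.+3) (e : R) : 0 <= e ->
  sphere_curve gamma -> 0 < curve_length gamma ->
  (forall f B, plt t.+1 f -> (forall x, nsq x = 1 -> `|f x| <= B) ->
    `|(curve_length gamma)^-1 * curve_int gamma f - sphere_int f| <= e * B) ->
  approx_design_curve e t gamma.
Proof.
move=> e0 cg L0 h; split=> //; first by rewrite invr_gt0.
move=> f pf; have [F pF fF] := sphere_poly_plt pf.
have -> : curve_int gamma f = curve_int gamma F.
  apply: eq_Rintegral => s; rewrite inE /= in_itv/= => s01.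
  by rewrite fF//; have [+ _ _ _ _] := cg; exact.
have -> : sphere_int f = sphere_int F by apply: eq_sphere_int => x /sphereE/fF.
apply: h => // x x1; rewrite -fF; last exact/sphereE.
exact: sphere_sup_ge pf x1.
Qed.

Lemma powR_exponent (t : R) (k l : nat) : 1 <= t -> (0 < k)%N -> (k <= l)%N ->
  t <= t `^ (l%:R / k%:R) /\ (t `^ (l%:R / k%:R)) ^+ k = t ^+ l.
Proof.
move=> t1 k0 kl; have t0 : 0 <= t by lra.
have kR : 0 < k%:R :> R by rewrite ltr0n.
split; last by rewrite -powR_mulrn ?powR_ge0// -powRrM divfK ?gt_eqF// powR_mulrn.
rewrite -{1}(powRr1 t0); apply: ler_powR => //.
by rewrite ler_pdivlMr// mul1r ler_nat.
Qed.

End curve_family.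

Theorem theorem1p1 (R : realType) (d : nat) (hd : (3 <= d)%N) :
  exists (eps : nat -> R) (gamma : nat -> R -> 'rV[R]_d.+1),
    [/\ forall t : nat, (1 <= t)%N ->
          0 <= eps t /\ approx_design_curve (eps t) t (gamma t),
        odd d ->
          asymp (fun t => curve_length (gamma t)) (fun t => t%:R ^+ (d - 1)),
        ~~ odd d ->
          asymp (fun t => curve_length (gamma t)) (fun t => t%:R ^+ (2 * d - 3)) &
        asymp eps (fun t => 1 / t%:R)].
Proof.
case: d hd => [//|[//|[//|n]]] _.
have [m [M [E [T0 [m0 E0 T01 fam]]]]] := @curve_family R n.+1.
have /choice[G HG] : forall T : R, exists gamma : R -> 'rV[R]_n.+4, T0 <= T ->
    [/\ sphere_curve gamma,
    m * T ^+ n.+2 <= curve_length gamma <= M * T ^+ n.+2 &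
    forall t f B, t%:R <= T -> plt t.+1 f -> (forall x, nsq x = 1 -> `|f x| <= B) ->
      `|(curve_length gamma)^-1 * curve_int gamma f - sphere_int f| <= E / T * B].
  move=> T; have [/fam[g hg]|_] := boolP (T0 <= T); first by exists g.
  by exists (fun=> 0).
(* With d = n + 3 the length is of order T^(d-1). For d even, the exponent (2d - 3) / (d - 1) makes
   T^(d-1) equal to t^(2d-3), and it is at least 1, so T is at least t. *)
pose base (t : nat) : R := if odd n.+3 then t%:R else t%:R `^ ((2 * n.+3 - 3)%N%:R / n.+2%:R).
have base_ge t : (1 <= t)%N -> t%:R <= base t.
  move=> t1; rewrite /base; case: ifP => // _.
  have [] := @powR_exponent R t%:R n.+2 (2 * n.+3 - 3) _ isT _ => //; last by lia.
  by rewrite ler1n.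
(* The maximum provides a curve for every t >= 1; from [N0] on it equals [base t], so the
   asymptotics are unaffected. *)
pose T t := Num.max T0 (base t).
have TT0 t : T0 <= T t by rewrite le_max lexx.
have Tge t : (1 <= t)%N -> t%:R <= T t by move=> /base_ge h; rewrite le_max h orbT.
have tpos t : (1 <= t)%N -> 0 < t%:R :> R by rewrite ltr0n.
pose N0 := (Num.truncn T0).+1.
have N0T t : (N0 <= t)%N -> T t = base t.
  move=> Nt; apply/max_idPr; have t1 : (1 <= t)%N by exact: leq_trans Nt.
  apply: le_trans (base_ge t t1); apply: ltW.
  by apply: lt_le_trans (truncnS_gt T0) _; rewrite ler_nat.
have asym (b : nat -> R) : (forall t, (N0 <= t)%N -> base t ^+ n.+2 = b t /\ 0 < b t) ->
    asymp (fun t => curve_length (G (T t))) b.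
  move=> hb; exists m, M; split=> //; exists N0 => // t /= Nt.
  have [e b0] := hb t Nt; have [_ + _] := HG _ (TT0 t).
  by rewrite (N0T t Nt) e ler_pdivlMr// ler_pdivrMr.
(* The tolerance is only an upper bound for the error of the curve, so it may be set to E / t
   exactly. The true bound E / T is no larger, T being at least t. *)
exists (fun t => E / t%:R), (fun t => G (T t)); split.
- move=> t t1; have t0 := tpos t t1; split; first by rewrite divr_ge0// ltW.
  have [cg /andP[L1 _] hg] := HG _ (TT0 t).
  have T0' : 0 < T t by apply: lt_le_trans (TT0 t); lra.
  apply: design_of_family => //; first by rewrite divr_ge0// ltW.
    by apply: lt_le_trans L1; rewrite mulr_gt0// exprn_gt0.
  move=> f B pf fB; apply: le_trans (hg t f B (Tge t t1) pf fB) _.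
  have B0 : 0 <= B.
    by apply: le_trans (sphere_int_le (plt_nice pf) fB); exact: normr_ge0.
  rewrite ler_wpM2r// ler_pM2l// lef_pV2 ?posrE//; exact: Tge.
- move=> od; apply: asym => t Nt; have t1 : (1 <= t)%N by exact: leq_trans Nt.
  by rewrite /base od subn1/=; split=> //; rewrite exprn_gt0// tpos.
- move=> ed; apply: asym => t Nt; have t1 : (1 <= t)%N by exact: leq_trans Nt.
  rewrite /base (negbTE ed); split; last by rewrite exprn_gt0// tpos.
  have [] := @powR_exponent R t%:R n.+2 (2 * n.+3 - 3) _ isT _ => //; last by lia.
  by rewrite ler1n.
exists E, E; split=> //; exists 1%N => // t /= t1; have t0 := tpos t t1.
have -> : E / t%:R / (1 / t%:R) = E by field; rewrite gt_eqF.
by rewrite lexx.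
Qed.
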